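(* If $M$ is any nonstandard model of $\mathrm{PA}$, or indeed merely of $IE_1$, then every countable model of set theory is isomorphic to a submodel of the hereditarily finite sets $\langle \mathrm{HF}^M,\in^M\rangle$ of $M$. Indeed, $\langle \mathrm{HF}^M,\in^M\rangle$ is universal for all countable acyclic binary relations: for every countable set $G$ with an acyclic binary relation $\rightharpoonup$ on it, the structure $\langle G,\rightharpoonup\rangle$ is isomorphic to a submodel of $\langle \mathrm{HF}^M,\in^M\rangle$.
   Context: $IE_1$ is the fragment of Peano arithmetic in which induction is restricted to bounded existential formulas. For a model $M$ of arithmetic, $\langle\mathrm{HF}^M,\in^M\rangle$ is the structure obtained in $M$ by Ackermann coding: its elements are the elements of $M$, and $n\in^M m$ holds iff $M$ satisfies ''the $n$-th binary bit of $m$ is $1$'' (expressed by the standard bounded formula of arithmetic). A binary relation $\rightharpoonup$ on $G$ is acyclic if there is no finite directed path (of length at least one) from a point of $G$ to itself. A submodel of a structure with a binary relation is an arbitrary subset with the restricted relation (an induced substructure). A model of set theory is a first-order structure $\langle N,\in^N\rangle$ satisfying at least the Kripke–Platek axioms KP; it need not be well-founded. *)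

(* Defs.v *)
From Stdlib Require Import Relations FinFun PeanoNat Lia.

Set Implicit Arguments.

(** * First-order formulas over a given type of atomic formulas

    Variables are de Bruijn indices: under a quantifier, variable 0 is the
    quantified one and variable [S i] is the variable [i] of the context. *)

Inductive form (A : Type) : Type :=
| Atom (a : A)
| Not (f : form A)
| And (f g : form A)
| Or (f g : form A)
| Imp (f g : form A)
| All (f : form A)
| Ex (f : form A).

Definition scons (D : Type) (d : D) (e : nat -> D) : nat -> D :=
  fun i => match i with 0 => d | S j => e j end.

Fixpoint sat (A D : Type) (I : (nat -> D) -> A -> Prop) (e : nat -> D)
    (f : form A) : Prop :=
  match f with
  | Atom a => I e a
  | Not g => ~ sat I e g
  | And g h => sat I e g /\ sat I e h
  | Or g h => sat I e g \/ sat I e h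
  | Imp g h => sat I e g -> sat I e h
  | All g => forall d, sat I (scons d e) g
  | Ex g => exists d, sat I (scons d e) g
  end.

Fixpoint qfree (A : Type) (f : form A) : Prop :=
  match f with
  | Atom _ => True
  | Not g => qfree g
  | And g h | Or g h | Imp g h => qfree g /\ qfree h
  | All _ | Ex _ => False
  end.

(** * Arithmetic *)

Inductive term : Type :=
| Var (i : nat)
| Zero
| One
| Add (s t : term)
| Mul (s t : term).

Inductive arith_atom : Type :=
| Eq (s t : term)
| Lt (s t : term).

Notation aform := (form arith_atom).

Record arith_structure : Type := {
  carrier :> Type;
  zero : carrier;
  one : carrier;
  add : carrier -> carrier -> carrier;
  mul : carrier -> carrier -> carrier;
  lt : carrier -> carrier -> Prop
}.

Arguments zero {_}.
Arguments one {_}.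
Arguments add {_}.
Arguments mul {_}.
Arguments lt {_}.

Fixpoint eval (M : arith_structure) (e : nat -> M) (t : term) : M :=
  match t with
  | Var i => e i
  | Zero => zero
  | One => one
  | Add s t => add (eval M e s) (eval M e t)
  | Mul s t => mul (eval M e s) (eval M e t)
  end.

Definition arith_interp (M : arith_structure) (e : nat -> M) (a : arith_atom)
    : Prop :=
  match a with
  | Eq s t => eval M e s = eval M e t
  | Lt s t => lt (eval M e s) (eval M e t)
  end.

Definition asat (M : arith_structure) (e : nat -> M) (f : aform) : Prop :=
  sat (arith_interp M) e f.

(** [lift k t] reads [t] under [k] additional quantifiers. *)
Fixpoint lift (k : nat) (t : term) : term :=
  match t with
  | Var i => Var (k + i)
  | Zero => Zero
  | One => One
  | Add s t => Add (lift k s) (lift k t)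
  | Mul s t => Mul (lift k s) (lift k t)
  end.

Definition fEq (s t : term) : aform := Atom (Eq s t).
Definition fLt (s t : term) : aform := Atom (Lt s t).
Definition fLe (s t : term) : aform := Or (fLt s t) (fEq s t).
Definition fIff (f g : aform) : aform := And (Imp f g) (Imp g f).

(** The lift keeps the bound variable out of the bounding term. *)
Definition bEx (t : term) (f : aform) : aform :=
  Ex (And (fLe (Var 0) (lift 1 t)) f).
Definition bAll (t : term) (f : aform) : aform :=
  All (Imp (fLe (Var 0) (lift 1 t)) f).

(** Bounded existential formulas: a block of bounded existential quantifiers
    in front of a quantifier-free formula. *)
Inductive E1 : aform -> Prop :=
| E1_qfree f : qfree f -> E1 f
| E1_bEx t f : E1 f -> E1 (bEx t f).

Inductive bounded : aform -> Prop :=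
| bounded_atom a : bounded (Atom a)
| bounded_not f : bounded f -> bounded (Not f)
| bounded_and f g : bounded f -> bounded g -> bounded (And f g)
| bounded_or f g : bounded f -> bounded g -> bounded (Or f g)
| bounded_imp f g : bounded f -> bounded g -> bounded (Imp f g)
| bounded_all t f : bounded f -> bounded (bAll t f)
| bounded_ex t f : bounded f -> bounded (bEx t f).

(** The theory PA^- of the nonnegative parts of discretely ordered rings. *)
Record PA_minus (M : arith_structure) : Prop := {
  pa_addA : forall x y z : M, add (add x y) z = add x (add y z);
  pa_addC : forall x y : M, add x y = add y x;
  pa_mulA : forall x y z : M, mul (mul x y) z = mul x (mul y z);
  pa_mulC : forall x y : M, mul x y = mul y x;
  pa_mulDr : forall x y z : M, mul x (add y z) = add (mul x y) (mul x z);
  pa_add0 : forall x : M, add x zero = x;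
  pa_mul0 : forall x : M, mul x zero = zero;
  pa_mul1 : forall x : M, mul x one = x;
  pa_lt_trans : forall x y z : M, lt x y -> lt y z -> lt x z;
  pa_lt_irr : forall x : M, ~ lt x x;
  pa_lt_total : forall x y : M, lt x y \/ x = y \/ lt y x;
  pa_lt_add : forall x y z : M, lt x y -> lt (add x z) (add y z);
  pa_lt_mul : forall x y z : M, lt zero z -> lt x y -> lt (mul x z) (mul y z);
  pa_sub : forall x y : M, lt x y -> exists z, add x z = y;
  pa_lt01 : lt (zero : M) one;
  pa_discrete : forall x : M, lt zero x -> lt one x \/ one = x;
  pa_nonneg : forall x : M, lt zero x \/ zero = x
}.

(** The induction axiom for [f] in variable 0, with all values of the
    remaining variables (the parameters). *)
Definition induction_for (M : arith_structure) (f : aform) : Prop :=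
  forall e : nat -> M,
    asat M (scons zero e) f ->
    (forall x, asat M (scons x e) f -> asat M (scons (add x one) e) f) ->
    forall x, asat M (scons x e) f.

Definition PA (M : arith_structure) : Prop :=
  PA_minus M /\ forall f, induction_for M f.

Definition IE1 (M : arith_structure) : Prop :=
  PA_minus M /\ forall f, E1 f -> induction_for M f.

Fixpoint numeral (M : arith_structure) (n : nat) : M :=
  match n with
  | 0 => zero
  | S n => add (numeral M n) one
  end.

Definition nonstandard (M : arith_structure) : Prop :=
  exists x : M, forall n, x <> numeral M n.

(** * Ackermann membership *)

Definition Two : term := Add One One.

(** [x] is a power of two: it is positive and each of its divisors is 1 or
    even. *)
Definition fPow (x : term) : aform :=
  And (fLt Zero x)
    (bAll x (bAll (lift 1 x)
      (Imp (fEq (Mul (Var 1) (Var 0)) (lift 2 x))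
        (Or (fEq (Var 1) One)
          (bEx (Var 1) (fEq (Var 2) (Add (Var 0) (Var 0)))))))).

(** [a < x] and [w = (h * x + a) * x + l] for some [h] and some [l < x]; for
    [x = 2^(2^i)] this says that [a] is the number written in the bits
    [2^i, ..., 2^(i+1) - 1] of [w], i.e. in the [i]-th block of [w]. *)
Definition fBlock (w x a : term) : aform :=
  And (fLt a x)
    (bEx w (bEx (lift 1 x)
      (And (fLt (Var 0) (lift 2 x))
        (fEq (lift 2 w)
          (Add (Mul (Add (Mul (Var 1) (lift 2 x)) (lift 2 a)) (lift 2 x))
               (Var 0)))))).

(** With [x_i = 2^(2^i)] and [k] maximal such that [x_k <= p], the codes
    [u, t, v, w] hold in their [i]-th blocks, for [i <= k], respectively
    1, [2^i], [n mod 2^i] and [2^(n mod 2^i)].  The block of [u] at a power of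
    two [x <= p] is 1 iff [x] is one of the [x_i]. *)
Definition fFlagged (u x : term) : aform := And (fPow x) (fBlock u x One).

Definition fCodes (u t v w n p : term) : aform :=
  And
    (And (And (fBlock u Two One) (fBlock t Two One))
         (And (fBlock v Two Zero) (fBlock w Two One)))
  (And
    (bAll p
      (Imp (fPow (Var 0))
        (fIff (fBlock (lift 1 u) (Var 0) One)
          (Or (fEq (Var 0) Two)
            (bEx (Var 0)
              (And (fEq (Var 1) (Mul (Var 0) (Var 0)))
                   (fFlagged (lift 2 u) (Var 0))))))))
    (bAll p
      (Imp (fFlagged (lift 1 u) (Var 0))
        (bEx (Var 0) (bEx (Var 1) (bEx (Var 2)
          (let x := Var 3 in let a := Var 2 in let b := Var 1 in
           let c := Var 0 in let x2 := Mul x x in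
           let t := lift 4 t in let v := lift 4 v in let w := lift 4 w in
           let n := lift 4 n in let p := lift 4 p in
           And
             (And (fBlock t x a) (And (fBlock v x b) (fBlock w x c)))
           (And
             (Imp (fLe x2 p)
               (And (fBlock t x2 (Add a a))
                 (Or (And (fBlock v x2 b) (fBlock w x2 c))
                     (And (fBlock v x2 (Add b a))
                          (fBlock w x2 (Mul c x))))))
             (Imp (fLt p x2)
               (And (fEq n (Add b a)) (fEq p (Mul c x)))))))))))).

(** [p = 2^n] *)
Definition fExp2 (n p : term) : aform :=
  let pp := Mul p p in
  Or (And (fEq n Zero) (fEq p One))
     (bEx pp (bEx (lift 1 pp) (bEx (lift 2 pp) (bEx (lift 3 pp)
       (fCodes (Var 3) (Var 2) (Var 1) (Var 0) (lift 4 n) (lift 4 p)))))).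

(** The [n]-th binary bit of [m] is 1, for [n] variable 0 and [m] variable 1:
    [m = (2 * h + 1) * 2^n + l] for some [h] and some [l < 2^n]. *)
Definition bit_formula : aform :=
  bEx (Var 1)
    (And (fExp2 (Var 1) (Var 0))
      (bEx (Var 2) (bEx (Var 1)
        (And (fLt (Var 0) (Var 2))
          (fEq (Var 4)
            (Add (Mul (Add (Add (Var 1) (Var 1)) One) (Var 2)) (Var 0))))))).

Lemma bit_formula_bounded : bounded bit_formula.
Proof. repeat constructor. Qed.

Definition HF_mem (M : arith_structure) : relation M :=
  fun n m => asat M (scons n (scons m (fun _ => zero))) bit_formula.

(** * Set theory *)

Inductive set_atom : Type :=
| SEq (i j : nat)
| SMem (i j : nat).

Notation sform := (form set_atom).

Definition set_interp (N : Type) (E : relation N) (e : nat -> N)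
    (a : set_atom) : Prop :=
  match a with
  | SEq i j => e i = e j
  | SMem i j => E (e i) (e j)
  end.

Definition ssat (N : Type) (E : relation N) (e : nat -> N) (f : sform) : Prop :=
  sat (set_interp E) e f.

Inductive Delta0 : sform -> Prop :=
| Delta0_atom a : Delta0 (Atom a)
| Delta0_not f : Delta0 f -> Delta0 (Not f)
| Delta0_and f g : Delta0 f -> Delta0 g -> Delta0 (And f g)
| Delta0_or f g : Delta0 f -> Delta0 g -> Delta0 (Or f g)
| Delta0_imp f g : Delta0 f -> Delta0 g -> Delta0 (Imp f g)
| Delta0_all i f : Delta0 f -> Delta0 (All (Imp (Atom (SMem 0 (S i))) f))
| Delta0_ex i f : Delta0 f -> Delta0 (Ex (And (Atom (SMem 0 (S i))) f)).

(** Kripke-Platek set theory, with foundation for all formulas and without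
    the axiom of infinity. *)
Record KP (N : Type) (E : relation N) : Prop := {
  kp_nonempty : inhabited N;
  kp_ext : forall x y, (forall z, E z x <-> E z y) -> x = y;
  kp_foundation : forall (f : sform) (e : nat -> N),
    (exists x, ssat E (scons x e) f) ->
    exists x, ssat E (scons x e) f /\
      forall y, E y x -> ~ ssat E (scons y e) f;
  kp_pair : forall x y, exists z, E x z /\ E y z;
  kp_union : forall x, exists u, forall y, E y x -> forall z, E z y -> E z u;
  kp_separation : forall (f : sform) (e : nat -> N), Delta0 f ->
    forall x, exists s, forall z, E z s <-> E z x /\ ssat E (scons z e) f;
  kp_collection : forall (f : sform) (e : nat -> N), Delta0 f ->
    forall x,
      (forall z, E z x -> exists y, ssat E (scons y (scons z e)) f) ->
      exists c, forall z, E z x ->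
        exists y, E y c /\ ssat E (scons y (scons z e)) f
}.

(** * Relational structures *)

(** Finite sets are countable. *)
Definition countable (T : Type) : Prop := exists f : T -> nat, Injective f.

Definition acyclic (G : Type) (R : relation G) : Prop :=
  forall x, ~ clos_trans G R x x.

Definition induced (T : Type) (R : relation T) (S : T -> Prop)
    : relation {x : T | S x} :=
  fun x y => R (proj1_sig x) (proj1_sig y).

Definition isomorphic (G H : Type) (R : relation G) (Q : relation H) : Prop :=
  exists f : G -> H, Bijective f /\ forall x y, R x y <-> Q (f x) (f y).

Definition isomorphic_to_submodel (G T : Type) (R : relation G)
    (Q : relation T) : Prop :=
  exists S : T -> Prop, isomorphic R (induced Q S).

(* Main.v *)
(** Almost no arithmetic is carried out inside the weak theory IE1; it is done
    in the standard model and transferred.  Let [phi] be quantifier-free in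
    [+, *, /, mod] and suppose that in the natural numbers for every [i] there
    are [k > 0] and parameters such that [phi] holds for all [x < k].
    Eliminating the bounded quantifier (Davis, Putnam, Robinson) and
    exponentiation (Pell equations) turns this into an existential statement, and two
    overspill arguments produce a nonstandard [i] with [k] and parameters in [M]
    such that [phi] holds for all [x < k] in [M].

    Apply this to the statement that certain numbers code, by Goedel's beta
    function, the powers of two, sets [F q] for [q < (i + 1)^2] and the
    certificates required by the bounded definition of [2^n], where [F q] is a
    member of [F q'] iff [q / (i + 1) < q' / (i + 1)] and [q mod (i + 1)],
    [q' mod (i + 1)] are adjacent in the Rado graph given by the binary digits.
    A countable acyclic relation then embeds into [M]: send its [n]-th point to
    [F q] with [q / (i + 1)] a level chosen recursively in the interval below
    [i], compatibly with the relation, and [q mod (i + 1)] a standard number,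
    chosen recursively so that the Rado graph yields the symmetrised relation.

    A model of KP is acyclic, because the points of a cycle form a definable
    class without a minimal element. *)

(* The obstacle is that induction in [M] covers only E1 formulas, so the elimination of the bounded
   universal quantifier is not carried out in [M]. All that is transferred is that a certificate,
   read in the natural numbers, is never wrong. Being wrong is an E1 property, so its failure
   spreads from all standard bounds to a nonstandard one, and what a nonstandard certificate means
   is never asked. For the same reason exponentiation may be replaced by a Pell relation that is
   correct at standard arguments only.

   The transferred statement has a single quantifier [x < k] over a formula without quantifiers.
   Whatever is later used about the coded sets must therefore be a local condition on pairs of table
   entries.

   Sets in the natural numbers can only code acyclic digraphs, whence the levels: they orient every
   edge upwards, and a nonstandard interval of them leaves room for any countable acyclic relation.
   The second coordinate can stay standard because the Rado graph on the natural numbers already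
   contains every countable graph. *)
From HB Require Import structures.
From mathcomp Require Import all_boot all_order all_algebra.
From mathcomp Require Import boolp.
From Stdlib Require Import Relations Ring Classical ClassicalEpsilon.
Require Import Defs.

Set Implicit Arguments.
Unset Strict Implicit.
Unset Printing Implicit Defensive.

Import Order.TTheory GRing.Theory Num.Theory.

(** * The ordered ring of differences *)

Definition le (A : arith_structure) (x y : A) := lt x y \/ x = y.

Section Differences.
Variable A : arith_structure.
Hypothesis hA : PA_minus A.

Lemma pa_semi_ring : @semi_ring_theory A zero one add mul eq.
Proof.
case: hA => aA aC mA mC dr a0 m0 m1 *.
have dl (x y z : A) : mul (add x y) z = add (mul x z) (mul y z).
  by rewrite mC dr !(mC z).
have a0l (x : A) : add zero x = x by rewrite aC.
have m0l (x : A) : mul zero x = zero by rewrite mC.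
have m1l (x : A) : mul one x = x by rewrite mC.
by split=> *; rewrite ?aA ?mA.
Qed.

Add Ring pa_ring : pa_semi_ring.

Lemma pa_addI (x y z : A) : add x z = add y z -> x = y.
Proof.
move=> e.
case: (pa_lt_total hA x y) => [h|[//|h]]; case: (@pa_lt_irr _ hA (add x z)).
- by rewrite {2}e; apply: pa_lt_add.
- by rewrite {1}e; apply: pa_lt_add.
Qed.

Definition diff_rel (p q : A * A) := add p.1 q.2 = add q.1 p.2.

(** Classes are taken as predicates on pairs so that equality of differences is Leibniz equality.
    The dummy argument lets the ring instances, whose laws need PA^-, be found from the type. *)
Definition diff (_ : PA_minus A) : Type :=
  {S : A * A -> Prop | exists p, S = diff_rel p}.
Local Notation D := (diff hA).

HB.instance Definition _ := gen_eqMixin D.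
HB.instance Definition _ := gen_choiceMixin D.

Definition diff_pi (p : A * A) : D :=
  exist (fun S => exists p, S = diff_rel p) (diff_rel p) (ex_intro _ p erefl).

Lemma diff_rel_trans q p r : diff_rel p q -> diff_rel q r -> diff_rel p r.
Proof.
rewrite /diff_rel => h1 h2; apply: (@pa_addI _ _ (add q.1 q.2)).
transitivity (add (add p.1 q.2) (add q.1 r.2)); first by ring.
by rewrite h1 h2; ring.
Qed.

Lemma diff_piE p q : diff_pi p = diff_pi q <-> diff_rel p q.
Proof.
split=> [[] h|h].
  by rewrite h /diff_rel.
apply: eq_exist => /=; apply/funext => r; apply/propext; split=> h'.
  by apply: diff_rel_trans h'; rewrite /diff_rel h.
exact: diff_rel_trans h h'.
Qed.

Lemma diff_surj (d : D) : exists p, d = diff_pi p.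
Proof. by case: d => S [p e]; exists p; apply: eq_exist. Qed.

Definition diff_repr (d : D) := proj1_sig (cid (diff_surj d)).
Lemma diff_reprK d : diff_pi (diff_repr d) = d.
Proof. by rewrite /diff_repr; case: cid. Qed.

Definition lift2 (f : A * A -> A * A -> A * A) (x y : D) :=
  diff_pi (f (diff_repr x) (diff_repr y)).

Lemma lift2E f p q :
  (forall p p' q q', diff_rel p p' -> diff_rel q q' -> diff_rel (f p q) (f p' q')) ->
  lift2 f (diff_pi p) (diff_pi q) = diff_pi (f p q).
Proof.
by move=> h; apply/diff_piE; apply: h; apply/diff_piE; rewrite diff_reprK.
Qed.

Definition diff_add := lift2 (fun p q => (add p.1 q.1, add p.2 q.2)).
Definition diff_mul := lift2 (fun p q =>
  (add (mul p.1 q.1) (mul p.2 q.2), add (mul p.1 q.2) (mul p.2 q.1))).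
Definition diff_opp (x : D) := diff_pi ((diff_repr x).2, (diff_repr x).1).

Lemma diff_addE p q :
  diff_add (diff_pi p) (diff_pi q) = diff_pi (add p.1 q.1, add p.2 q.2).
Proof.
apply: lift2E => {}p p' {}q q'; rewrite /diff_rel /= => h1 h2.
transitivity (add (add p.1 p'.2) (add q.1 q'.2)); first by ring.
by rewrite h1 h2; ring.
Qed.

Lemma diff_mulE p q : diff_mul (diff_pi p) (diff_pi q) =
  diff_pi (add (mul p.1 q.1) (mul p.2 q.2), add (mul p.1 q.2) (mul p.2 q.1)).
Proof.
apply: lift2E => {p q} - [a b] [c d] [e f] [g h] h1 h2.
rewrite /diff_rel /= in h1 h2.
apply: (@diff_rel_trans (add (mul c e) (mul d f), add (mul c f) (mul d e)));
  rewrite /diff_rel /=.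
- transitivity (add (mul (add a d) e) (mul (add c b) f)); first by ring.
  by rewrite h1 -{2}h1; ring.
- transitivity (add (mul c (add e h)) (mul d (add g f))); first by ring.
  by rewrite h2 -{2}h2; ring.
Qed.

Lemma diff_oppE p : diff_opp (diff_pi p) = diff_pi (p.2, p.1).
Proof.
rewrite /diff_opp; apply/diff_piE; rewrite /diff_rel /=.
have /diff_piE : diff_pi (diff_repr (diff_pi p)) = diff_pi p by rewrite diff_reprK.
rewrite /diff_rel => h; transitivity (add p.1 (diff_repr (diff_pi p)).2).
  ring.
by rewrite -h; ring.
Qed.

Definition diff_zero : D := diff_pi (zero, zero).
Definition diff_one : D := diff_pi (one, zero).

Ltac diff_tac := repeat (let x := fresh in intro x; case: (diff_surj x) => ? ->);
  rewrite /diff_zero /diff_one ?(diff_addE, diff_mulE, diff_oppE) /=;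
  apply/diff_piE; rewrite /diff_rel /=; ring.

Lemma diff_addA : associative diff_add. Proof. by diff_tac. Qed.
Lemma diff_addC : commutative diff_add. Proof. by diff_tac. Qed.
Lemma diff_add0 : left_id diff_zero diff_add. Proof. by diff_tac. Qed.
Lemma diff_addN : left_inverse diff_zero diff_opp diff_add. Proof. by diff_tac. Qed.
Lemma diff_mulA : associative diff_mul. Proof. by diff_tac. Qed.
Lemma diff_mulC : commutative diff_mul. Proof. by diff_tac. Qed.
Lemma diff_mul1 : left_id diff_one diff_mul. Proof. by diff_tac. Qed.
Lemma diff_mulD : left_distributive diff_mul diff_add. Proof. by diff_tac. Qed.

Lemma zero_neq_one : zero <> one :> A.
Proof. by move=> e; have := Defs.pa_lt01 hA; rewrite e => /(@pa_lt_irr _ hA). Qed.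

Lemma diff_one_neq0 : diff_one != diff_zero.
Proof.
apply/eqP => /diff_piE; rewrite /diff_rel /= => h; apply: zero_neq_one.
by apply: (@pa_addI _ _ zero); rewrite h; ring.
Qed.

HB.instance Definition _ := GRing.isZmodule.Build D
  diff_addA diff_addC diff_add0 diff_addN.
HB.instance Definition _ := GRing.Zmodule_isComNzRing.Build D
  diff_mulA diff_mulC diff_mul1 diff_mulD diff_one_neq0.

Definition emb (x : A) : D := diff_pi (x, zero).

Lemma emb_inj : injective emb.
Proof. by move=> x y /diff_piE /pa_addI. Qed.

Lemma embD x y : emb (add x y) = (emb x + emb y)%R.
Proof.
rewrite [RHS]diff_addE; apply/diff_piE; rewrite /diff_rel /=; ring.
Qed.

Lemma embM x y : emb (mul x y) = (emb x * emb y)%R.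
Proof.
rewrite [RHS]diff_mulE; apply/diff_piE; rewrite /diff_rel /=; ring.
Qed.

Lemma emb0 : emb zero = 0%R. Proof. by []. Qed.
Lemma emb1 : emb one = 1%R. Proof. by []. Qed.

(** Integral domains of MathComp carry an inverse; units are decided classically, and every other
    element is its own inverse. *)
Definition diff_unit : {pred D} := fun x => `[< exists y, y * x = 1 >]%R.
Definition diff_inv (x : D) : D :=
  if pselect (exists y, y * x = 1)%R is left h then proj1_sig (cid h) else x.

Lemma diff_mulVr : {in diff_unit, left_inverse 1%R diff_inv *%R}.
Proof.
move=> x /asboolP h; rewrite /diff_inv; case: pselect => // h'; by case: cid.
Qed.

Lemma diff_unitP (x y : D) : (y * x = 1)%R -> diff_unit x.
Proof. by move=> h; apply/asboolP; exists y. Qed.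

Lemma diff_invr0 : {in [predC diff_unit], diff_inv =1 id}.
Proof.
by move=> x; rewrite inE => /asboolP h; rewrite /diff_inv; case: pselect.
Qed.

HB.instance Definition _ := GRing.ComNzRing_hasMulInverse.Build D
  diff_mulVr diff_unitP diff_invr0.

Lemma diff_cases (d : D) : exists x : A, d = emb x \/ d = (- emb x)%R.
Proof.
have [[x y] ->] := diff_surj d.
have [h|[<-|h]] := pa_lt_total hA x y.
- have [z <-] := pa_sub hA _ _ h; exists z; right.
  rewrite [RHS]diff_oppE; apply/diff_piE; rewrite /diff_rel /=; ring.
- by exists zero; left; apply/diff_piE; rewrite /diff_rel /=; ring.
- have [z <-] := pa_sub hA _ _ h; exists z; left.
  by apply/diff_piE; rewrite /diff_rel /=; ring.
Qed.

Lemma pa_mul_eq0 (x y : A) : mul x y = zero -> x = zero \/ y = zero.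
Proof.
move=> h; have [hx|->] := pa_nonneg hA x; last by left.
have [hy|->] := pa_nonneg hA y; last by right.
have := pa_lt_mul hA _ _ _ hy hx; rewrite h (pa_mulC hA) (pa_mul0 hA).
by move/(@pa_lt_irr _ hA).
Qed.

Lemma diff_idom (x y : D) : (x * y = 0 -> (x == 0) || (y == 0))%R.
Proof.
have [a ha] := diff_cases x; have [b hb] := diff_cases y => h.
have : emb (mul a b) = 0%R.
  by rewrite embM; case: ha hb h => -> [] ->; rewrite ?(mulrN, mulNr) ?opprK // => /eqP;
     rewrite oppr_eq0 => /eqP.
rewrite -emb0 => /emb_inj /pa_mul_eq0 [] e; apply/orP; [left|right].
  by case: ha => ->; rewrite e emb0 ?oppr0.
by case: hb => ->; rewrite e emb0 ?oppr0.
Qed.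

HB.instance Definition _ := GRing.ComUnitRing_isIntegral.Build D diff_idom.

Definition diff_le (x y : D) : bool := `[< exists z : A, y = x + emb z >]%R.
Definition diff_lt (x y : D) : bool := (y != x) && diff_le x y.
Definition diff_norm (x : D) : D := if diff_le 0%R x then x else (- x)%R.

Lemma pa_add_eq0 (x y : A) : add x y = zero -> x = zero.
Proof.
move=> h; have [hx|-> //] := pa_nonneg hA x.
have := pa_lt_add hA _ _ y hx; rewrite h (pa_addC hA) (pa_add0 hA) => hy.
have [h0|e] := pa_nonneg hA y.
  by case: (pa_lt_irr hA _ (pa_lt_trans hA _ _ _ h0 hy)).
by rewrite -e in hy; case: (pa_lt_irr hA _ hy).
Qed.

Lemma diff_ge0P (x : D) : reflect (exists z, x = emb z) (diff_le 0%R x).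
Proof.
by apply: (iffP (asboolP _)) => -[z h]; exists z; rewrite h add0r.
Qed.

Lemma diff_le0_add (x y : D) : diff_le 0%R x -> diff_le 0%R y -> diff_le 0%R (x + y)%R.
Proof.
move=> /diff_ge0P[a ->] /diff_ge0P[b ->]; apply/diff_ge0P.
by exists (add a b); rewrite embD.
Qed.
Lemma diff_le0_mul (x y : D) : diff_le 0%R x -> diff_le 0%R y -> diff_le 0%R (x * y)%R.
Proof.
move=> /diff_ge0P[a ->] /diff_ge0P[b ->]; apply/diff_ge0P.
by exists (mul a b); rewrite embM.
Qed.
Lemma diff_le0_anti (x : D) : diff_le 0%R x -> diff_le x 0%R -> x = 0%R.
Proof.
move=> /diff_ge0P[a ->] /asboolP[b]; rewrite -emb0 -embD => /emb_inj /esym /pa_add_eq0 ->.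
by [].
Qed.
Lemma diff_sub_ge0 (x y : D) : diff_le 0%R (y - x)%R = diff_le x y.
Proof.
apply/diff_ge0P/asboolP => -[z h]; exists z; first by rewrite -h addrC subrK.
by rewrite h addrC addKr.
Qed.
Lemma diff_le0_total (x : D) : diff_le 0%R x || diff_le x 0%R.
Proof.
have [a [] ->] := diff_cases x; apply/orP; [left|right].
  by apply/diff_ge0P; exists a.
by apply/asboolP; exists a; rewrite addNr.
Qed.
Lemma diff_normN (x : D) : diff_norm (- x)%R = diff_norm x.
Proof.
rewrite /diff_norm; case: ifP => [h1|h1]; case: ifP => [h2|h2]; rewrite ?opprK //.
  have := @diff_le0_anti _ h2; rewrite -diff_sub_ge0 sub0r => /(_ h1) ->.
  by rewrite oppr0.
have := diff_le0_total x; rewrite h2 /= -diff_sub_ge0 sub0r.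
by rewrite h1.
Qed.
Lemma diff_ge0_norm (x : D) : diff_le 0%R x -> diff_norm x = x.
Proof. by rewrite /diff_norm => ->. Qed.
Lemma diff_lt_def (x y : D) : diff_lt x y = (y != x) && diff_le x y.
Proof. by []. Qed.

HB.instance Definition _ := Num.IntegralDomain_isLeReal.Build D
  diff_le0_add diff_le0_mul diff_le0_anti diff_sub_ge0 diff_le0_total
  diff_normN diff_ge0_norm diff_lt_def.

Lemma emb_ge0 x : (0 <= emb x)%R.
Proof. by apply/diff_ge0P; exists x. Qed.

Lemma emb_le x y : (emb x <= emb y)%R <-> le x y.
Proof.
split.
  move=> /asboolP[z]; rewrite -embD => /emb_inj ->.
  have [h|<-] := pa_nonneg hA z; last by right; ring.
  by left; have := pa_lt_add hA _ _ x h; congr lt; ring.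
move=> [/(@pa_sub _ hA _ _)[z <-]|-> //].
by rewrite embD lerDl emb_ge0.
Qed.

Lemma pa_le1 (x : A) : x = zero \/ le one x.
Proof.
have [/(@pa_discrete _ hA) [h|h]|->] := pa_nonneg hA x; [right; by left|right; by right|by left].
Qed.

(** By discreteness a strict inequality becomes a weak one with 1 added, in which form linear
    arithmetic over an ordered ring can exploit it. *)
Lemma emb_lt x y : (emb x + 1 <= emb y)%R <-> lt x y.
Proof.
rewrite -emb1 -embD emb_le; split.
  have h : lt x (add x one).
    by have := pa_lt_add hA _ _ x (Defs.pa_lt01 hA); congr lt; ring.
  by move=> [/(@pa_lt_trans _ hA _ _ _ h)|<-].
move=> /[dup] h /(@pa_sub _ hA _ _)[z e].
have [ez|] := pa_le1 z.
  by move: h; rewrite -e ez (pa_add0 hA) => /(@pa_lt_irr _ hA).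
by rewrite -!emb_le -e !embD lerD2l.
Qed.

End Differences.

(* Arithmetic in models of PA^- by decision procedures for ordered rings *)
From mathcomp Require Import ring lra zify.

Lemma pa_not_lt (A : arith_structure) (hA : PA_minus A) (x y : A) :
  ~ lt x y <-> le y x.
Proof.
split; first by case: (pa_lt_total hA x y) => [|[->|]] //; [right|left].
move=> h1 h2; case: h1 => [h1|h1]; last by case: (pa_lt_irr hA x); rewrite -{2}h1.
exact: (pa_lt_irr hA _ (pa_lt_trans hA _ _ _ h1 h2)).
Qed.

Lemma pa_not_le (A : arith_structure) (hA : PA_minus A) (x y : A) :
  ~ le x y <-> lt y x.
Proof.
rewrite -(pa_not_lt hA); split => [h|h h']; last exact: h'.
exact: contrapT h.
Qed.

Ltac emb_hyps hA :=
  repeat match goal with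
  | h : ~ lt ?x ?y |- _ => apply (proj1 (pa_not_lt hA x y)) in h
  | h : ~ le ?x ?y |- _ => apply (proj1 (pa_not_le hA x y)) in h
  | h : lt ?x ?y |- _ => apply (proj2 (emb_lt hA x y)) in h; rewrite ?(embD, embM, emb0, emb1) in h
  | h : le ?x ?y |- _ => apply (proj2 (emb_le hA x y)) in h; rewrite ?(embD, embM, emb0, emb1) in h
  | h : @eq (carrier _) ?x ?y |- _ => apply (f_equal (emb hA)) in h; rewrite ?(embD, embM, emb0, emb1) in h
  end.

Ltac emb_goal hA :=
  lazymatch goal with
  | |- lt _ _ => apply (proj1 (emb_lt hA _ _))
  | |- le _ _ => apply (proj1 (emb_le hA _ _))
  | |- ~ lt _ _ => apply (proj2 (pa_not_lt hA _ _)); apply (proj1 (emb_le hA _ _))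
  | |- ~ le _ _ => apply (proj2 (pa_not_le hA _ _)); apply (proj1 (emb_lt hA _ _))
  | |- @eq (carrier _) _ _ => apply (@emb_inj _ hA)
  | |- False => idtac
  end; rewrite ?(embD, embM, emb0, emb1).

(** Restores what the passage to the ring loses, namely that elements of the model are
    nonnegative. *)
Ltac emb_pos hA :=
  let T := fresh "T" in
  repeat match goal with
  | |- context [emb hA ?v] =>
    lazymatch goal with
    | _ : is_true (0 <= emb hA v)%R |- _ => fail
    | _ => have := emb_ge0 hA v; move=> ?
    end
  | h : context [emb hA ?v] |- _ =>
    lazymatch goal with
    | _ : is_true (0 <= emb hA v)%R |- _ => fail
    | _ => have := emb_ge0 hA v; move=> ?
    end
  end.

Ltac emb_all hA := emb_hyps hA; emb_goal hA; emb_pos hA.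
Ltac pa_lra hA := emb_all hA; lra.
Ltac pa_nra hA := emb_all hA; nra.
Ltac pa_ring hA := emb_goal hA; ring.


(** * Bounded existential definability *)

Fixpoint subt (sg : nat -> term) (t : term) : term :=
  match t with
  | Var i => sg i
  | Zero => Zero
  | One => One
  | Add s t => Add (subt sg s) (subt sg t)
  | Mul s t => Mul (subt sg s) (subt sg t)
  end.

Definition up (sg : nat -> term) (i : nat) : term :=
  if i is j.+1 then lift 1 (sg j) else Var 0.

Fixpoint subf (sg : nat -> term) (f : aform) : aform :=
  match f with
  | Atom (Eq s t) => Atom (Eq (subt sg s) (subt sg t))
  | Atom (Lt s t) => Atom (Lt (subt sg s) (subt sg t))
  | Not g => Not (subf sg g)
  | And g h => And (subf sg g) (subf sg h)
  | Or g h => Or (subf sg g) (subf sg h)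
  | Imp g h => Imp (subf sg g) (subf sg h)
  | All g => All (subf (up sg) g)
  | Ex g => Ex (subf (up sg) g)
  end.

Lemma eval_subt (A : arith_structure) (e : nat -> A) sg t :
  eval A e (subt sg t) = eval A (fun i => eval A e (sg i)) t.
Proof. by elim: t => //= s -> t ->. Qed.

Lemma eval_lift (A : arith_structure) (e : nat -> A) k t :
  eval A e (lift k t) = eval A (fun i => e (k + i)%coq_nat) t.
Proof. by elim: t => //= s -> t ->. Qed.

Lemma eval_lift1 (A : arith_structure) (d : A) (e : nat -> A) t :
  eval A (scons d e) (lift 1 t) = eval A e t.
Proof. by rewrite eval_lift. Qed.

Lemma scons_up (A : arith_structure) (d : A) (e : nat -> A) sg :
  (fun i => eval A (scons d e) (up sg i)) = scons d (fun i => eval A e (sg i)).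
Proof. by apply/funext => -[|i] //=; rewrite eval_lift1. Qed.

Lemma asat_subf (A : arith_structure) f : forall (e : nat -> A) sg,
  asat A e (subf sg f) <-> asat A (fun i => eval A e (sg i)) f.
Proof.
rewrite /asat; elim: f => [[s t|s t]|f IH|f IHf g IHg|f IHf g IHg|f IHf g IHg|f IH|f IH] e sg /=.
- by rewrite !eval_subt.
- by rewrite !eval_subt.
- by rewrite IH.
- by rewrite IHf IHg.
- by rewrite IHf IHg.
- by rewrite IHf IHg.
- by split=> h d; have := h d; rewrite IH scons_up.
- by split=> -[d h]; exists d; move: h; rewrite IH scons_up.
Qed.

Lemma subt_lift sg t : subt (up sg) (lift 1 t) = lift 1 (subt sg t).
Proof. by elim: t => //= s -> t ->. Qed.

Lemma qfree_subf sg f : qfree f -> qfree (subf sg f).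
Proof.
elim: f => [[s t|s t]|f IH|f IHf g IHg|f IHf g IHg|f IHf g IHg|f IH|f IH] //=;
  by case=> /IHf ? /IHg.
Qed.

Lemma E1_subf f : E1 f -> forall sg, E1 (subf sg f).
Proof.
elim=> {}f; first by move=> q sg; apply: E1_qfree; apply: qfree_subf.
move=> g _ IH sg; rewrite /bEx /=.
rewrite subt_lift; exact: E1_bEx.
Qed.

Section E1def.
Variable A : arith_structure.
Hypothesis hA : PA_minus A.
Implicit Types (P Q : (nat -> A) -> Prop) (e : nat -> A).

(** A semantic notion, because the prenex class [E1] is closed under conjunction and disjunction
    only up to equivalence. *)
Definition E1def P := exists f, E1 f /\ forall e, asat A e f <-> P e.

Lemma E1def_ext P Q : E1def P -> (forall e, P e <-> Q e) -> E1def Q.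
Proof. by move=> [f [h1 h2]] h; exists f; split=> // e; rewrite h2 h. Qed.

Lemma E1def_qf f : qfree f -> E1def (fun e => asat A e f).
Proof. by move=> h; exists f; split=> //; apply: E1_qfree. Qed.

Lemma E1def_eq s t : E1def (fun e => eval A e s = eval A e t).
Proof. by apply: (E1def_ext (@E1def_qf (fEq s t) I)). Qed.

Lemma E1def_neq s t : E1def (fun e => eval A e s <> eval A e t).
Proof. by apply: (E1def_ext (@E1def_qf (Not (fEq s t)) I)). Qed.

Lemma E1def_lt s t : E1def (fun e => lt (eval A e s) (eval A e t)).
Proof. by apply: (E1def_ext (@E1def_qf (fLt s t) I)). Qed.

Lemma E1def_le s t : E1def (fun e => le (eval A e s) (eval A e t)).
Proof. by apply: (E1def_ext (@E1def_qf (fLe s t) (conj I I))). Qed.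

Lemma E1def_sub sg P : E1def P -> E1def (fun e => P (fun i => eval A e (sg i))).
Proof.
move=> [f [h1 h2]]; exists (subf sg f); split; first exact: E1_subf.
by move=> e; rewrite asat_subf h2.
Qed.

Lemma E1def_ren r P : E1def P -> E1def (fun e => P (fun i => e (r i))).
Proof. exact: (@E1def_sub (fun i => Var (r i))). Qed.

Lemma E1def_ex t P : E1def P ->
  E1def (fun e => exists y, le y (eval A e t) /\ P (scons y e)).
Proof.
move=> [f [h1 h2]]; exists (bEx t f); split; first exact: E1_bEx.
move=> e; rewrite /bEx /asat /=; split=> -[y [h3 h4]]; exists y;
  rewrite eval_lift1 in h3 *; split=> //; exact/h2.
Qed.

(** Prenexing for conjunction and disjunction at once. Disjunction commutes with a bounded
    quantifier only over a nonempty range; 0 lies below every bound. *)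
Lemma E1def_op (op : Prop -> Prop -> Prop) (fop : aform -> aform -> aform) :
  (forall f g, qfree f -> qfree g -> qfree (fop f g)) ->
  (forall e f g, asat A e (fop f g) <-> op (asat A e f) (asat A e g)) ->
  (forall R S R' S', (R <-> R') -> (S <-> S') -> op R S -> op R' S') ->
  (forall R S, op R S -> op S R) ->
  (forall (T : Type) (B R : T -> Prop) S, (exists x, B x) ->
     op (exists x, B x /\ R x) S <-> exists x, B x /\ op (R x) S) ->
  forall P Q, E1def P -> E1def Q -> E1def (fun e => op (P e) (Q e)).
Proof.
move=> hq hs hop hC hex P Q [f [hf hP]] [g [hg hQ]].
have {hop}opE R S R' S' : (R <-> R') -> (S <-> S') -> op R S <-> op R' S'.
  by move=> h1 h2; split; apply: hop; tauto.
have {}hC R S : op R S <-> op S R by split; apply: hC.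
suff h : E1def (fun e => op (asat A e f) (asat A e g)).
  by apply: (E1def_ext h) => e; apply: opE; [apply: hP|apply: hQ].
have step t P' Q' : E1def (fun e => op (P' e) (Q' (fun i => e i.+1))) ->
  E1def (fun e => op (exists y, le y (eval A e t) /\ P' (scons y e)) (Q' e)).
  move=> /(E1def_ex t) h; apply: (E1def_ext h) => e.
  rewrite hex; last first.
    exists zero; case: (pa_nonneg hA (eval A e t)) => [|<-]; [by left|by right].
  by [].
have bExE e t f' : asat A e (bEx t f') <->
  exists y, le y (eval A e t) /\ asat A (scons y e) f'.
  by rewrite /bEx /asat /=; split=> -[y [h3 h4]]; exists y;
     rewrite eval_lift1 in h3 *.
elim: hf g hg {P Q hP hQ} => [{}f hf g hg|t {}f _ IH g hg].
  elim: hg f hf => [{}g hg f hf|t {}g _ IH f hf].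
    by apply: (E1def_ext (E1def_qf (hq _ _ hf hg))).
  have := IH (subf (fun i => Var i.+1) f) (qfree_subf _ hf).
  move=> h; apply: (E1def_ext (step t (fun e => asat A e g) (fun e => asat A e f) _)).
    apply: (E1def_ext h) => e; rewrite hC; apply: opE => //.
    by rewrite asat_subf.
  by move=> e; rewrite hC; apply: opE => //; symmetry; apply: bExE.
have := IH (subf (fun i => Var i.+1) g) (E1_subf hg _) => h.
apply: (E1def_ext (step t (fun e => asat A e f) (fun e => asat A e g) _)).
  by apply: (E1def_ext h) => e; apply: opE => //; rewrite asat_subf.
by move=> e; apply: opE => //; symmetry; apply: bExE.
Qed.

Lemma E1def_and P Q : E1def P -> E1def Q -> E1def (fun e => P e /\ Q e).
Proof.
move: P Q; refine (@E1def_op and (@And _) _ _ _ _ _) => //; try tauto.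
move=> T B R S [x hx]; split.
  by move=> [[y [? ?]] ?]; exists y.
by move=> [y [? [? ?]]]; split=> //; exists y.
Qed.

Lemma E1def_or P Q : E1def P -> E1def Q -> E1def (fun e => P e \/ Q e).
Proof.
move: P Q; refine (@E1def_op or (@Or _) _ _ _ _ _) => //; try tauto.
move=> T B R S [x hx]; split.
  move=> [[y [? ?]]|?]; [exists y|exists x]; tauto.
by move=> [y [? [?|?]]]; [left; exists y|right].
Qed.

(** The bounded block of existential quantifiers over variables [0, ..., r-1];
    the bound does not depend on them. *)
Definition cat_env (T : Type) (r : nat) (v e : nat -> T) : nat -> T :=
  fun i => if i < r then v i else e (i - r).

Lemma E1def_exs r t P : E1def P ->
  E1def (fun e => exists v : nat -> A, (forall j, j < r -> le (v j) (eval A e t)) /\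
                       P (cat_env r v e)).
Proof.
elim: r t P => [|r IH] t P hP.
  apply: (E1def_ext hP) => e; rewrite /cat_env /=.
  have -> : (fun i => e (i - 0)) = e by apply/funext => i; rewrite subn0.
  by split=> [?|[v [_ ?]]//]; exists (fun=> zero).
have := IH t _ (E1def_ex (lift r t) hP).
move=> h; apply: (E1def_ext h) => e.
have ct (v : nat -> A) : eval A (cat_env r v e) (lift r t) = eval A e t.
  rewrite eval_lift; congr eval; apply/funext => i; rewrite /cat_env plusE.
  by rewrite ltnNge leq_addr /= addKn.
have cs (v : nat -> A) y : scons y (cat_env r v e) = cat_env r.+1 (scons y v) e.
  by apply/funext => -[|i]; rewrite /cat_env /= ?ltnS ?subSS.
split.
  move=> [v [h1 [y [h2 h3]]]]; exists (scons y v); split; last by rewrite -cs.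
  by case=> [_|j /h1//]; rewrite -(ct v).
move=> [v [h1 h2]]; exists (fun i => v i.+1); split; first by move=> j hj; apply: h1.
exists (v 0); rewrite ct cs; split; first exact: h1.
by have -> : scons (v 0) (fun i => v i.+1) = v by apply/funext => -[].
Qed.

End E1def.

(** * Standard elements and overspill *)

Section Numerals.
Variable M : arith_structure.
Hypothesis hM : PA_minus M.
Local Notation num := (numeral M).

Definition std (x : M) := exists n, x = num n.

Lemma emb_num n : emb hM (num n) = n%:R%R.
Proof. by elim: n => [|n IH] //=; rewrite embD IH emb1 natr1. Qed.

Lemma numD m n : num (m + n) = add (num m) (num n).
Proof. by apply: (@emb_inj _ hM); rewrite embD !emb_num natrD. Qed.

Lemma numM m n : num (m * n) = mul (num m) (num n).
Proof. by apply: (@emb_inj _ hM); rewrite embM !emb_num natrM. Qed.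

Lemma num_le m n : le (num m) (num n) <-> m <= n.
Proof. by rewrite -(emb_le hM) !emb_num ler_nat. Qed.

Lemma num_lt m n : lt (num m) (num n) <-> m < n.
Proof. by rewrite -(emb_lt hM) !emb_num natr1 ler_nat. Qed.

Lemma num_inj : injective num.
Proof.
by move=> m n e; apply/eqP; rewrite eqn_leq; apply/andP; split; apply/num_le; rewrite e; right.
Qed.

Lemma std_le x n : le x (num n) -> std x.
Proof.
elim: n => [|n IH] h; first by exists 0; pa_lra hM.
have [h'|h'] := classic (le x (num n)); first exact: IH.
by exists n.+1 => /=; rewrite /= in h; pa_lra hM.
Qed.

Lemma std_le_std x y : le x y -> std y -> std x.
Proof. by move=> h [n e]; apply: (@std_le _ n); rewrite -e. Qed.

Lemma nstd_gt x n : ~ std x -> lt (num n) x.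
Proof. by move=> h; apply/(pa_not_le hM) => /std_le. Qed.

Lemma nstd_pred x : ~ std x -> exists y, x = add y one /\ ~ std y.
Proof.
move=> h; have := nstd_gt 0 h => /= h0.
have h1 : le one x by pa_lra hM.
case: h1 => [/(@pa_sub _ hM _ _)[y e]|e]; last by case: h; exists 1; rewrite -e; pa_lra hM.
exists y; split; first by rewrite -e; pa_lra hM.
by move=> [n en]; apply: h; exists n.+1; rewrite -e en; pa_lra hM.
Qed.

End Numerals.

Section IE1.
Variable M : arith_structure.
Hypothesis hIE1 : IE1 M.
Let hM : PA_minus M := proj1 hIE1.
Local Notation num := (numeral M).

Lemma E1_ind (P : (nat -> M) -> Prop) e : E1def P -> P (scons zero e) ->
  (forall x, P (scons x e) -> P (scons (add x one) e)) ->
  forall x, P (scons x e).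
Proof.
move=> [f [/(proj2 hIE1) h1 h2]] h0 hS x.
by rewrite -h2; apply: h1 => [|y]; rewrite !h2 //; apply: hS.
Qed.

(** Induction runs down from [x]: [Q] at [z] says that some [y <= x - z] satisfies [P]. *)
Lemma E1_least (P : (nat -> M) -> Prop) e x : E1def P -> P (scons x e) ->
  exists y, P (scons y e) /\ forall z, lt z y -> ~ P (scons z e).
Proof.
move=> hP hx; apply: contrapT => hn.
pose Q := fun e : nat -> M => exists y, le y (e 1) /\
  (le (add y (e 0)) (e 1) /\ P (scons y (fun i => e i.+2))).
have hQ : E1def Q.
  have h1 := E1def_le M (Add (Var 0) (Var 1)) (Var 2).
  have h2 := E1def_ren (fun i => if i is j.+1 then j.+3 else 0) hP.
  apply: (E1def_ext (E1def_ex (Var 1) (E1def_and hM h1 h2))) => e' /=.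
  have E (y : M) : (fun i : nat => scons y e' match i with 0 => 0 | j.+1 => j.+3 end) =
    scons y (fun i => e' i.+2) by apply/funext => -[].
  by split=> -[y [h3 [h4 h5]]]; exists y; split=> //; split=> //; move: h5; rewrite /Q E.
have : Q (scons (add x one) (scons x e)).
  apply: (E1_ind hQ); first by exists x; split; [right|split; [pa_lra hM|]].
  move=> y [/= z [h1 [h2 h3]]].
  have [w hw] : exists w, lt w z /\ P (scons w e).
    apply: contrapT => h; apply: hn; exists z; split=> // w hw hPw; apply: h.
    by exists w.
  by exists w; move: hw => [hw hPw]; split; [|split] => //=; pa_lra hM.
by move=> [y [/= h1 [h2 _]]]; pa_lra hM.
Qed.

Hypothesis hns : nonstandard M.

Lemma exists_nstd : exists a : M, ~ std a.
Proof. by case: hns => a ha; exists a => -[n]; apply: ha. Qed.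

(** If [P] held at no nonstandard element it would define the standard cut, which contains 0 and is
    closed under successor; induction would then make every element standard. *)
Lemma E1_overspill (P : (nat -> M) -> Prop) e : E1def P ->
  (forall n, P (scons (num n) e)) -> exists x, ~ std x /\ P (scons x e).
Proof.
move=> hP hn; apply: contrapT => h; have [a ha] := exists_nstd.
have h' x : P (scons x e) -> std x.
  by move=> hx; apply: contrapT => hx'; apply: h; exists x.
apply: h; exists a; split=> //.
apply: (E1_ind hP); first exact: (hn 0).
by move=> x /h' [n ->]; apply: (hn n.+1).
Qed.

(** If [P] held at every nonstandard element, it would hold at [a - z] by induction on [z]: since
    [P] fails at standard numbers, [a - z] is nonstandard, hence so is its predecessor. At [z = a]
    this contradicts the hypothesis at 0. *)
Lemma U1_overspill (P : (nat -> M) -> Prop) e : E1def P ->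
  (forall n, ~ P (scons (num n) e)) -> exists x, ~ std x /\ ~ P (scons x e).
Proof.
move=> hP hn; apply: contrapT => h; have [a ha] := exists_nstd.
have h' x : ~ std x -> P (scons x e).
  by move=> hx; apply: contrapT => hx'; apply: h; exists x.
pose Q := fun e : nat -> M => exists y, le y (e 1) /\
  (add y (e 0) = e 1 /\ P (scons y (fun i => e i.+2))).
have hQ : E1def Q.
  have h1 := E1def_eq M (Add (Var 0) (Var 1)) (Var 2).
  have h2 := E1def_ren (fun i => if i is j.+1 then j.+3 else 0) hP.
  apply: (E1def_ext (E1def_ex (Var 1) (E1def_and hM h1 h2))) => e' /=.
  have E (y : M) : (fun i : nat => scons y e' match i with 0 => 0 | j.+1 => j.+3 end) =
    scons y (fun i => e' i.+2) by apply/funext => -[].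
  by split=> -[y [h3 [h4 h5]]]; exists y; split=> //; split=> //; move: h5; rewrite /Q E.
have : Q (scons a (scons a e)).
  apply: (E1_ind hQ).
    by exists a; split; [right|split; [rewrite /=; pa_lra hM|apply: h']].
  move=> y [/= z [h1 [h2 h3]]].
  have hz : ~ std z by move=> [n ez]; rewrite ez in h3; apply: hn h3.
  have [w [ew hw]] := nstd_pred hM hz.
  exists w; split; [|split] => /=; [pa_lra hM|pa_lra hM|exact: h'].
move=> [y [/= h1 [h2 h3]]]; apply: (hn 0).
by have -> : num 0 = y by rewrite /=; pa_lra hM.
Qed.

End IE1.

(** * Division with remainder *)

(** In models of IE1 the quotient and the remainder have existential bounded
    graphs, so both a quantifier-free formula in them and its negation are
    bounded existential. *)
Inductive dterm : Type :=
| DVar (i : nat)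
| DZero
| DOne
| DAdd (s t : dterm)
| DMul (s t : dterm)
| DDiv (s t : dterm)
| DMod (s t : dterm).

Inductive dform : Type :=
| DEq (s t : dterm)
| DLt (s t : dterm)
| DNot (f : dform)
| DAnd (f g : dform)
| DOr (f g : dform)
| DImp (f g : dform).

(** Isolated as a hypothesis so that division is available both in the natural numbers and in the
    given model. *)
Definition euclidean (A : arith_structure) := forall x y : A, lt zero y ->
  exists q r, lt r y /\ x = add (mul q y) r.

Section Division.
Variable A : arith_structure.
Hypothesis hA : PA_minus A.
Hypothesis hE : euclidean A.

Definition is_div (x y q : A) :=
  (y = zero /\ q = zero) \/ (le (mul q y) x /\ lt x (add (mul q y) y)).

(** As in the natural numbers, [x / 0 = 0] and [x mod 0 = x]. *)
Definition ediv (x y : A) : A := epsilon (inhabits zero) (is_div x y).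
Definition emod (x y : A) : A :=
  epsilon (inhabits zero) (fun r => x = add (mul (ediv x y) y) r).

Lemma pa_pos (x : A) : x <> zero -> lt zero x.
Proof. by move=> h; case: (pa_nonneg hA x) => // /esym. Qed.

Lemma is_div_ediv x y : is_div x y (ediv x y).
Proof.
apply: epsilon_spec; have [->|h] := classic (y = zero).
  by exists zero; left.
have [q [r [h1 ->]]] := hE x (pa_pos h); exists q; right; split; pa_lra hA.
Qed.

Lemma is_div_uniq x y q q' : is_div x y q -> is_div x y q' -> q = q'.
Proof.
move=> [[-> ->]|[h1 h2]] [[e1 e2]|[h3 h4]] //.
- by case: (pa_not_lt hA x (add (mul q' zero) zero)) => _; case=> //; pa_lra hA.
- by move: h1 h2; rewrite e1 => h1 h2; exfalso; pa_lra hA.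
have lr u v : le (mul u y) x -> lt x (add (mul v y) y) -> le u v.
  by move=> h h'; apply/pa_not_lt => // h''; pa_nra hA.
by have a := lr _ _ h1 h4; have b := lr _ _ h3 h2; pa_lra hA.
Qed.

Lemma edivE x y q : is_div x y q -> ediv x y = q.
Proof. by move=> h; apply: is_div_uniq h; apply: is_div_ediv. Qed.

Lemma ediv_eq x y : x = add (mul (ediv x y) y) (emod x y).
Proof.
rewrite /emod; pose P := fun r => x = add (mul (ediv x y) y) r.
apply: (epsilon_spec (inhabits zero) P); rewrite /P => {P}.
have [[e1 e2]|[[h|h] _]] := is_div_ediv x y.
- by exists x; rewrite e2 e1; pa_lra hA.
- by have [z e] := pa_sub hA _ _ h; exists z.
- by exists zero; pa_lra hA.
Qed.

Lemma emod_lt x y : y <> zero -> lt (emod x y) y.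
Proof.
move=> hy; have := ediv_eq x y; case: (is_div_ediv x y) => [[]//|[_ h] e].
by pa_lra hA.
Qed.

Lemma ediv0 x : ediv x zero = zero.
Proof. by apply: edivE; left. Qed.

Lemma ediv_emodE x y q r : lt r y -> x = add (mul q y) r ->
  ediv x y = q /\ emod x y = r.
Proof.
move=> h1 h2; have e : ediv x y = q.
  by apply: edivE; right; split; pa_lra hA.
by split=> //; have := ediv_eq x y; rewrite e => h; pa_lra hA.
Qed.

Lemma ediv_le x y : le (ediv x y) x.
Proof.
have := ediv_eq x y; have [->|/pa_pos hy e] := classic (y = zero).
  by rewrite ediv0 => _; pa_lra hA.
by apply/pa_not_lt => // h; pa_nra hA.
Qed.

Lemma emod_le x y : le (emod x y) x.
Proof. by have := ediv_eq x y => h; pa_nra hA. Qed.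

Fixpoint deval (e : nat -> A) (t : dterm) : A :=
  match t with
  | DVar i => e i
  | DZero => zero
  | DOne => one
  | DAdd s t => add (deval e s) (deval e t)
  | DMul s t => mul (deval e s) (deval e t)
  | DDiv s t => ediv (deval e s) (deval e t)
  | DMod s t => emod (deval e s) (deval e t)
  end.

Fixpoint dsat (e : nat -> A) (f : dform) : Prop :=
  match f with
  | DEq s t => deval e s = deval e t
  | DLt s t => lt (deval e s) (deval e t)
  | DNot f => ~ dsat e f
  | DAnd f g => dsat e f /\ dsat e g
  | DOr f g => dsat e f \/ dsat e g
  | DImp f g => dsat e f -> dsat e g
  end.

Definition tail_env (T : Type) (e : nat -> T) : nat -> T := fun i => e i.+1.

(** The bounding term is what turns the substitution of [g] into an E1 definable property into a
    bounded quantifier. *)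
Definition E1fun (g : (nat -> A) -> A) :=
  (exists b, forall e, le (g e) (eval A e b)) /\
  E1def (fun e => e 0 = g (tail_env e)).

Lemma E1def_fun g P : E1fun g -> E1def P -> E1def (fun e => P (scons (g e) e)).
Proof.
move=> [[b hb] hg] hP.
apply: (E1def_ext (E1def_ex b (E1def_and hA hg hP))) => e; split.
  by move=> [y [_ [/= -> h]]].
by move=> h; exists (g e); split.
Qed.

Lemma E1fun_tail g : E1fun g -> E1fun (fun e => g (tail_env e)).
Proof.
move=> [[b hb] hg]; split.
  by exists (lift 1 b) => e; rewrite eval_lift; apply: hb.
exact: (E1def_ren (fun i => if i is j.+1 then j.+2 else 0) hg).
Qed.

(** Monotonicity of the bound [b] lets the bounds of the two arguments be substituted into it. *)
Lemma E1fun_op (op : A -> A -> A) b g1 g2 :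
  (forall x y e, le (op x y) (eval A (scons x (scons y e)) b)) ->
  (forall x y x' y' e, le x x' -> le y y' ->
    le (eval A (scons x (scons y e)) b) (eval A (scons x' (scons y' e)) b)) ->
  E1def (fun e => e 2 = op (e 0) (e 1)) ->
  E1fun g1 -> E1fun g2 -> E1fun (fun e => op (g1 e) (g2 e)).
Proof.
move=> hb hm ho h1 h2; split.
  have [[b1 hb1] _] := h1; have [[b2 hb2] _] := h2.
  exists (subt (scons b1 (scons b2 Var)) b) => e; rewrite eval_subt.
  have -> : (fun i => eval A e (scons b1 (scons b2 Var) i)) =
     scons (eval A e b1) (scons (eval A e b2) e).
    by apply/funext => -[|[]].
  have := hb (g1 e) (g2 e) e; have := hm _ _ _ _ e (hb1 e) (hb2 e) => h h'.
  by pa_lra hA.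
have h := E1def_fun (E1fun_tail h2) (E1def_fun (E1fun_tail (E1fun_tail h1)) ho).
exact: h.
Qed.

Lemma E1fun_var i : E1fun (fun e => e i).
Proof. by split; [exists (Var i) => e; right|apply: (E1def_eq A (Var 0) (Var i.+1))]. Qed.

Lemma E1def_is_div i j k : E1def (fun e => is_div (e i) (e j) (e k)).
Proof.
apply: E1def_or => //; apply: E1def_and => //.
- exact: (E1def_eq A (Var j) Zero).
- exact: (E1def_eq A (Var k) Zero).
- exact: (E1def_le A (Mul (Var k) (Var j)) (Var i)).
- exact: (E1def_lt A (Var i) (Add (Mul (Var k) (Var j)) (Var j))).
Qed.

Lemma pa_le_mul (x y x' y' : A) : le x x' -> le y y' -> le (mul x y) (mul x' y').
Proof. by move=> h1 h2; pa_nra hA. Qed.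

Lemma E1fun_deval t : E1fun (fun e => deval e t).
Proof.
elim: t => [i|||s IHs t IHt|s IHs t IHt|s IHs t IHt|s IHs t IHt] /=.
- exact: E1fun_var.
- by split; [exists Zero => e; right|apply: (E1def_eq A (Var 0) Zero)].
- by split; [exists One => e; right|apply: (E1def_eq A (Var 0) One)].
- apply: (@E1fun_op add (Add (Var 0) (Var 1))) IHs IHt => /=; first by right.
    by move=> *; pa_lra hA.
  exact: (E1def_eq A (Var 2) (Add (Var 0) (Var 1))).
- apply: (@E1fun_op mul (Mul (Var 0) (Var 1))) IHs IHt => /=; first by right.
    by move=> *; apply: pa_le_mul.
  exact: (E1def_eq A (Var 2) (Mul (Var 0) (Var 1))).
- apply: (@E1fun_op ediv (Var 0)) IHs IHt => //= [x y _|]; first exact: ediv_le.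
  apply: (E1def_ext (E1def_is_div 0 1 2)) => e; split=> [/edivE ->//|->].
  exact: is_div_ediv.
- apply: (@E1fun_op emod (Var 0)) IHs IHt => //= [x y _|]; first exact: emod_le.
  have h := E1def_eq A (Var 1) (Add (Mul (Var 0) (Var 2)) (Var 3)).
  apply: (E1def_ext (E1def_ex (Var 0) (E1def_and hA h (E1def_is_div 1 2 0)))) => e /=.
  split=> [[q [_ [e1 /edivE e2]]]|->].
    by have := ediv_eq (e 0) (e 1); rewrite e2 => h3; pa_lra hA.
  exists (ediv (e 0) (e 1)); split; first exact: ediv_le.
  by split; [exact: ediv_eq|exact: is_div_ediv].
Qed.

Lemma E1def_deval2 P s t : E1def P ->
  E1def (fun e => P (scons (deval e s) (scons (deval e t) e))).
Proof.
move=> hP.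
have h := E1def_fun (E1fun_deval t) (E1def_fun (E1fun_tail (E1fun_deval s)) hP).
exact: h.
Qed.

Lemma E1def_dsat_not f : E1def (fun e => dsat e f) /\ E1def (fun e => ~ dsat e f).
Proof.
elim: f => /= [s t|s t|f [h1 h2]|f [h1 h2] g [h3 h4]|f [h1 h2] g [h3 h4]|f [h1 h2] g [h3 h4]].
- split; first exact: (E1def_deval2 s t (E1def_eq A (Var 0) (Var 1))).
  exact: (E1def_deval2 s t (E1def_neq A (Var 0) (Var 1))).
- split; first exact: (E1def_deval2 s t (E1def_lt A (Var 0) (Var 1))).
  apply: (E1def_ext (E1def_deval2 s t (E1def_le A (Var 1) (Var 0)))) => e /=.
  by rewrite pa_not_lt.
- by split=> //; apply: (E1def_ext h1) => e; split; [move=> ? []|exact: contrapT].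
- split; first exact: E1def_and.
  by apply: (E1def_ext (E1def_or hA h2 h4)) => e; split; tauto.
- split; first exact: E1def_or.
  by apply: (E1def_ext (E1def_and hA h2 h4)) => e; split; tauto.
- split; first by apply: (E1def_ext (E1def_or hA h2 h3)) => e; split; tauto.
  by apply: (E1def_ext (E1def_and hA h1 h4)) => e; split; tauto.
Qed.

Definition E1def_dsat f := proj1 (E1def_dsat_not f).

End Division.

Lemma IE1_euclidean (M : arith_structure) : IE1 M -> euclidean M.
Proof.
move=> hI; have hM := proj1 hI => x y hy.
pose P := fun e : nat -> M =>
  exists q, le q (e 0) /\ exists r, le r (e 1) /\ (lt r (e 1) /\ e 0 = add (mul q (e 1)) r).
have hP : E1def P.
  have h1 := E1def_lt M (Var 0) (Var 3).
  have h2 := E1def_eq M (Var 2) (Add (Mul (Var 1) (Var 3)) (Var 0)).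
  exact: (E1def_ext (E1def_ex (Var 0) (E1def_ex (Var 2) (E1def_and hM h1 h2)))).
have [q [_ [r [_ h]]]] : P (scons x (scons y (fun=> zero))); last by exists q, r.
apply: (E1_ind hI hP).
  by exists zero; split=> /=; [right|exists zero; split; [pa_lra hM|split=> //; pa_lra hM]].
move=> z [q [/= h1 [r [h2 [h3 h4]]]]].
have [h5|h5] := classic (lt (add r one) y).
  by exists q; split; [|exists (add r one); split; [|split=> //]] => /=; pa_lra hM.
exists (add q one); split; last first.
  by exists zero; split; [|split] => /=; pa_lra hM.
have [->|hq] := classic (q = zero); first by rewrite /=; pa_lra hM.
rewrite /=; pa_lra hM.
Qed.

(** * Pell's equation and exponentiation *)

Section Pell.
Variable A : arith_structure.
Hypothesis hA : PA_minus A.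
Local Notation "x + y" := (add x y).
Local Notation "x * y" := (mul x y).
Local Notation "1" := one.
Variable a : A.
Hypothesis ha : le 1 a.

(** Solutions of Pell's equation for the base [a + 1]. *)
Definition pell_sol (X Y : A) :=
  X * X = (a * a + (a + a)) * (Y * Y) + 1 /\ exists q, le q X /\ X = 1 + a * q.

(** With [D = (a + 1)^2 - 1 = a * a + (a + a)], these are the coefficients of [(a + 1 + sqrt D)^k].
    The index is a true natural number, so only solutions of standard index are named. *)
Fixpoint pell (k : nat) : A * A :=
  if k is j.+1 then
    let: (X, Y) := pell j in
    ((a + 1) * X + (a * a + (a + a)) * Y, X + (a + 1) * Y)
  else (one, zero).

Lemma pa_neq0 (x : A) : x <> zero -> le 1 x.
Proof. by case: (pa_le1 hA x). Qed.

Lemma pa_subW (x y : A) : le x y -> exists z, y = x + z.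
Proof.
case=> [/(@pa_sub _ hA _ _)[z <-]|->]; first by exists z.
by exists zero; pa_lra hA.
Qed.

Lemma le_mul1 (z : A) : le z (1 + a * z).
Proof. by have h := ha; pa_nra hA. Qed.

Lemma pell_solP k : pell_sol (pell k).1 (pell k).2.
Proof.
elim: k => [|k] /=.
  split; first by pa_nra hA.
  by exists zero; split; [left; exact: (Defs.pa_lt01 hA)|pa_lra hA].
case: (pell k) => X Y /= [h1 [q [h2 h3]]]; split.
  by pa_lra hA.
have e : (a + 1) * X + (a * a + (a + a)) * Y =
  1 + a * (q + a * q + Y * (a + (1 + 1)) + 1).
  by rewrite {1}h3; pa_ring hA.
exists (q + a * q + Y * (a + (1 + 1)) + 1); split=> //.
by rewrite e; apply: le_mul1.
Qed.

(** Modulo [a] the base is 1 and [D] is 0, so [X] stays 1 and [Y] grows by 1 at each step. *)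
Lemma pell_res k : exists q, (pell k).2 = numeral A k + a * q.
Proof.
elim: k => [|k [q]] /=; first by exists zero; pa_ring hA.
have [_ [r [_]]] := pell_solP k; case: (pell k) => X Y /= -> ->.
by exists (r + (numeral A k + a * q) + q); pa_ring hA.
Qed.

Lemma pa_lt_sq (x y : A) : lt x y -> lt (x * x) (y * y).
Proof. by move=> h; pa_nra hA. Qed.

(** Multiplication by the conjugate unit [a + 1 - sqrt D]. The differences [(a + 1) X - D Y] and
    [(a + 1) Y - X] exist in the model because the equation orders the squares of their terms. *)
Lemma pell_pred X Y : pell_sol X Y -> Y <> zero -> exists X' Y',
  [/\ pell_sol X' Y', X = (a + 1) * X' + (a * a + (a + a)) * Y',
      Y = X' + (a + 1) * Y' & lt Y' Y].
Proof.
move=> [h1 [q [h2 h3]]] /pa_neq0 hY.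
have [X' eX] : exists X', (a + 1) * X = (a * a + (a + a)) * Y + X'.
  apply: pa_subW; apply/(pa_not_lt hA) => /pa_lt_sq h.
  have : (a + 1) * X * ((a + 1) * X) = (a + 1) * (a + 1) * (X * X) by pa_ring hA.
  rewrite h1 => e; rewrite e in h; move: h => {e h1}; apply/(pa_not_lt hA).
  by emb_all hA; nra.
have [Y' eY] : exists Y', (a + 1) * Y = X + Y'.
  apply: pa_subW; apply/(pa_not_lt hA) => /pa_lt_sq h.
  rewrite h1 in h; move: h; apply/(pa_not_lt hA).
  by emb_all hA; nra.
exists X', Y'.
have E : emb hA X' = ((emb hA a + 1) * emb hA X - (emb hA a * emb hA a + (emb hA a + emb hA a))
  * emb hA Y)%R /\ emb hA Y' = ((emb hA a + 1) * emb hA Y - emb hA X)%R.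
  by emb_hyps hA; split; lra.
have e1 : X = (a + 1) * X' + (a * a + (a + a)) * Y'.
  by emb_all hA; case: E => -> ->; ring.
have e2 : Y = X' + (a + 1) * Y' by emb_all hA; case: E => -> ->; ring.
have e3 : X' * X' = (a * a + (a + a)) * (Y' * Y') + 1.
  by emb_all hA; case: E => -> ->; lra.
have hX' : le 1 X'.
  by apply: pa_neq0 => e; rewrite e in e3; pa_nra hA.
split=> //; last by pa_nra hA.
split=> //.
have [u eu] : exists u, X = X' + a * u.
  by exists (X' + (a + (1 + 1)) * Y'); rewrite {1}e1; pa_ring hA.
have [z ez] : exists z, q = u + z.
  apply: pa_subW; apply/(pa_not_lt hA) => h.
  have : X' + a * u = 1 + a * q by rewrite -eu.
  by move=> e; have h' := ha; clear - hA e h h' hX'; pa_nra hA.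
have e4 : X' = 1 + a * z.
  have : X' + a * u = 1 + a * q by rewrite -eu.
  by rewrite ez => e; clear - hA e; pa_lra hA.
exists z; split=> //.
by rewrite e4; apply: le_mul1.
Qed.

(** Descent: a predecessor with [Y'] above the [k]-th value would have [X'] above it too, and so
    come from a solution with [Y] above the next value. *)
Lemma pell_std k X Y : pell_sol X Y -> le Y (pell k).2 ->
  exists2 j, j <= k & (X, Y) = pell j.
Proof.
elim: k X Y => [|k IH] X Y h hY.
  have e : Y = zero by move: hY => /= hY; pa_lra hA.
  exists 0 => //=; rewrite e; congr (_, _); move: h => [h _]; rewrite e in h.
  by clear - hA h; pa_nra hA.
have [e|/(pell_pred h)[X' [Y' [h' e1 e2 _]]]] := classic (Y = zero).
  by have [|j hj ->] := IH X Y h; [rewrite e; pa_lra hA|exists j => //; apply: leqW].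
have [|j hj e] := IH X' Y' h'; last first.
  by exists j.+1 => //=; rewrite -e -e1 -e2.
apply/(pa_not_lt hA) => hlt.
have [h1 _] := pell_solP k; have [h2 _] := h'.
move: hY => /=; case: (pell k) h1 hlt => X0 Y0 /= h1 hlt hY.
have hX : lt X0 X'.
  apply/(pa_not_le hA) => hX; have ha' := ha; clear - hA h1 h2 hX hlt ha'.
  have : le (X' * X') (X0 * X0) by apply: pa_le_mul.
  have h3 := pa_lt_sq hlt.
  rewrite h1 h2 => h4; clear - hA h3 h4 ha'; emb_all hA; nra.
rewrite e2 in hY; have h3 : le zero a by pa_lra hA.
by clear - hA hX hY hlt h3; pa_nra hA.
Qed.

(** Descent lowers the residue of [Y] modulo [a] by 1. A nonzero solution of residue 0 would descend
    to one of residue -1 strictly below [Ys], the least of that residue; so [k] steps end exactly at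
    [Y = 0]. This keeps solutions of nonstandard index out. *)
Lemma pell_uniq Ys k X Y :
  (forall n, lt (numeral A n) a) ->
  (forall X Y q, pell_sol X Y -> Y + 1 = a * q -> le Ys Y) ->
  pell_sol X Y -> le Y Ys -> (exists q, Y = numeral A k + a * q) ->
  (X, Y) = pell k.
Proof.
move=> hn hYs; elim: k X Y => [|k IH] X Y h hY [q eq].
  have [e|/(pell_pred h)[X' [Y' [h' _ e2 hlt]]]] := classic (Y = zero).
    by have [|j] := @pell_std 0 X Y h; [rewrite e; right|rewrite leqn0 => /eqP ->].
  exfalso; have [_ [r [_ er]]] := h'; rewrite /= in eq.
  have [z ez] : exists z, q = (r + Y') + z.
    apply: pa_subW; apply/(pa_not_lt hA) => h1.
    by clear - hA eq e2 er h1; pa_nra hA.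
  have : le Ys Y'.
    by apply: (hYs X' Y' z) => //; rewrite er eq ez in e2; clear - hA e2; pa_lra hA.
  by move=> h1; pa_lra hA.
have hY0 : Y <> zero.
  by move=> e; rewrite e /= in eq; clear - hA eq; pa_nra hA.
have [X' [Y' [h' e1 e2 hlt]]] := pell_pred h hY0.
rewrite /= -(IH X' Y') //; first by rewrite -e1 -e2.
  by pa_lra hA.
have [_ [r [_ er]]] := h'; rewrite /= in eq.
have hk := hn k.
have [z ez] : exists z, q = (r + Y') + z.
  apply: pa_subW; apply/(pa_not_lt hA) => h1.
  by clear - hA eq e2 er h1 hk; pa_nra hA.
by exists z; rewrite er eq ez in e2; clear - hA e2; pa_lra hA.
Qed.

(** Modulo [m = 2 (a + 1) c - c^2 - 1] the element [c - (a + 1)] is a square root of [D]; reading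
    [sqrt D] as this element turns the unit [a + 1 + sqrt D] into [c]. *)
Lemma pell_exp (c m : A) k : m + (c * c + 1) = (1 + 1) * ((a + 1) * c) ->
  exists J, (pell k).1 + c * (pell k).2 =
    (iter k (mul c) 1 + (a + 1) * (pell k).2) + m * J.
Proof.
move=> hm; elim: k => [|k [J]] /=; first by exists zero; pa_lra hA.
case: (pell k) => X Y /= h; exists (c * J + Y); emb_all hA.
have em : emb hA m = ((1 + 1) * ((emb hA a + 1) * emb hA c) - emb hA c * emb hA c - 1)%R by lra.
have ep : emb hA (iter k (mul c) 1) = (emb hA X + emb hA c * emb hA Y -
  (emb hA a + 1) * emb hA Y - emb hA m * emb hA J)%R by lra.
by rewrite ep em; ring.
Qed.

Lemma iter_mul_num b k : iter k (mul (numeral A b)) 1 = numeral A (b ^ k).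
Proof.
elim: k => [|k IH] /=; first by pa_lra hA.
by rewrite IH expnS numM.
Qed.

End Pell.

Section ExpRel.
Variable A : arith_structure.
Local Notation "x + y" := (add x y).
Local Notation "x * y" := (mul x y).

(** For standard [b], [k], [p] and suitable parameters [a], [s] this says
    [p = (b + 1)^k]: the solution [(X, Y)] with [Y = k mod a] is the [k]-th
    one, and [X - (a - b) Y] is congruent to [(b + 1)^k] modulo [m]. *)
Definition exp_rel (a s b k p : A) : Prop :=
  exists X, le X ((a + one) * s + one) /\
  exists Y, le Y s /\
  exists q, le q X /\
  exists r, le r Y /\
  exists m, le m ((one + one) * ((a + one) * (b + one))) /\
  exists J, le J (X + (b + one) * Y) /\
  (X * X = (a * a + (a + a)) * (Y * Y) + one /\
  (X = one + a * q /\
  (Y = k + a * r /\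
  (m + ((b + one) * (b + one) + one) = (one + one) * ((a + one) * (b + one)) /\
   X + (b + one) * Y = (p + (a + one) * Y) + m * J)))).

Lemma E1def_exp_rel : PA_minus A ->
  E1def (fun e => exp_rel (e 0) (e 1) (e 2) (e 3) (e 4)).
Proof.
move=> hA.
pose V := Var; pose a := V 6; pose b := V 8; pose k := V 9; pose p := V 10.
pose X := V 5; pose Y := V 4; pose q := V 3; pose r := V 2; pose m := V 1; pose J := V 0.
have h : E1def (fun e : nat -> A => asat A e
  (And (fEq (Mul X X) (Add (Mul (Add (Mul a a) (Add a a)) (Mul Y Y)) One))
  (And (fEq X (Add One (Mul a q)))
  (And (fEq Y (Add k (Mul a r)))
  (And (fEq (Add m (Add (Mul (Add b One) (Add b One)) One)) (Mul (Add One One) (Mul (Add a One) (Add b One))))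
    (fEq (Add X (Mul (Add b One) Y)) (Add (Add p (Mul (Add a One) Y)) (Mul m J)))))))).
  by apply: E1def_qf.
have h1 := E1def_ex (Add (V 4) (Mul (Add (V 7) One) (V 3))) h.
have h2 := E1def_ex (Mul (Add One One) (Mul (Add (V 4) One) (Add (V 6) One))) h1.
have h3 := E1def_ex (V 1) (E1def_ex (V 2) h2).
apply: (E1def_ext (E1def_ex (Add (Mul (Add (V 0) One) (V 1)) One) (E1def_ex (V 2)
  (E1def_ex (V 1) (E1def_ex (V 1) h2))))).
by [].
Qed.

End ExpRel.

Section Exp.
Variable M : arith_structure.
Hypothesis hI : IE1 M.
Hypothesis hns : nonstandard M.
Let hM : PA_minus M := proj1 hI.
Local Notation num := (numeral M).

(** Bounded form of the statement that [Y] solves Pell's equation and is -1 modulo [a]. The least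
    such [Y] delimits the range in which the residue of [Y] determines the solution. *)
Definition pell_neg (a Y : M) := exists X, le X (add (mul (add a one) Y) one) /\
  exists q, le q X /\ exists r, le r (add Y one) /\
  (mul X X = add (mul (add (mul a a) (add a a)) (mul Y Y)) one /\
  (X = add one (mul a q) /\ add Y one = mul a r)).

Lemma E1def_pell_neg : E1def (fun e => pell_neg (e 0) (e 1)).
Proof.
pose V := Var; pose a := V 3; pose Y := V 4.
pose X := V 2; pose q := V 1; pose r := V 0.
have h : E1def (fun e : nat -> M => asat M e
  (And (fEq (Mul X X) (Add (Mul (Add (Mul a a) (Add a a)) (Mul Y Y)) One))
  (And (fEq X (Add One (Mul a q))) (fEq (Add Y One) (Mul a r))))).
  by apply: E1def_qf.
apply: (E1def_ext (E1def_ex (Add (Mul (Add (V 0) One) (V 1)) One) (E1def_ex (V 0)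
  (E1def_ex (Add (V 3) One) h)))).
by [].
Qed.

Lemma pell_X_le (a X Y : M) : pell_sol a X Y -> le X (add (mul (add a one) Y) one).
Proof.
move=> [h _]; apply/(pa_not_lt hM) => h'; have := pa_lt_sq hM h'; rewrite h => {h'} h'.
by clear h; emb_all hM; nra.
Qed.

Lemma pell_negI (a X Y q : M) : le one a -> pell_sol a X Y -> add Y one = mul a q ->
  pell_neg a Y.
Proof.
move=> ha h1 h2; exists X; split; first exact: pell_X_le.
have [h3 [r [h4 h5]]] := h1; exists r; split=> //; exists q; split; last by [].
by rewrite h2; clear - hM ha; pa_nra hM.
Qed.

Lemma std_pell (n k : nat) : std (pell (num n) k).1 /\ std (pell (num n) k).2.
Proof.
elim: k => [|k] /=.
  by split; [exists 1 => /=; pa_lra hM|exists 0].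
case: (pell (num n) k) => X Y /= [[x ->] [y ->]]; split.
  exists ((n + 1) * x + (n * n + (n + n)) * y)%N.
  by rewrite !(numD hM, numM hM) /=; pa_lra hM.
exists (x + (n + 1) * y)%N.
by rewrite !(numD hM, numM hM) /=; pa_lra hM.
Qed.

(** For the standard modulus [n + 1] the solution of index [n] has residue -1 and is standard.
    Overspill below a nonstandard bound [b] reaches a nonstandard modulus. *)
Lemma nstd_pell_base : exists a Y : M, ~ std a /\ pell_neg a Y.
Proof.
have [b hb] := exists_nstd hns.
pose P := fun e : nat -> M => exists Y, le Y (e 1) /\ pell_neg (add (e 0) one) Y.
have hP : E1def P.
  have h := E1def_sub (fun i => if i is 0 then Add (Var 1) One else Var 0) E1def_pell_neg.
  exact: (E1def_ext (E1def_ex (Var 1) h)).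
have [n|x [hx [Y [_ hY]]]] := E1_overspill hI hns (e := fun=> b) hP; last first.
  exists (add x one), Y; split=> // hs; apply: hx; apply: std_le_std hs => //.
  by pa_lra hM.
have ha : le one (num n.+1) by have := emb_ge0 hM (num n) => ?; rewrite /=; pa_lra hM.
exists (pell (num n.+1) n).2; split.
  by have [_ [m ->]] := std_pell n.+1 n; left; apply: nstd_gt.
have [q e] := pell_res hM ha n.
apply: (@pell_negI _ (pell (num n.+1) n).1 _ (add q one)) => //.
  exact: pell_solP.
by rewrite e /=; pa_ring hM.
Qed.

Theorem exp_rel_exists : exists a s : M, forall b k p : nat,
  exp_rel a s (num b) (num k) (num p) <-> p = (b.+1 ^ k)%N.
Proof.
have [a [Y0 [hna hY0]]] := nstd_pell_base.
have hlt n : lt (num n) a by apply: nstd_gt.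
have ha : le one a by left; have -> : one = num 1 by rewrite /=; pa_lra hM.
have hP : E1def (fun e : nat -> M => pell_neg (e 1) (e 0)).
  exact: (E1def_ren (fun i => if i is 0 then 1 else 0) E1def_pell_neg).
have [s [hs1 hs2]] := @E1_least _ hI _ (fun=> a) Y0 hP hY0.
have {}hs2 X Y q : pell_sol a X Y -> add Y one = mul a q -> le s Y.
  move=> h1 h2; apply/(pa_not_lt hM) => h3.
  exact: (hs2 _ h3 (pell_negI ha h1 h2)).
have [Xs [_ [qs [_ [rs [_ [es1 [es2 es3]]]]]]]] := hs1.
have hsol : pell_sol a Xs s.
  by split=> //; exists qs; split=> //; rewrite es2; apply: le_mul1.
(* If a solution of standard index exceeded [s], then [s] would have some standard index [j], hence
   residue [j]; but its residue is -1 and [j + 1 < a]. *)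
have hle k : le (pell a k).2 s.
  apply/(pa_not_lt hM) => /(or_introl (B := s = (pell a k).2)).
  move=> /(pell_std hM ha hsol)[j _ e].
  have [q] := pell_res hM ha j; rewrite -e /= => e'.
  have h := hlt j.+1; rewrite e' in es3; rewrite /= in h.
  have h0 := emb_ge0 hM (num j).
  by have [h1|/(pa_not_le hM) h1] := classic (le rs q); clear - hM h es3 ha h0 h1; pa_nra hM.
exists a, s => b k p.
have [m em] : exists m, mul (add one one) (mul (add a one) (add (num b) one)) =
  add (add (mul (add (num b) one) (add (num b) one)) one) m.
  apply: pa_subW => //; have h := hlt b; clear - hM h; pa_nra hM.
(* Standard numbers lie below [a], so below the modulus [m]: between them congruence modulo [m] is
   equality. *)
have hm : le a m.
  have h := hlt (b * b + b + b)%N; rewrite !(numD hM, numM hM) in h.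
  have := emb_ge0 hM (num b) => h0.
  clear - hM h em h0 ha; apply/(pa_not_lt hM) => h1; pa_nra hM.
have em' : add m (add (mul (add (num b) one) (add (num b) one)) one) =
  mul (add one one) (mul (add a one) (add (num b) one)) by rewrite em; pa_lra hM.
have [J hJ] := pell_exp hM k em'.
have ei : iter k (mul (add (num b) one)) one = num (b.+1 ^ k) by rewrite -(iter_mul_num hM).
rewrite ei in hJ.
split.
  move=> [X [_ [Y [hY [q [hq [r [_ [m' [_ [J' [_ [e1 [e2 [e3 [e4 e5]]]]]]]]]]]]]]]].
  have hsol' : pell_sol a X Y by split=> //; exists q.
  have eXY := pell_uniq hM ha hlt hs2 hsol' hY (ex_intro _ r e3).
  move: hJ; rewrite -eXY /= e5 => hJ.
  have em1 : m' = m by clear - hM e4 em'; pa_lra hM.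
  rewrite em1 in hJ.
  have h1 := hlt p; have h2 := hlt (b.+1 ^ k)%N.
  apply: (num_inj hM); have h3 := emb_ge0 hM (num p); have h4 := emb_ge0 hM (num (b.+1 ^ k)).
  have lr (u v i j : M) : lt u a -> add u (mul m i) = add v (mul m j) -> le j i.
    move=> hu hh; apply/(pa_not_lt hM) => hij; have hv := emb_ge0 hM v.
    by clear - hM hu hh hij hm hv; pa_nra hM.
  have hh : add (num p) (mul m J') = add (num (b.+1 ^ k)) (mul m J) by clear - hM hJ; pa_lra hM.
  have l1 := lr _ _ _ _ h1 hh; have l2 := lr _ _ _ _ h2 (esym hh).
  have eJ : J = J' by clear - hM l1 l2; pa_lra hM.
  by rewrite eJ in hh; clear - hM hh; pa_lra hM.
move=> ->.
have hX := pell_solP hM ha k.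
exists (pell a k).1; split.
  have h := pell_X_le hX; have h' := hle k.
  by clear - hM h h' ha; pa_nra hM.
have [h1 [q [h2 h3]]] := hX.
exists (pell a k).2; split=> //; exists q; split=> //.
have [r hr] := pell_res hM ha k; exists r; split.
  by rewrite hr; have h4 := emb_ge0 hM (num k); clear - hM ha h4; pa_nra hM.
exists m; split.
  by rewrite -em'; clear - hM; pa_nra hM.
exists J; split; last by [].
by rewrite hJ; clear - hM hm ha; pa_nra hM.
Qed.

End Exp.

(** * Elimination of the bounded universal quantifier *)

Section Chinese.
Variables (k : nat) (m : nat -> nat).
Hypothesis co_m : forall x y, x < k -> y < k -> x != y -> coprime (m x) (m y).

Lemma coprime_prod_lt n a : (forall x, x < n -> coprime a (m x)) ->
  coprime a (\prod_(x < n) m x).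
Proof.
by move=> h; elim/big_rec: _ => [|i x _ hx]; rewrite ?coprimen1 // coprimeMr hx h.
Qed.

Lemma dvdn_prod_coprime n z : n <= k ->
  (forall x, x < n -> m x %| z) -> \prod_(x < n) m x %| z.
Proof.
elim: n => [|n IH] hn h; first by rewrite big_ord0 dvd1n.
rewrite big_ord_recr /= Gauss_dvd; last first.
  rewrite coprime_sym; apply: coprime_prod_lt => x hx; apply: co_m => //.
    exact: ltn_trans hn.
  by rewrite gtn_eqF.
by rewrite IH ?(ltnW hn) //= ?h // => x hx; apply: h; apply: ltnW.
Qed.

Lemma eqmod_prod_coprime a b : (forall x, x < k -> a = b %[mod m x]) ->
  a = b %[mod \prod_(x < k) m x].
Proof.
wlog le_ab : a b / b <= a.
  move=> h h'; case/orP: (leq_total b a) => hle; first exact: h.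
  by apply/esym/h => // x /h'.
move=> h; apply/eqP; rewrite eqn_mod_dvd //; apply: dvdn_prod_coprime => // x hx.
by rewrite -eqn_mod_dvd //; apply/eqP/h.
Qed.

Lemma chinese_exists r : exists Y, forall x, x < k -> Y = r x %[mod m x].
Proof.
suff : forall n, n <= k -> exists Y, forall x, x < n -> Y = r x %[mod m x] by apply.
elim=> [|n IH] hn; first by exists 0.
have [Y hY] := IH (ltnW hn).
have co : coprime (m n) (\prod_(x < n) m x).
  apply: coprime_prod_lt => x hx; apply: co_m => //.
    exact: ltn_trans hn.
  by rewrite gtn_eqF.
exists (chinese (m n) (\prod_(x < n) m x) (r n) Y) => x.
rewrite ltnS leq_eqVlt => /orP[/eqP ->|hx]; first by rewrite chinese_modl.
rewrite -(hY _ hx).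
have hd : m x %| \prod_(x < n) m x by rewrite (bigD1 (Ordinal hx)) //= dvdn_mulr.
have := chinese_modr co (r n) Y.
by move/(congr1 (fun z => z %% m x)); rewrite !(modn_dvdm _ hd).
Qed.

End Chinese.

Section BoundedForall.
Variables (k u m : nat) (s t : (nat -> nat) -> nat -> nat).
Hypothesis s_mono : forall v v' x x', (forall j, j < m -> v j <= v' j) ->
  x <= x' -> s v x <= s v' x'.
Hypothesis t_mono : forall v v' x x', (forall j, j < m -> v j <= v' j) ->
  x <= x' -> t v x <= t v' x'.
Hypothesis s_mod : forall v v' x x' q, (forall j, j < m -> v j = v' j %[mod q]) ->
  x = x' %[mod q] -> s v x = s v' x' %[mod q].
Hypothesis t_mod : forall v v' x x' q, (forall j, j < m -> v j = v' j %[mod q]) ->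
  x = x' %[mod q] -> t v x = t v' x' %[mod q].

(** [Q] is the product of the pairwise coprime moduli [mm x], [x < k], whose
    prime factors exceed [B]; as [T = x] modulo [mm x], the single congruence
    modulo [Q] encodes the [k] equations. *)
Let B := k + u + 1 + s (fun=> u) k + t (fun=> u) k.
Let F := B`!.
Let T := k + F * F.
Let Q := 'C(T, k).
Let mm x := 1 + F %/ (k - x) * F.

Let uB : u.+1 <= B. Proof. by rewrite /B; lia. Qed.
Let sB : s (fun=> u) k <= B. Proof. by rewrite /B; lia. Qed.
Let tB : t (fun=> u) k <= B. Proof. by rewrite /B; lia. Qed.
Let kT : k <= T. Proof. exact: leq_addr. Qed.

Let leB x : x < k -> 0 < k - x <= B.
Proof. by rewrite /B; lia. Qed.

(** The square in [T] leaves a factor [F] after the division by [k - x], so [mm x] is 1 modulo [F]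
    and prime to all numbers from 1 up to [B]. *)
Let mmE x : x < k -> (k - x) * mm x = T - x.
Proof.
move=> hx; have h : k - x %| F by apply: dvdn_fact; apply: leB.
rewrite /mm mulnDr muln1 mulnA [(k - x) * _]mulnC divnK // /T.
by have := ltnW hx; lia.
Qed.

Let QE : Q = \prod_(x < k) mm x.
Proof.
apply/eqP; rewrite -(eqn_pmul2r (fact_gt0 k)) bin_ffact -ffactnn !ffact_prod -big_split /=.
by apply/eqP; apply: eq_bigr => i _; rewrite mulnC mmE.
Qed.

Let prime_gt x p : prime p -> p %| mm x -> B < p.
Proof.
move=> pp; rewrite ltnNge; apply: contraL => hp.
have h : p %| F by apply: dvdn_fact; rewrite prime_gt0.
rewrite /mm dvdn_addl; last by rewrite dvdn_mull.
by rewrite dvdn1; case: eqP pp => // ->.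
Qed.

Let coprimeF x : coprime (mm x) F.
Proof. by rewrite /coprime /mm addnC gcdnC gcdnMDl gcdn1. Qed.

Let coprime_small x n : n <= B -> coprime (mm x) n`!.
Proof.
by move=> hn; apply: coprime_dvdr (coprimeF x); rewrite /F -(bin_fact hn) dvdn_mull ?dvdn_mulr.
Qed.

Let coprime_mm x y : x < k -> y < k -> x != y -> coprime (mm x) (mm y).
Proof.
wlog lt_xy : x y / x < y => [h hx hy hxy|hx hy _].
  have := hxy; rewrite neq_ltn => /orP[] h'; first exact: h.
  by rewrite coprime_sym; apply: h => //; rewrite eq_sym.
set g := gcdn (mm x) (mm y).
have hg : g %| (y - x).
  have -> : y - x = (T - x) - (T - y) by have : y <= T; rewrite /T; lia.
  by apply: dvdn_sub; rewrite -mmE //; apply: dvdn_mull;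
     rewrite ?dvdn_gcdl ?dvdn_gcdr.
have hF : g %| F.
  apply: dvdn_trans hg _; apply: dvdn_fact.
  by have := leB hx; lia.
have := coprime_dvdr hF (coprimeF x); rewrite /coprime => /eqP e.
by apply/eqP; rewrite -/g -e; apply/esym/gcdn_idPr; apply: dvdn_gcdl.
Qed.

Let T_mod x : x < k -> x = T %[mod mm x].
Proof.
move=> hx; have hT : x <= T by apply: leq_trans (ltnW hx) kT.
by apply/esym/eqP; rewrite eqn_mod_dvd // -mmE // dvdn_mull.
Qed.

Let mm_dvdQ x : x < k -> mm x %| Q.
Proof. by move=> hx; rewrite QE (bigD1 (Ordinal hx)) //= dvdn_mulr. Qed.

(** From left to right, [Y] collects the witnesses by Chinese remaindering. Conversely take a prime
    [p] dividing [mm x]: it divides [Y j ^_ u.+1], so [Y j] is congruent modulo [p] to some number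
    up to [u]; since [p] exceeds [B], hence both values, the congruence between them is an
    equality. *)
Theorem bounded_forall :
  (forall x, x < k -> exists v, (forall j, j < m -> v j <= u) /\ s v x = t v x) <->
  exists Y, (forall j, j < m -> Q %| 'C(Y j, u.+1)) /\ s Y T = t Y T %[mod Q].
Proof.
split=> [h|[Y [h1 h2]] x hx].
  have [v hv] : exists v : nat -> nat -> nat, forall x, x < k ->
      (forall j, j < m -> v x j <= u) /\ s (v x) x = t (v x) x.
    have h' x : exists w : nat -> nat, x < k ->
        (forall j, j < m -> w j <= u) /\ s w x = t w x.
      case: (ltnP x k) => [/h[w hw]|_]; by [exists w|exists (fun=> 0)].
    by exists (fun x => proj1_sig (cid (h' x))) => x hx; case: cid => w /= /(_ hx).
  have [Y hY] : exists Y : nat -> nat, forall j x, x < k -> Y j = v x j %[mod mm x].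
    have h' j := chinese_exists coprime_mm (fun x => v x j).
    by exists (fun j => proj1_sig (cid (h' j))) => j x hx; case: cid => w /= /(_ x hx).
  exists Y; split.
    move=> j hj; rewrite QE; apply: (dvdn_prod_coprime coprime_mm) => // x hx.
    (* As [mm x] is prime to the factorial of [u.+1], divisibility can be tested on the falling
       factorial, one of whose factors is [Y j - v x j]. *)
    have := coprime_small x uB; move/Gauss_dvdl => <-; rewrite bin_ffact.
    have hvu := (hv x hx).1 j hj; rewrite ffact_prod.
    have [hle|hlt] := leqP (v x j) (Y j).
      rewrite (bigD1 (Ordinal (hvu : v x j < u.+1))) //= dvdn_mulr //.
      by rewrite -eqn_mod_dvd // hY.
    by rewrite -ffact_prod ffact_small // (leq_trans hlt) // ltnW.
  have hx x : x < k -> s Y T = t Y T %[mod mm x].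
    move=> hx; have [_ e] := hv x hx.
    have hY' j : j < m -> Y j = v x j %[mod mm x] by move=> _; apply: hY.
    have eT := esym (T_mod hx).
    by rewrite (s_mod hY' eT) (t_mod hY' eT) e.
  by rewrite QE; apply: (eqmod_prod_coprime coprime_mm).
have hF : 0 < F by apply: fact_gt0.
have hm : 1 < mm x.
  have /andP[h0 hB] := leB hx.
  have : 0 < F %/ (k - x) by rewrite divn_gt0 // dvdn_leq // dvdn_fact // h0.
  by rewrite /mm add1n ltnS => h; rewrite muln_gt0 h.
set p := pdiv (mm x); have pp : prime p by apply: pdiv_prime.
have pm : p %| mm x by apply: pdiv_dvd.
have pQ : p %| Q by apply: dvdn_trans pm (mm_dvdQ hx).
have hp := prime_gt pp pm.
have hv j : exists w, j < m -> w <= u /\ w = Y j %[mod p].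
  case: (ltnP j m) => hj; last by exists 0.
  have [hle|hlt] := leqP (Y j) u; first by exists (Y j).
  have : p %| Y j ^_ u.+1 by rewrite -bin_ffact dvdn_mulr // (dvdn_trans pQ) // h1.
  rewrite ffact_prod.
  suff : forall n, n <= u -> p %| \prod_(i < n.+1) (Y j - i) ->
    exists w, w <= u /\ w = Y j %[mod p].
    by move=> h h'; have [w hw] := h u (leqnn u) h'; exists w.
  elim=> [|n IH] hn.
    rewrite big_ord_recr big_ord0 /= mul1n subn0 => hd; exists 0; split=> //.
    by apply/esym/eqP; rewrite eqn_mod_dvd ?subn0.
  rewrite big_ord_recr /= Euclid_dvdM // => /orP[|hd].
    by apply: IH; apply: ltnW.
  exists n.+1; split=> //; apply/esym/eqP; rewrite eqn_mod_dvd //.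
  exact: leq_trans hn (ltnW hlt).
pose v j := proj1_sig (cid (hv j)).
have hv' j : j < m -> v j <= u /\ v j = Y j %[mod p].
  by rewrite /v; case: cid.
exists v; split=> [j /hv'[]//|].
have e1 : s v x = s Y T %[mod p].
  apply: s_mod => [j /hv'[]//|].
  by have := congr1 (fun z => z %% p) (T_mod hx); rewrite !modn_dvdm.
have e2 : t v x = t Y T %[mod p].
  apply: t_mod => [j /hv'[]//|].
  by have := congr1 (fun z => z %% p) (T_mod hx); rewrite !modn_dvdm.
have e3 : s Y T = t Y T %[mod p].
  by have := congr1 (fun z => z %% p) h2; rewrite !modn_dvdm.
have ls : s v x < p.
  apply: leq_ltn_trans hp; apply: leq_trans (_ : s (fun=> u) k <= _).
    by apply: s_mono => [j /hv'[]//|]; apply: ltnW.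
  exact: sB.
have lt : t v x < p.
  apply: leq_ltn_trans hp; apply: leq_trans (_ : t (fun=> u) k <= _).
    by apply: t_mono => [j /hv'[]//|]; apply: ltnW.
  exact: tB.
by move: e1; rewrite e3 -e2 !modn_small.
Qed.

End BoundedForall.

(** * The standard model and Diophantine relations *)

Definition Nst : arith_structure := {|
  carrier := nat; zero := 0; one := 1; add := addn; mul := muln;
  lt := fun x y => x < y |}.

Lemma Nst_PA : PA_minus Nst.
Proof.
split=> /=; try by [lia | nia].
by move=> x y h; exists (y - x); lia.
Qed.

Lemma Nst_euclidean : euclidean Nst.
Proof.
by move=> x y h; exists (x %/ y), (x %% y); split; [apply: ltn_pmod|apply: divn_eq].
Qed.

Notation neval := (eval Nst).

Lemma neval_mono t : forall e e', (forall i, e i <= e' i) -> neval e t <= neval e' t.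
Proof.
elim: t => //= s IHs t IHt e e' h; [exact: leq_add (IHs _ _ h) (IHt _ _ h)|].
exact: leq_mul (IHs _ _ h) (IHt _ _ h).
Qed.

Lemma neval_mod q t : forall e e', (forall i, e i = e' i %[mod q]) ->
  neval e t = neval e' t %[mod q].
Proof.
elim: t => //= s IHs t IHt e e' h; have h1 := IHs _ _ h; have h2 := IHt _ _ h.
  by rewrite -modnDm h1 h2 modnDm.
by rewrite -modnMm h1 h2 modnMm.
Qed.

Definition rent (r : nat -> nat) := subt (fun i => Var (r i)).

Lemma eval_rent (A : arith_structure) (e : nat -> A) r t :
  eval A e (rent r t) = eval A (fun i => e (r i)) t.
Proof. exact: eval_subt. Qed.

(** With [ren_r], places two blocks of [m1] and [m2] witnesses side by side in front of common
    parameters. *)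
Definition ren_l (m1 m2 i : nat) := if i < m1 then i else i + m2.
Definition ren_r (m1 m2 i : nat) := if i < m2 then m1 + i else i + m1.

Lemma cat_env_l (T : Type) m1 m2 (v e : nat -> T) :
  (fun i => cat_env (m1 + m2) v e (ren_l m1 m2 i)) = cat_env m1 v e.
Proof.
apply/funext => i; rewrite /cat_env /ren_l; case: (ltnP i m1) => h.
  by rewrite (leq_trans h) ?leq_addr.
by rewrite ltn_add2r ltnNge h /= subnDr.
Qed.

Lemma cat_env_r (T : Type) m1 m2 (v e : nat -> T) :
  (fun i => cat_env (m1 + m2) v e (ren_r m1 m2 i)) = cat_env m2 (fun j => v (m1 + j)) e.
Proof.
apply/funext => i; rewrite /cat_env /ren_r; case: (ltnP i m2) => h.
  by rewrite ltn_add2l h.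
by rewrite addnC ltn_add2l ltnNge h /= subnDl.
Qed.

Lemma cat_env_merge (T : Type) m1 m2 (v1 v2 e : nat -> T) :
  exists v, cat_env m1 v e = cat_env m1 v1 e /\
    cat_env m2 (fun j => v (m1 + j)) e = cat_env m2 v2 e.
Proof.
exists (fun i => if i < m1 then v1 i else v2 (i - m1)).
split; apply/funext => i; rewrite /cat_env; first by case: (ltnP i m1) => // ->.
have -> : (m1 + i < m1) = false by lia.
by rewrite addKn.
Qed.

Lemma cat_env_scons (T : Type) m (v e : nat -> T) y :
  cat_env m v (scons y e) = cat_env m.+1 (fun i => if i == m then y else v i) e.
Proof.
apply/funext => i; rewrite /cat_env; case: (ltngtP i m) => h.
- by rewrite ltnS ltnW.
- rewrite ltnS leqNgt h /=; have -> : i - m = (i - m.+1).+1 by lia.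
  by [].
- by rewrite h ltnSn subnn.
Qed.

Lemma cat_env_sconsV (T : Type) m (v e : nat -> T) :
  cat_env m.+1 v e = cat_env m v (scons (v m) e).
Proof.
rewrite cat_env_scons; apply/funext => i; rewrite /cat_env; case: ifP => // _.
by case: eqP => // ->.
Qed.

Lemma eval_lift_cat (A : arith_structure) m (v e : nat -> A) t :
  eval A (cat_env m v e) (lift m t) = eval A e t.
Proof.
rewrite eval_lift; congr eval; apply/funext => i; rewrite /cat_env plusE.
by rewrite ltnNge leq_addr /= addKn.
Qed.

Implicit Types R S : (nat -> nat) -> Prop.

Definition Dio R := exists m s t, forall e : nat -> nat, R e <->
  exists v : nat -> nat, neval (cat_env m v e) s = neval (cat_env m v e) t.

Lemma Dio_ext R S : Dio R -> (forall e, R e <-> S e) -> Dio S.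
Proof.
by move=> [m [s [t h]]] h'; exists m, s, t => e; rewrite -h'.
Qed.

Lemma Dio_eq s t : Dio (fun e => neval e s = neval e t).
Proof.
exists 0, s, t => e.
have E v : cat_env 0 v e = e by apply/funext => i; rewrite /cat_env /= subn0.
by split=> [h|[v]]; [exists (fun=> 0)|]; rewrite E.
Qed.

Lemma Dio_ex R : Dio R -> Dio (fun e => exists y, R (scons y e)).
Proof.
move=> [m [s [t h]]]; exists m.+1, s, t => e; split.
  by move=> [y /h[v hv]]; rewrite cat_env_scons in hv; eexists; exact: hv.
by move=> [v]; rewrite cat_env_sconsV => hv; exists (v m); apply/h; exists v.
Qed.

Lemma Dio_op (op : Prop -> Prop -> Prop) (fs ft : term -> term -> term -> term -> term) :
  (forall (e : nat -> nat) s t s' t',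
    neval e (fs s t s' t') = neval e (ft s t s' t') <->
    op (neval e s = neval e t) (neval e s' = neval e t')) ->
  (forall m1 m2 (P Q : (nat -> nat) -> Prop) (e : nat -> nat),
    op (exists v, P (cat_env m1 v e)) (exists v, Q (cat_env m2 v e)) <->
    exists v, op (P (cat_env m1 v e)) (Q (cat_env m2 (fun j => v (m1 + j)) e))) ->
  (forall P Q P' Q', (P <-> P') -> (Q <-> Q') -> op P Q -> op P' Q') ->
  forall R S, Dio R -> Dio S -> Dio (fun e => op (R e) (S e)).
Proof.
move=> h1 h2 hop R S [m1 [s1 [t1 hR]]] [m2 [s2 [t2 hS]]].
pose l := rent (ren_l m1 m2); pose r := rent (ren_r m1 m2).
exists (m1 + m2), (fs (l s1) (l t1) (r s2) (r t2)), (ft (l s1) (l t1) (r s2) (r t2)) => e.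
have h3 := h2 m1 m2 (fun e => neval e s1 = neval e t1) (fun e => neval e s2 = neval e t2) e.
have hop' P Q P' Q' : (P <-> P') -> (Q <-> Q') -> op P Q <-> op P' Q'.
  by move=> u v; split; apply: hop; tauto.
rewrite (hop' _ _ _ _ (hR e) (hS e)) h3; split=> -[v hv]; exists v; move: hv.
  by rewrite h1 !eval_rent cat_env_l cat_env_r.
by rewrite h1 !eval_rent cat_env_l cat_env_r.
Qed.

Lemma sum_squares_eq a b c d :
  a * a + b * b + (c * c + d * d) = 2 * (a * b) + 2 * (c * d) -> a = b /\ c = d.
Proof.
have h x y : 2 * (x * y) <= x * x + y * y ?= iff (x == y).
  by have := nat_Cauchy x y; rewrite -!mulnn.
have [/leqifP h1 /leqifP h2] := (h a b, h c d).
by move: h1 h2; case: eqP => [->|n1] h1; case: eqP => [->|n2] h2 e; split=> //; exfalso; lia.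
Qed.

Lemma Dio_and R S : Dio R -> Dio S -> Dio (fun e => R e /\ S e).
Proof.
(* The equation [(s - t)^2 + (s' - t')^2 = 0], expanded so that no subtraction occurs. *)
move: R S; apply: (Dio_op (op := and)
  (fs := fun s t s' t' => Add (Add (Mul s s) (Mul t t)) (Add (Mul s' s') (Mul t' t')))
  (ft := fun s t s' t' => Add (Mul Two (Mul s t)) (Mul Two (Mul s' t')))).
- by move=> e s t s' t' /=; split=> [/sum_squares_eq|[-> ->]]; [|nia].
- move=> m1 m2 P Q e; split=> [[[v1 h1] [v2 h2]]|[v [h1 h2]]].
    by have [v [e1 e2]] := cat_env_merge m1 m2 v1 v2 e; exists v; rewrite e1 e2.
  by split; [exists v|exists (fun j => v (m1 + j))].
- tauto.
Qed.

Lemma Dio_or R S : Dio R -> Dio S -> Dio (fun e => R e \/ S e).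
Proof.
(* The equation [(s - t) (s' - t') = 0], expanded in the same way. *)
move: R S; apply: (Dio_op (op := or)
  (fs := fun s t s' t' => Add (Mul s s') (Mul t t'))
  (ft := fun s t s' t' => Add (Mul s t') (Mul t s'))).
- by move=> e s t s' t' /=; split=> [h|[->|->]]; nia.
- move=> m1 m2 P Q e; split=> [[[v1 h1]|[v2 h2]]|[v [h1|h2]]].
  + by have [v [e1 e2]] := cat_env_merge m1 m2 v1 v1 e; exists v; rewrite e1; left.
  + by have [v [e1 e2]] := cat_env_merge m1 m2 v2 v2 e; exists v; rewrite e2; right.
  + by left; exists v.
  + by right; exists (fun j => v (m1 + j)).
- tauto.
Qed.

Lemma Dio_lt s t : Dio (fun e => neval e s < neval e t).
Proof.
apply: (Dio_ext (Dio_ex (Dio_eq (Add (Add (lift 1 s) One) (Var 0)) (lift 1 t)))) => e.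
split=> [[y]|h]; first by rewrite /= !eval_lift1; lia.
by exists (neval e t - neval e s - 1); rewrite /= !eval_lift1; lia.
Qed.

Lemma Dio_neq s t : Dio (fun e => neval e s <> neval e t).
Proof.
apply: (Dio_ext (Dio_or (Dio_lt s t) (Dio_lt t s))) => e; lia.
Qed.

Lemma Dio_qfree f : qfree f -> Dio (fun e => asat Nst e f) /\ Dio (fun e => ~ asat Nst e f).
Proof.
elim: f => //= [[s t|s t] _|f IH /IH[h1 h2]|f IHf g IHg [/IHf[h1 h2] /IHg[h3 h4]]|
  f IHf g IHg [/IHf[h1 h2] /IHg[h3 h4]]|f IHf g IHg [/IHf[h1 h2] /IHg[h3 h4]]].
- by split; [apply: Dio_eq|apply: Dio_neq].
- split; first exact: Dio_lt.
  apply: (Dio_ext (Dio_or (Dio_eq s t) (Dio_lt t s))) => e.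
  by rewrite /asat /=; lia.
- split=> //; apply: (Dio_ext h1) => e; rewrite /asat /=; split; first by move=> ? [].
  exact: contrapT.
- split; first exact: Dio_and.
  by apply: (Dio_ext (Dio_or h2 h4)) => e; rewrite /asat /=; split; tauto.
- split; first exact: Dio_or.
  by apply: (Dio_ext (Dio_and h2 h4)) => e; rewrite /asat /=; split; tauto.
- split; first by apply: (Dio_ext (Dio_or h2 h3)) => e; rewrite /asat /=; split; tauto.
  by apply: (Dio_ext (Dio_and h1 h4)) => e; rewrite /asat /=; split; tauto.
Qed.

Lemma Dio_E1def R : E1def (A := Nst) R -> Dio R.
Proof.
move=> [f [hf h]]; apply: (Dio_ext _ h) => {R h}.
elim: hf => [g /Dio_qfree[]//|t g _ IH].
have hle : Dio (fun e => neval e (Var 0) < neval e (Add (lift 1 t) One)) by apply: Dio_lt.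
apply: (Dio_ext (Dio_ex (Dio_and hle IH))) => e; rewrite /bEx /asat /=.
have hlt y : (y < neval (scons y e) (lift 1 t) + 1) <->
  (y < neval (scons y e) (lift 1 t) \/ y = neval (scons y e) (lift 1 t)) by lia.
by split=> -[y [h1 h2]]; exists y; split=> //; apply/hlt.
Qed.

(** * Existential definitions with exponentiation *)

Inductive xatom : Type :=
| XEq (s t : term)
| XExp (b k p : term).

Fixpoint xall (X : xatom -> Prop) (L : list xatom) : Prop :=
  if L is a :: L' then X a /\ xall X L' else True.

(** The base is shifted by 1 to agree with [exp_rel], whose modulus would be negative for the base
    0. *)
Definition xholds (e : nat -> nat) (a : xatom) : Prop :=
  match a with
  | XEq s t => neval e s = neval e t
  | XExp b k p => neval e p = (neval e b).+1 ^ neval e k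
  end.

(** Existential definability from equations and the exponential function. *)
Definition XD R := exists m L, forall e : nat -> nat, R e <->
  exists v : nat -> nat, xall (xholds (cat_env m v e)) L.

Lemma XD_ext R S : XD R -> (forall e, R e <-> S e) -> XD S.
Proof. by move=> [m [L h]] h'; exists m, L => e; rewrite -h'. Qed.

Lemma cat_env0 (T : Type) (v e : nat -> T) : cat_env 0 v e = e.
Proof. by apply/funext => i; rewrite /cat_env /= subn0. Qed.

Lemma XD_atom a : XD (fun e => xholds e a).
Proof.
exists 0, [:: a] => e; split=> [h|[v []]]; last by rewrite cat_env0.
by exists (fun=> 0); rewrite cat_env0.
Qed.

Lemma XD_eq s t : XD (fun e => neval e s = neval e t).
Proof. exact: (XD_atom (XEq s t)). Qed.

Lemma XD_exp b k p : XD (fun e => neval e p = (neval e b).+1 ^ neval e k).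
Proof. exact: (XD_atom (XExp b k p)). Qed.

Definition suba sg (a : xatom) : xatom :=
  match a with
  | XEq s t => XEq (subt sg s) (subt sg t)
  | XExp b k p => XExp (subt sg b) (subt sg k) (subt sg p)
  end.

Lemma xall_map (X Y : xatom -> Prop) f L : (forall a, X (f a) <-> Y a) ->
  xall X [seq f a | a <- L] <-> xall Y L.
Proof. by move=> h; elim: L => //= a L ->; rewrite h. Qed.

Lemma xall_cat X L1 L2 : xall X (L1 ++ L2) <-> xall X L1 /\ xall X L2.
Proof. by elim: L1 => /= [|a L1 ->]; tauto. Qed.

Lemma xholds_sub e sg a : xholds e (suba sg a) <-> xholds (fun i => neval e (sg i)) a.
Proof. by case: a => [s t|b k p] /=; rewrite !eval_subt. Qed.

Lemma XD_sub sg R : XD R -> XD (fun e => R (fun i => neval e (sg i))).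
Proof.
move=> [m [L h]].
pose sg' i := if i < m then Var i else lift m (sg (i - m)).
exists m, (map (suba sg') L) => e; rewrite h.
have E v : (fun i => neval (cat_env m v e) (sg' i)) =
    cat_env m v (fun i => neval e (sg i)).
  apply/funext => i; rewrite /sg' {2}/cat_env; case: ifP => hi.
    by rewrite /= /cat_env hi.
  exact: eval_lift_cat.
have Em v : xall (xholds (cat_env m v e)) (map (suba sg') L) <->
    xall (xholds (cat_env m v (fun i => neval e (sg i)))) L.
  by apply: xall_map => a; rewrite xholds_sub E.
by split=> -[v hv]; exists v; move: hv; rewrite Em.
Qed.

Lemma XD_and R S : XD R -> XD S -> XD (fun e => R e /\ S e).
Proof.
move=> [m1 [L1 h1]] [m2 [L2 h2]].
exists (m1 + m2), (map (suba (fun i => Var (ren_l m1 m2 i))) L1 ++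
  map (suba (fun i => Var (ren_r m1 m2 i))) L2) => e.
have El v L : xall (xholds (cat_env (m1 + m2) v e)) (map (suba (fun i => Var (ren_l m1 m2 i))) L)
    <-> xall (xholds (cat_env m1 v e)) L.
  by apply: xall_map => a; rewrite xholds_sub /= cat_env_l.
have Er v L : xall (xholds (cat_env (m1 + m2) v e)) (map (suba (fun i => Var (ren_r m1 m2 i))) L)
    <-> xall (xholds (cat_env m2 (fun j => v (m1 + j)) e)) L.
  by apply: xall_map => a; rewrite xholds_sub /= cat_env_r.
rewrite h1 h2; split.
  move=> [[v1 hv1] [v2 hv2]]; have [v [e1 e2]] := cat_env_merge m1 m2 v1 v2 e.
  by exists v; rewrite xall_cat El Er e1 e2.
move=> [v]; rewrite xall_cat El Er => -[hv1 hv2].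
by split; [exists v|exists (fun j => v (m1 + j))].
Qed.

Lemma XD_ex R : XD R -> XD (fun e => exists y, R (scons y e)).
Proof.
move=> [m [L h]]; exists m.+1, L => e; split.
  by move=> [y /h[v hv]]; rewrite cat_env_scons in hv; eexists; exact: hv.
by move=> [v]; rewrite cat_env_sconsV => hv; exists (v m); apply/h; exists v.
Qed.

Lemma XD_exs r R : XD R -> XD (fun e => exists v : nat -> nat, R (cat_env r v e)).
Proof.
elim: r R => [|r IH] R hR.
  apply: (XD_ext hR) => e; split=> [h|[v]]; last by rewrite cat_env0.
  by exists (fun=> 0); rewrite cat_env0.
apply: (XD_ext (XD_ex (IH _ hR))) => e; split.
  by move=> [y [v hv]]; rewrite cat_env_scons in hv; eexists; exact: hv.
by move=> [v]; rewrite cat_env_sconsV => hv; exists (v r), v.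
Qed.

Lemma XD_forall_lt n (R : nat -> (nat -> nat) -> Prop) :
  (forall j, XD (R j)) -> XD (fun e => forall j, j < n -> R j e).
Proof.
move=> h; elim: n => [|n IH].
  by apply: (XD_ext (XD_eq Zero Zero)) => e; split.
apply: (XD_ext (XD_and IH (h n))) => e; split.
  move=> [h1 h2] j; rewrite ltnS leq_eqVlt => /orP[/eqP->//|]; exact: h1.
by move=> h'; split; [move=> j hj; apply: h'; apply: ltnW|apply: h'].
Qed.

(** * Binomial coefficients and factorials from exponentiation *)

Lemma digit_expansion W b : forall n (d : nat -> nat), (forall j, d j < W) ->
  (forall j, n <= j -> d j = 0) ->
  exists h l, l < W ^ b /\ \sum_(j < n) d j * W ^ j = (h * W + d b) * W ^ b + l.
Proof.
elim: b => [|b IH] [|n] d hW h0.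
- by exists 0, 0; rewrite big_ord0 h0.
- exists (\sum_(j < n) d j.+1 * W ^ j), 0; split=> //.
  rewrite big_ord_recl expn0 !muln1 addn0 addnC big_distrl /=; congr (_ + _).
  by apply: eq_bigr => i _; rewrite expnSr mulnA.
- by exists 0, 0; rewrite big_ord0 h0 ?expn_gt0 ?(leq_trans _ (hW 0)).
have [||h [l [h1 h2]]] := IH n (fun j => d j.+1) => //.
  by move=> j hj; apply: h0.
exists h, (l * W + d 0); split.
  by rewrite expnSr; have := hW 0; nia.
rewrite big_ord_recl expn0 muln1.
have -> : \sum_(i < n) d (fintype.lift ord0 i) * W ^ fintype.lift ord0 i = W * \sum_(j < n) d j.+1 * W ^ j.
  rewrite big_distrr /=; apply: eq_bigr => i _.
  by rewrite /bump /= add1n expnS mulnCA.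
by rewrite h2 expnSr; move: (W ^ b) (d b.+1) => P z; ring.
Qed.

(** The binomial coefficients of [a] sum to [2^a], so in base [W = 2^a + 1] they are the digits of
    [(W + 1)^a]. *)
Lemma binomial_digit a b c : c = 'C(a, b) <-> exists h l,
  [/\ l < (2 ^ a).+1 ^ b, c < (2 ^ a).+1 &
      ((2 ^ a).+1).+1 ^ a = (h * (2 ^ a).+1 + c) * (2 ^ a).+1 ^ b + l].
Proof.
set W := (2 ^ a).+1.
have hC j : 'C(a, j) < W.
  rewrite ltnS; case: (leqP j a) => hj; last by rewrite bin_small.
  have /= := expnDn 1 1 a; rewrite addnn => ->.
  rewrite (bigD1 (Ordinal (hj : j < a.+1))) //= !exp1n !muln1.
  exact: leq_addr.
have hW : 0 < W by [].
have [||h [l [h1 h2]]] := @digit_expansion W b a.+1 (fun j => 'C(a, j)) => //.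
  by move=> j hj; rewrite bin_small.
have e : W.+1 ^ a = (h * W + 'C(a, b)) * W ^ b + l.
  rewrite -h2 -add1n expnDn; apply: eq_bigr => i _; by rewrite exp1n mul1n.
split=> [->|[h' [l' [h3 h4 h5]]]]; first by exists h, l.
have hR : 0 < W ^ b by rewrite expn_gt0.
have E h0 c0 l0 : l0 < W ^ b -> c0 < W -> ((h0 * W + c0) * W ^ b + l0) %/ W ^ b %% W = c0.
  by move=> u v; rewrite divnMDl // divn_small // addn0 modnMDl modn_small.
by rewrite -(E h' c l') // -h5 e E.
Qed.

Lemma ffact_le_exp r n : r ^_ n <= r ^ n.
Proof.
elim: n => [|n IH]; first by rewrite ffactn0.
by rewrite ffactnSr expnSr; apply: leq_mul => //; apply: leq_subr.
Qed.

(** Quantifies how close the falling factorial is to the power: their difference is at most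
    [n^2 r^(n-1)]. The inequality is multiplied by [r] to avoid the predecessor. *)
Lemma ffact_lower r n : n <= r -> r * r ^ n <= r * r ^_ n + n ^ 2 * r ^ n.
Proof.
elim: n => [|n IH] hn; first by rewrite !expn0 ffactn0; lia.
have := IH (ltnW hn); have h := ffact_le_exp r n.
rewrite ffactnSr (expnS r n); move: (r ^_ n) (r ^ n) h => f p h h'.
have [d ed] : exists d, r = n + d by exists (r - n); lia.
have -> : r - n = d by lia.
have h2 : r * (r * p) <= r * (r * f + n ^ 2 * p) by rewrite leq_mul2l h' orbT.
apply: leq_trans h2 _.
have h3 : r * (r * f) = r * (f * d) + n * (r * f) by rewrite {2}ed; lia.
have h4 : n * (r * f) <= n * (r * p) by rewrite !leq_mul2l h !orbT.
rewrite mulnDr h3.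
have h5 : n.+1 ^ 2 * (r * p) = n ^ 2 * (r * p) + n * (r * p) + (n + 1) * (r * p).
  by rewrite -!mulnn; lia.
by rewrite h5; lia.
Qed.

Lemma leq_exp_base a b n : a <= b -> a ^ n <= b ^ n.
Proof. by case: n => // n h; rewrite leq_exp2r. Qed.

Lemma fact_le_exp n : n`! <= n.+1 ^ n.
Proof.
elim: n => // n IH; rewrite factS expnS; apply: leq_mul => //.
by apply: leq_trans IH _; apply: leq_exp_base.
Qed.

(** The quotient [r^n / C(r, n) = n! r^n / r^_n] exceeds [n!] by less than 1 as soon as
    [r > (n! + 1) n^2], and the chosen power is that large. *)
Lemma factorial_quotient n f r : r = n.+2 ^ n.+3 -> f = n`! <-> exists l,
  l < 'C(r, n) /\ r ^ n = f * 'C(r, n) + l.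
Proof.
move=> er.
have hr : (n`! + 1) * n ^ 2 < r.
  have h1 : n`! + 1 <= n.+2 ^ n.+1.
    have := fact_le_exp n; have : n.+1 ^ n <= n.+2 ^ n by apply: leq_exp_base.
    have h0 : 0 < n.+2 ^ n by rewrite expn_gt0.
    by rewrite [n.+2 ^ n.+1]expnS; move: (n.+2 ^ n) (n.+1 ^ n) h0 => p q; nia.
  rewrite er (_ : n.+3 = n.+1 + 2); last by rewrite addn2.
  rewrite expnD.
  apply: leq_ltn_trans (_ : n.+2 ^ n.+1 * n ^ 2 < _); first by rewrite leq_mul2r h1 orbT.
  by rewrite ltn_mul2l expn_gt0 /= ltn_exp2r.
have nr : n <= r.
  by move: hr; rewrite -mulnn; have := fact_gt0 n; nia.
have hb := bin_ffact r n; have hl := ffact_lower nr.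
have hu := ffact_le_exp r n.
have hc : 0 < 'C(r, n) by rewrite bin_gt0.
have hq : r ^ n < (n`! + 1) * 'C(r, n).
  have hp : 0 < r ^ n by rewrite expn_gt0 er expn_gt0.
  rewrite -(ltn_pmul2l (fact_gt0 n)) -(ltn_pmul2l (leq_ltn_trans (leq0n _) hr)).
  have -> : r * (n`! * ((n`! + 1) * 'C(r, n))) = (n`! + 1) * (r * r ^_ n).
    by rewrite -hb; lia.
  have h1 : (n`! + 1) * (r * r ^ n) <= (n`! + 1) * (r * r ^_ n) + (n`! + 1) * n ^ 2 * r ^ n.
    by rewrite -mulnA -mulnDr leq_mul2l hl orbT.
  have h2 : (n`! + 1) * n ^ 2 * r ^ n < r * r ^ n by rewrite ltn_mul2r hp.
  by lia.
split=> [->|[l [h1 h2]]].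
  by exists (r ^ n - n`! * 'C(r, n)); rewrite -hb in hu; split; lia.
have e : r ^ n %/ 'C(r, n) = f by rewrite h2 divnMDl // divn_small // addn0.
have h3 : f < n`! + 1 by rewrite -e ltn_divLR.
have h4 : n`! <= f by rewrite -e leq_divRL // mulnC hb.
by apply/eqP; rewrite eqn_leq h4 andbT -ltnS -[n`!.+1]addn1.
Qed.

Lemma XD_lt s t : XD (fun e => neval e s < neval e t).
Proof.
apply: (XD_ext (XD_ex (XD_eq (Add (Add (lift 1 s) One) (Var 0)) (lift 1 t)))) => e.
split=> [[y]|h]; first by rewrite /= !eval_lift1; lia.
by exists (neval e t - neval e s - 1); rewrite /= !eval_lift1; lia.
Qed.

Lemma XD_binomial : XD (fun e => e 0 = 'C(e 1, e 2)).
Proof.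
pose V := Var.
have h := XD_and (XD_exp One (V 6) (V 0)) (XD_and (XD_exp (Add (V 0) One) (V 6) (V 1))
  (XD_and (XD_exp (V 0) (V 7) (V 2)) (XD_and (XD_lt (V 3) (V 2)) (XD_and
  (XD_lt (V 5) (Add (V 0) One))
  (XD_eq (V 1) (Add (Mul (Add (Mul (V 4) (Add (V 0) One)) (V 5)) (V 2)) (V 3))))))).
apply: (XD_ext (XD_ex (XD_ex (XD_ex (XD_ex (XD_ex h)))))) => e.
rewrite binomial_digit; split.
  move=> [h0 [l [R [P [w [/= -> [-> [-> [h1 [h2 h3]]]]]]]]]]; exists h0, l.
  by rewrite !addn1 in h1 h2 h3; split.
move=> [h0 [l [h1 h2 h3]]].
exists h0, l, ((2 ^ e 1).+1 ^ e 2), ((2 ^ e 1).+2 ^ e 1), (2 ^ e 1) => /=.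
by rewrite !addn1.
Qed.

Lemma XD_factorial : XD (fun e => e 0 = (e 1)`!).
Proof.
pose V := Var.
have hb := XD_sub (fun i => if i is i'.+1 then if i' is 0 then V 1 else V 6 else V 2) XD_binomial.
have h := XD_and (XD_exp (Add (V 6) One) (Add (V 6) (Add One (Add One One))) (V 1))
  (XD_and (XD_eq (V 1) (Add (V 0) One)) (XD_and (XD_exp (V 0) (V 6) (V 3)) (XD_and hb (XD_and (XD_lt (V 4) (V 2))
  (XD_eq (V 3) (Add (Mul (V 5) (V 2)) (V 4))))))).
apply: (XD_ext (XD_ex (XD_ex (XD_ex (XD_ex (XD_ex h)))))) => e.
rewrite (factorial_quotient _ erefl); split.
  move=> [l [P [c [r [r' [/= h1 [h2 [h3 [h4 [h5 h6]]]]]]]]]]; exists l.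
  have er : r = (e 1).+2 ^ (e 1).+3 by rewrite h1 addn1 addn3.
  rewrite -er -h4; split=> //.
  by rewrite h2 addn1 -h3.
move=> [l [h1 h2]]; pose r := (e 1).+2 ^ (e 1).+3.
have hr : 0 < r by rewrite expn_gt0.
exists l, (r ^ e 1), 'C(r, e 1), r, r.-1 => /=.
by rewrite addn1 addn3 addn1 prednK.
Qed.

(** [bounded_forall] made existential: divisibility and congruence modulo [Q] get explicit
    quotients, and beyond polynomials only factorials and binomial coefficients remain. *)
Theorem XD_bounded_forall R : Dio R ->
  XD (fun e => forall x, x < e 0 -> R (scons x e)).
Proof.
move=> [m [s [t hR]]]; pose V := Var.
pose ev q (v : nat -> nat) x e := neval (cat_env m v (scons x e)) q.
have ev_mono q e v v' x x' : (forall j, j < m -> v j <= v' j) -> x <= x' ->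
    ev q v x e <= ev q v' x' e.
  move=> h1 h2; apply: neval_mono => i; rewrite /cat_env; case: ifP => [/h1//|_].
  by case: (i - m).
have ev_mod q e v v' x x' d : (forall j, j < m -> v j = v' j %[mod d]) -> x = x' %[mod d] ->
    ev q v x e = ev q v' x' e %[mod d].
  move=> h1 h2; apply: neval_mod => i; rewrite /cat_env; case: ifP => [/h1//|_].
  by case: (i - m).
pose B u e := e 0 + u + 1 + ev s (fun=> u) (e 0) e + ev t (fun=> u) (e 0) e.
have sem e : (forall x, x < e 0 -> R (scons x e)) <->
  exists u F T Q, F = (B u e)`! /\ T = e 0 + F * F /\ Q = 'C(T, e 0) /\
  exists Y : nat -> nat, (forall j, j < m -> exists c h, c = 'C(Y j, u.+1) /\ c = h * Q) /\
    exists h h', ev s Y T e + h * Q = ev t Y T e + h' * Q.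
  have bf u := @bounded_forall (e 0) u m (fun v x => ev s v x e) (fun v x => ev t v x e)
    (fun v v' x x' => @ev_mono s e v v' x x') (fun v v' x x' => @ev_mono t e v v' x x')
    (fun v v' x x' d => @ev_mod s e v v' x x' d) (fun v v' x x' d => @ev_mod t e v v' x x' d).
  split.
    (* Finitely many [x] are concerned, so a single [u] bounds all witnesses. *)
    move=> h; have [u hu] : exists u, forall x, x < e 0 ->
        exists v, (forall j, j < m -> v j <= u) /\ ev s v x e = ev t v x e.
      elim: (e 0) h => [|k IH] h; first by exists 0.
      have [|u hu] := IH; first by move=> x hx; apply: h; apply: ltnW.
      have /hR[w hw] := h k (ltnSn k).
      have wB j : j < m -> w j <= \sum_(i < m) w i.
        by move=> hj; rewrite (bigD1 (Ordinal hj)) //= leq_addr.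
      exists (u + \sum_(i < m) w i) => x; rewrite ltnS leq_eqVlt => /orP[/eqP ->|/hu].
        by exists w; split=> // j /wB hj; apply: leq_trans hj (leq_addl _ _).
      move=> [v [h1 h2]]; exists v; split=> // j /h1 hj.
      exact: leq_trans hj (leq_addr _ _).
    have [Y [h1 h2]] := (proj1 (bf u)) hu.
    do 4 eexists; do 3 split=> //; exists Y; split.
      by move=> j /h1 /dvdnP[h' eh]; exists 'C(Y j, u.+1), h'.
    move: h2; set Q := 'C(_, _); set a := ev s Y _ e; set b := ev t Y _ e => h2.
    have [hle|hle] := leqP a b.
      exists ((b - a) %/ Q), 0; rewrite divnK ?subnKC ?addn0 //.
      by rewrite -eqn_mod_dvd // eq_sym; apply/eqP.
    exists 0, ((a - b) %/ Q); have hle' := ltnW hle.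
    rewrite divnK ?subnKC ?addn0 //.
    by rewrite -eqn_mod_dvd //; apply/eqP.
  move=> [u [F [T [Q [eF [eT [eQ [Y [h1 [h [h' e2]]]]]]]]]]].
  suff : forall x, x < e 0 -> exists v, (forall j, j < m -> v j <= u) /\ ev s v x e = ev t v x e.
    by move=> h2 x /h2[v [_ hv]]; apply/hR; exists v.
  apply/bf; rewrite -/(B u e) -eF -eT -eQ; exists Y; split.
    by move=> j /h1[c [g [<- ->]]]; apply: dvdn_mull.
  have := congr1 (fun z => z %% Q) e2.
  by rewrite ![_ + _ * Q]addnC !modnMDl.
suff : XD (fun e => exists u F T Q, F = (B u e)`! /\ T = e 0 + F * F /\ Q = 'C(T, e 0) /\
  exists Y : nat -> nat, (forall j, j < m -> exists c h, c = 'C(Y j, u.+1) /\ c = h * Q) /\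
    exists h h', ev s Y T e + h * Q = ev t Y T e + h' * Q).
  by move=> h; apply: (XD_ext h) => e; symmetry; apply: sem.
(* [sB] evaluates a polynomial at the extreme values, all witnesses [u] and [x = e 0], under the
   quantifiers for [u, F, T, Q]; [sY] evaluates it at [Y] and [T], under the block [Y] and two
   quotients as well. *)
pose sB i := if i < m then V 3 else if i == m then V 4 else V (4 + (i - m).-1).
pose sY i := if i < m then V i.+2 else if i == m then V m.+3 else V (i + 5).
have EB q (e' : nat -> nat) : neval e' (subt sB q) = ev q (fun=> e' 3) (e' 4) (fun i => e' (4 + i)).
  rewrite eval_subt; congr eval; apply/funext => i; rewrite /sB /cat_env.
  case: (ltngtP i m) => // h; last by rewrite h subnn.
  by case: (i - m) (subn_gt0 m i) => [|l _ //]; rewrite h.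
have EY q (a b : nat) Y (e' : nat -> nat) : neval (scons a (scons b (cat_env m Y e'))) (subt sY q) =
    ev q Y (e' 1) (fun i => e' (4 + i)).
  rewrite eval_subt; congr eval; apply/funext => i; rewrite /sY /cat_env.
  case: (ltngtP i m) => h /=; first by rewrite h.
    have -> : i + 5 = (i + 3).+2 by lia.
    rewrite /= ltnNge (leq_trans (ltnW h)) ?leq_addr //= -(subnSK h) /=.
    by congr e'; lia.
  by rewrite ltnNge leqnSn /= h subnn subSnn.
have hF := XD_sub (fun i => if i is 0 then V 2 else
  Add (Add (Add (Add (V 4) (V 3)) One) (subt sB s)) (subt sB t)) XD_factorial.
have hQ := XD_sub (fun i => if i is i'.+1 then if i' is 0 then V 1 else V 4 else V 0) XD_binomial.
have hC j := XD_ex (XD_ex (XD_and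
  (XD_sub (fun i => if i is i'.+1 then if i' is 0 then V j.+2 else Add (V (m + 5)) One else V 1)
    XD_binomial) (XD_eq (V 1) (Mul (V 0) (V m.+2))))).
have hE := XD_ex (XD_ex (XD_eq (Add (subt sY s) (Mul (V 1) (V m.+2)))
  (Add (subt sY t) (Mul (V 0) (V m.+2))))).
have h := XD_ex (XD_ex (XD_ex (XD_ex (XD_and hF (XD_and
  (XD_eq (V 1) (Add (V 4) (Mul (V 2) (V 2)))) (XD_and hQ
  (XD_exs m (XD_and (XD_forall_lt m hC) hE)))))))).
apply: (XD_ext h) => e {hF hQ hC hE h sem}.
have cm Y (e' : nat -> nat) k : cat_env m Y e' (m + k) = e' k.
  by rewrite /cat_env ltnNge leq_addr /= addKn.
have cm0 Y (e' : nat -> nat) : cat_env m Y e' m = e' 0 by rewrite -{2}[m]addn0 cm.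
have e5 : m + 5 = (m + 3).+2 by lia.
have cj Y (e' : nat -> nat) j : j < m -> cat_env m Y e' j = Y j by rewrite /cat_env => ->.
split=> -[u [F [T [Q [hF [hT [hQ [Y [h1 h2]]]]]]]]]; exists u, F, T, Q.
  split; first by move: hF => /=; rewrite !EB.
  split=> //; split=> //; exists Y; split.
    move=> j hj; have [c [h [/= h3 h4]]] := h1 j hj; exists c, h; move: h3 h4.
    by rewrite cj // e5 /= cm cm0 addn1.
  by move: h2 => [h [h' h2]]; exists h, h'; move: h2; rewrite /= !EY cm0.
split; first by rewrite /= !EB.
split=> //; split=> //; exists Y; split.
  move=> j hj; have [c [h [h3 h4]]] := h1 j hj; exists c, h => /=.
  by rewrite cj // e5 /= cm cm0 addn1.
by move: h2 => [h [h' h2]]; exists h, h'; rewrite /= !EY cm0.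
Qed.

(** * Transfer from the natural numbers to a nonstandard model *)

Fixpoint tbound (t : term) : nat :=
  match t with
  | Var i => i.+1
  | Zero | One => 0
  | Add s t | Mul s t => maxn (tbound s) (tbound t)
  end.

Lemma eval_agree (A : arith_structure) t (e e' : nat -> A) :
  (forall i, i < tbound t -> e i = e' i) -> eval A e t = eval A e' t.
Proof.
elim: t => //= [i h|s IHs t IHt h|s IHs t IHt h]; first exact: h.
- by rewrite IHs ?IHt // => i hi; apply: h; rewrite leq_max hi ?orbT.
- by rewrite IHs ?IHt // => i hi; apply: h; rewrite leq_max hi ?orbT.
Qed.

Fixpoint dtbound (t : dterm) : nat :=
  match t with
  | DVar i => i.+1
  | DZero | DOne => 0
  | DAdd s t | DMul s t | DDiv s t | DMod s t => maxn (dtbound s) (dtbound t)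
  end.

Fixpoint dfbound (f : dform) : nat :=
  match f with
  | DEq s t | DLt s t => maxn (dtbound s) (dtbound t)
  | DNot f => dfbound f
  | DAnd f g | DOr f g | DImp f g => maxn (dfbound f) (dfbound g)
  end.

Lemma deval_agree (A : arith_structure) t (e e' : nat -> A) :
  (forall i, i < dtbound t -> e i = e' i) -> deval e t = deval e' t.
Proof.
elim: t => //= [i h|s IHs t IHt h|s IHs t IHt h|s IHs t IHt h|s IHs t IHt h];
  first exact: h.
all: by rewrite IHs ?IHt // => i hi; apply: h; rewrite leq_max hi ?orbT.
Qed.

Lemma dsat_agree (A : arith_structure) f (e e' : nat -> A) :
  (forall i, i < dfbound f -> e i = e' i) -> dsat e f <-> dsat e' f.
Proof.
elim: f => /= [s t h|s t h|f IH h|f IHf g IHg h|f IHf g IHg h|f IHf g IHg h].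
1,2: by rewrite (deval_agree (e := e) (e' := e') (t := s)) ?(deval_agree (e := e) (e' := e') (t := t)) //
  => i hi; apply: h; rewrite leq_max hi ?orbT.
- by rewrite IH.
all: by rewrite IHf ?IHg // => i hi; apply: h; rewrite leq_max hi ?orbT.
Qed.

Definition xbound (a : xatom) : nat :=
  match a with
  | XEq s t => maxn (tbound s) (tbound t)
  | XExp b k p => maxn (tbound b) (maxn (tbound k) (tbound p))
  end.

Section Transfer.
Variable M : arith_structure.
Hypothesis hI : IE1 M.
Hypothesis hns : nonstandard M.
Let hM : PA_minus M := proj1 hI.
Let hE : euclidean M := IE1_euclidean hI.
Local Notation num := (numeral M).

Lemma eval_num (e : nat -> nat) t : eval M (fun i => num (e i)) t = num (neval e t).
Proof.
elim: t => //= [|s -> t ->|s -> t ->]; first by pa_lra hM.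
  exact/esym/(numD hM).
exact/esym/(numM hM).
Qed.

Lemma is_div_num (x y q : nat) : is_div (A := Nst) x y q -> is_div (num x) (num y) (num q).
Proof.
move=> [[/= -> ->]|[h1 h2]]; first by left.
right; rewrite -!(numM hM, numD hM); split; last exact/num_lt.
by apply/num_le => //; case: h1 => /= [/ltnW|->].
Qed.

Lemma num_ediv (x y : nat) : num (ediv (A := Nst) x y) = ediv (num x) (num y).
Proof.
apply/esym/(edivE hM hE); apply: (@is_div_num x y (ediv (A := Nst) x y)).
exact: (is_div_ediv Nst_PA Nst_euclidean).
Qed.

Lemma num_emod (x y : nat) : num (emod (A := Nst) x y) = emod (num x) (num y).
Proof.
have h1 : x = (ediv (A := Nst) x y * y + emod (A := Nst) x y)%N :=
  ediv_eq Nst_PA Nst_euclidean x y.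
have h2 := ediv_eq hM hE (num x) (num y); rewrite -num_ediv in h2.
have := congr1 num h1; rewrite numD // numM // {1}h2 => h3.
by clear h2; pa_lra hM.
Qed.

Lemma deval_num (e : nat -> nat) t : deval (fun i => num (e i)) t = num (deval (A := Nst) e t).
Proof.
elim: t => //= [|s -> t ->|s -> t ->|s -> t ->|s -> t ->].
- by pa_lra hM.
- exact/esym/(numD hM).
- exact/esym/(numM hM).
- exact/esym/num_ediv.
- exact/esym/num_emod.
Qed.

Lemma dsat_num (e : nat -> nat) f : dsat (fun i => num (e i)) f <-> dsat (A := Nst) e f.
Proof.
elim: f => /= [s t|s t|f IH|f IHf g IHg|f IHf g IHg|f IHf g IHg].
- by rewrite !deval_num; split=> [/(num_inj hM)|->].
- by rewrite !deval_num; apply: num_lt.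
- by rewrite IH.
all: by rewrite IHf IHg.
Qed.

(** The parameters [a] and [s] stay fixed. [exp_rel] is known to mean exponentiation at standard
    arguments only, so these atoms carry no intended meaning elsewhere. *)
Definition xholdsM (a s : M) (e : nat -> M) (x : xatom) : Prop :=
  match x with
  | XEq t t' => eval M e t = eval M e t'
  | XExp b k p => exp_rel a s (eval M e b) (eval M e k) (eval M e p)
  end.

Lemma xholdsM_agree a s x e e' : (forall i, i < xbound x -> e i = e' i) ->
  xholdsM a s e x <-> xholdsM a s e' x.
Proof.
case: x => [t t'|b k p] /= h.
  by rewrite (@eval_agree _ t e e') ?(@eval_agree _ t' e e') // => i hi; apply: h;
     rewrite !leq_max hi ?orbT.
by rewrite (@eval_agree _ b e e') ?(@eval_agree _ k e e') ?(@eval_agree _ p e e') // => i hi;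
  apply: h; rewrite !leq_max hi ?orbT.
Qed.

Lemma xallM_agree a s L e e' : (forall i, i < foldr maxn 0 (map xbound L) -> e i = e' i) ->
  xall (xholdsM a s e) L <-> xall (xholdsM a s e') L.
Proof.
elim: L => //= x L IH h; rewrite IH ?(@xholdsM_agree a s x e e') // => i hi; apply: h;
  by rewrite leq_max hi ?orbT.
Qed.

Lemma E1def_xholdsM i j x : E1def (fun e : nat -> M => xholdsM (e i) (e j) e x).
Proof.
case: x => [t t'|b k p] /=; first exact: E1def_eq.
exact: (E1def_sub (fun l => match l with 0 => Var i | 1 => Var j | 2 => b | 3 => k | _ => p end)
  (E1def_exp_rel hM)).
Qed.

Lemma E1def_xall i j L : E1def (fun e : nat -> M => xall (xholdsM (e i) (e j) e) L).
Proof.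
elim: L => /= [|x L IH]; last by apply: E1def_and => //; apply: E1def_xholdsM.
by apply: (E1def_ext (E1def_eq M Zero Zero)).
Qed.

(** The hypothesis has an existential definition by equations and
    exponentials.  No certificate for it below a standard bound is wrong, so by
    overspill none below some nonstandard bound is; and below that bound there
    are certificates at all standard [i], hence at some nonstandard one. *)
Theorem transfer (f : dform) :
  (forall i : nat, exists (k : nat) (W : nat -> nat), 0 < k /\ forall x, x < k ->
     dsat (A := Nst) (scons x (scons k (scons i W))) f) ->
  exists (i k : M) (W : nat -> M), [/\ ~ std i, lt zero k & forall x, lt x k ->
     dsat (scons x (scons k (scons i W))) f].
Proof.
move=> hN.
have hD : Dio (fun e => dsat (A := Nst) e f).
  exact: Dio_E1def (E1def_dsat Nst_PA Nst_euclidean f).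
have [m [L hL]] := XD_bounded_forall hD.
(* Layout of the quantified block: the witnesses of [L] below [m], then [k] at [m], [i] at [m + 1]
   and the parameters from [m + 2] on; all variables used lie below [n], and position [n] is kept
   for a counterexample. *)
pose n := maxn (m + (dfbound f).+2) (foldr maxn 0 (map xbound L)).
have [a [s has]] := exp_rel_exists hI hns.
have xallN (e : nat -> M) (w : nat -> nat) : (forall j, j < n -> e j = num (w j)) ->
    xall (xholdsM a s e) L <-> xall (xholds w) L.
  move=> he; have : forall j, j < foldr maxn 0 (map xbound L) -> e j = num (w j).
    by move=> j hj; apply: he; rewrite leq_max hj orbT.
  elim: (L) => //= x L' IH h.
  rewrite IH; last by move=> j hj; apply: h; rewrite leq_max hj orbT.
  rewrite (@xholdsM_agree a s x e (fun i => num (w i))); last first.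
    by move=> j hj; apply: h; rewrite leq_max hj.
  case: x {h} => [t t'|b k p] /=; rewrite !eval_num.
    split=> -[h1 h2]; split=> //; first exact: (num_inj hM).
    by rewrite h1.
  by rewrite has.
(* A certificate for [k = E m] contradicted by some [x < k]. The parameters of [exp_rel] sit beyond
   the block, after the bound. *)
pose bad (E : nat -> M) := xall (xholdsM (E n.+2) (E n.+3) E) L /\
  (lt (E n) (E m) /\ ~ dsat (scons (E n) (fun j => E (m + j))) f).
have hbad : E1def bad.
  apply: E1def_and => //; first exact: E1def_xall.
  apply: E1def_and => //; first exact: (E1def_lt M (Var n) (Var m)).
  have h := proj2 (E1def_dsat_not hM hE f).
  apply: (E1def_ext (E1def_ren (fun i => if i is i'.+1 then m + i' else n) h)) => E.
  have -> // : (fun i => E (if i is i'.+1 then m + i' else n)) = scons (E n) (fun j => E (m + j)).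
  by apply/funext => -[].
have hG := E1def_exs n.+1 (Var 0) hbad.
have hmn j : j <= (dfbound f).+1 -> m + j < n.
  move=> hj; apply: leq_trans (leq_maxl _ _); by rewrite ltn_add2l ltnS.
have catE (u e : nat -> M) j : j <= n -> cat_env n.+1 u e j = u j.
  by move=> hj; rewrite /cat_env ltnS hj.
have catP (u e : nat -> M) j : cat_env n.+1 u e (n.+1 + j) = e j.
  by rewrite /cat_env ltnNge leq_addr /= addKn.
have catA (u e : nat -> M) : cat_env n.+1 u e n.+2 = e 1 by rewrite -[n.+2]addn1 catP.
have catS (u e : nat -> M) : cat_env n.+1 u e n.+3 = e 2 by rewrite -[n.+3]addn2 catP.
have [N|b [hb hGb]] := U1_overspill hI hns (e := scons a (scons s (fun=> zero))) hG.
  move=> [u [hu [h1 [h2 h3]]]].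
  have [w hw] : exists w : nat -> nat, forall j, j <= n -> u j = num (w j).
    have h j : exists x, j <= n -> u j = num x.
      case: (leqP j n) => hj; last by exists 0.
      by have [x ->] := std_le hM (hu j hj); exists x.
    by exists (fun j => proj1_sig (cid (h j))) => j hj; case: cid => x /= /(_ hj).
  rewrite catA catS /= in h1.
  have {}h1 : xall (xholds w) L.
    apply/(xallN (cat_env n.+1 u (scons (num N) (scons a (scons s (fun=> zero)))))) => // j hj.
    by rewrite catE ?hw // ltnW.
  have hmn0 : m <= n by have := hmn 0 isT; rewrite addn0 => /ltnW.
  rewrite !catE // !hw // in h2.
  move/(num_lt hM): h2 => h2.
  have /hL : exists v, xall (xholds (cat_env m v (fun j => w (m + j)))) L.
    exists w; have -> // : cat_env m w (fun j => w (m + j)) = w.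
    by apply/funext => j; rewrite /cat_env; case: ltnP => // hj; rewrite subnKC.
  rewrite addn0 => /(_ (w n) h2) h4; apply: h3.
  have hag : forall i, i < dfbound f ->
      scons (cat_env n.+1 u (scons (num N) (scons a (scons s (fun=> zero)))) n)
        (fun j => cat_env n.+1 u (scons (num N) (scons a (scons s (fun=> zero)))) (m + j)) i =
      num (scons (w n) (fun j => w (m + j)) i).
    case=> [_|i hi] /=; first by rewrite catE ?hw.
    have hle : m + i <= n by apply/ltnW/hmn; do 2 apply: ltnW; exact: ltnW.
    by rewrite catE ?hw.
  exact/(dsat_agree hag)/dsat_num.
pose good (E : nat -> M) := E m.+1 = E n.+1 /\
  (lt zero (E m) /\ xall (xholdsM (E n.+3) (E n.+4) E) L).
have hgood : E1def good.
  apply: E1def_and => //; first exact: (E1def_eq M (Var m.+1) (Var n.+1)).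
  apply: E1def_and => //; first exact: (E1def_lt M Zero (Var m)).
  exact: E1def_xall.
have hH := E1def_exs n.+1 (Var 1) hgood.
have catS' (u e : nat -> M) : cat_env n.+1 u e n.+4 = e 3 by rewrite -[n.+4]addn3 catP.
have cat0 (u e : nat -> M) : cat_env n.+1 u e n.+1 = e 0 by rewrite -(catP u e 0) addn0.
have hm1 : m.+1 <= n by have := hmn 1 isT; rewrite addn1 => /ltnW.
have [N|i [hi [u [hu [h1 [h0 h2]]]]]] :=
    E1_overspill hI hns (e := scons b (scons a (scons s (fun=> zero)))) hH.
  have [k [W [hk hW]]] := hN N.
  have /hL[v hv] : forall x, x < scons k (scons N W) 0 ->
    dsat (A := Nst) (scons x (scons k (scons N W))) f by [].
  pose w := cat_env m v (scons k (scons N W)).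
  exists (fun j => num (w j)); split.
    by move=> j hj; left; apply: nstd_gt.
  split; first by rewrite cat0 catE // /w /cat_env ltnNge leqnSn /= subSnn.
  split; first by rewrite catE ?(ltnW hm1) // /w /cat_env ltnn subnn /=; apply/(num_lt hM 0).
  rewrite catS catS' /=; apply/(xallN _ w) => // j hj.
  by rewrite catE // ltnW.
rewrite catS catS' /= in h2; rewrite cat0 catE //= in h1.
rewrite (catE _ _ _ (ltnW hm1)) in h0.
exists i, (u m), (fun j => u (m + j.+2)); split=> // x hx.
(* Since [x < k <= b], a counterexample would complete the certificate to a bad block below [b]. *)
apply: contrapT => hf; apply: hGb.
exists (fun j => if j == n then x else u j).
have hmn0 : m < n by have := hmn 0 isT; rewrite addn0.
have hum : le (u m) b := hu m (ltnW hmn0).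
split.
  move=> j hj /=; case: eqP => [_|_]; last exact: hu.
  by left; case: hum => [h|<- //]; apply: (pa_lt_trans hM) hx h.
split.
  rewrite catA catS /=; apply: (proj1 (@xallM_agree _ _ _ _ _ _) h2) => j hj.
  have hj' : j < n by apply: leq_trans hj (leq_maxr _ _).
  by rewrite !(catE _ _ _ (ltnW hj')) ltn_eqF.
split; first by rewrite (catE _ _ _ (leqnn n)) (catE _ _ _ (ltnW hmn0)) eqxx ltn_eqF.
move=> h; apply: hf; move: h.
rewrite catE // eqxx => h.
set e' := scons x _ in h; have hag : forall j, j < dfbound f ->
    e' j = scons x (scons (u m) (scons i (fun j => u (m + j.+2)))) j.
  case=> [//|j] hj; have hj' : m + j < n by apply: hmn; do 3 apply: ltnW.
  rewrite /e' /= (catE _ _ _ (ltnW hj')) ltn_eqF //.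
  by case: j hj hj' => [|[|j]] hj hj' //=; rewrite ?addn0 // addn1 h1.
exact/(dsat_agree hag).
Qed.

End Transfer.

(** * Digraphs coded by hereditarily finite sets *)

Section Package.
Variable A : arith_structure.
Variables (x k i K d cE cN cF cU cT cV cW : A).
Local Notation "x + y" := (add x y).
Local Notation "x * y" := (mul x y).
Local Notation "1" := one.
Local Notation two := (1 + 1).

Definition arr (c j : A) : A := emod c (1 + (j + 1) * d).
Definition pbit (m p : A) : Prop := emod (ediv m p) two = 1.
Definition blk (w y : A) : A := emod (ediv w y) y.
Definition side : A := i + 1.
Definition size2 : A := side * side.
Definition rado (c c' : A) : Prop :=
  (lt c c' /\ pbit c' (arr cE c)) \/ (lt c' c /\ pbit c (arr cE c')).
Definition edge (a b : A) : Prop :=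
  lt (ediv a side) (ediv b side) /\ rado (emod a side) (emod b side).
Definition flag (u e : A) : Prop := blk u (arr cE e) = 1.

(** [arr cE] tabulates the powers of 2 and [arr cN] the 2-adic valuation;
    [arr cF] embeds the digraph [edge] into Ackermann membership, and
    [arr cU, ..., arr cW] are the four codes of [fExp2] at the exponents
    [arr cF a]. *)
Definition pkg_exp (a b : A) : Prop :=
  (k = K * K /\ (arr cE zero = 1 /\ (arr cE 1 = two /\ ~ lt K size2))) /\
  ((lt (a + b) K -> arr cE (a + b) = arr cE a * arr cE b) /\
  (lt a (arr cE a) /\
  (lt zero a -> emod a (arr cE (arr cN a)) = zero /\
     (pbit a (arr cE (arr cN a)) /\ lt (arr cN a) K)))).

(** Exponents above 1 ensure that only the disjunct of [fExp2] with codes is relevant. *)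
Definition pkg_node (a b : A) : Prop :=
  lt a size2 -> lt b size2 ->
  lt 1 (arr cF a) /\ (lt (arr cF a) K /\
  ((arr cF a = arr cF b -> a = b) /\
  ((pbit (arr cF b) (arr cE (arr cF a)) -> edge a b) /\
   (edge a b -> pbit (arr cF b) (arr cE (arr cF a)))))).

(** The flagged exponents up to [arr cF a] are to be the powers of two. This is expressed by
    halving, as a recursion on [b] without exponentiation; the last clauses supply the bound [p * p]
    of [fExp2]. *)
Definition pkg_code (a b : A) : Prop :=
  lt a size2 -> lt zero b -> ~ lt (arr cF a) b ->
  ((flag (arr cU a) b -> b = 1 \/ (emod b two = zero /\ flag (arr cU a) (ediv b two))) /\
   (b = 1 \/ (emod b two = zero /\ flag (arr cU a) (ediv b two)) -> flag (arr cU a) b)) /\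
  ((flag (arr cU a) b -> blk (arr cT a) (arr cE b) = b /\
     (blk (arr cV a) (arr cE b) = emod (arr cF a) b /\
      blk (arr cW a) (arr cE b) = arr cE (emod (arr cF a) b))) /\
  (lt (arr cU a) (arr cE (arr cF a) * arr cE (arr cF a)) /\
  (lt (arr cT a) (arr cE (arr cF a) * arr cE (arr cF a)) /\
  (lt (arr cV a) (arr cE (arr cF a) * arr cE (arr cF a)) /\
   lt (arr cW a) (arr cE (arr cF a) * arr cE (arr cF a)))))).

(** The transfer allows one universal quantifier, so [x = b * K + a] ranges over the pairs of
    indices below [K]. *)
Definition pkg : Prop :=
  pkg_exp (emod x K) (ediv x K) /\
  (pkg_node (emod x K) (ediv x K) /\ pkg_code (emod x K) (ediv x K)).

End Package.

Section PackageFormula.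
Let x := DVar 0. Let k := DVar 1. Let i := DVar 2. Let K := DVar 3. Let d := DVar 4.
Let cE := DVar 5. Let cN := DVar 6. Let cF := DVar 7. Let cU := DVar 8.
Let cT := DVar 9. Let cV := DVar 10. Let cW := DVar 11.
Let two := DAdd DOne DOne.
Let arr c j := DMod c (DAdd DOne (DMul (DAdd j DOne) d)).
Let pbit m p := DEq (DMod (DDiv m p) two) DOne.
Let blk w y := DMod (DDiv w y) y.
Let side := DAdd i DOne.
Let size2 := DMul side side.
Let rado c c' := DOr (DAnd (DLt c c') (pbit c' (arr cE c)))
  (DAnd (DLt c' c) (pbit c (arr cE c'))).
Let edge a b := DAnd (DLt (DDiv a side) (DDiv b side)) (rado (DMod a side) (DMod b side)).
Let flag u e := DEq (blk u (arr cE e)) DOne.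
Let a := DMod x K.
Let b := DDiv x K.
Let f_exp := DAnd
  (DAnd (DEq k (DMul K K)) (DAnd (DEq (arr cE DZero) DOne) (DAnd (DEq (arr cE DOne) two) (DNot (DLt K size2)))))
  (DAnd (DImp (DLt (DAdd a b) K) (DEq (arr cE (DAdd a b)) (DMul (arr cE a) (arr cE b))))
  (DAnd (DLt a (arr cE a))
  (DImp (DLt DZero a) (DAnd (DEq (DMod a (arr cE (arr cN a))) DZero)
     (DAnd (pbit a (arr cE (arr cN a))) (DLt (arr cN a) K)))))).
Let f_node := DImp (DLt a size2) (DImp (DLt b size2)
  (DAnd (DLt DOne (arr cF a)) (DAnd (DLt (arr cF a) K)
  (DAnd (DImp (DEq (arr cF a) (arr cF b)) (DEq a b))
  (DAnd (DImp (pbit (arr cF b) (arr cE (arr cF a))) (edge a b))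
        (DImp (edge a b) (pbit (arr cF b) (arr cE (arr cF a))))))))).
Let half := DOr (DEq b DOne) (DAnd (DEq (DMod b two) DZero) (flag (arr cU a) (DDiv b two))).
Let pp := DMul (arr cE (arr cF a)) (arr cE (arr cF a)).
Let f_code := DImp (DLt a size2) (DImp (DLt DZero b) (DImp (DNot (DLt (arr cF a) b))
  (DAnd (DAnd (DImp (flag (arr cU a) b) half) (DImp half (flag (arr cU a) b)))
  (DAnd (DImp (flag (arr cU a) b) (DAnd (DEq (blk (arr cT a) (arr cE b)) b)
     (DAnd (DEq (blk (arr cV a) (arr cE b)) (DMod (arr cF a) b))
           (DEq (blk (arr cW a) (arr cE b)) (arr cE (DMod (arr cF a) b))))))
  (DAnd (DLt (arr cU a) pp) (DAnd (DLt (arr cT a) pp) (DAnd (DLt (arr cV a) pp)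
     (DLt (arr cW a) pp)))))))).

Definition pkg_form := DAnd f_exp (DAnd f_node f_code).
End PackageFormula.

(** The formula mirrors the definitions symbol by symbol, so both sides are convertible. *)
Lemma pkg_formE (A : arith_structure) (x k i : A) (W : nat -> A) :
  dsat (scons x (scons k (scons i W))) pkg_form <->
  pkg x k i (W 0) (W 1) (W 2) (W 3) (W 4) (W 5) (W 6) (W 7) (W 8).
Proof. by []. Qed.

(** * Binary digits and the package in the natural numbers *)

Definition nbit (m x : nat) : bool := odd (m %/ 2 ^ x).

Lemma nbit0 m : nbit m 0 = odd m.
Proof. by rewrite /nbit expn0 divn1. Qed.

Lemma nbitS m x : nbit m x.+1 = nbit m./2 x.
Proof. by rewrite /nbit expnS divnMA divn2. Qed.

Lemma nbit_half (b : bool) m x : nbit (b + m.*2) x = if x is y.+1 then nbit m y else b.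
Proof.
case: x => [|x]; first by rewrite nbit0 oddD odd_double addbF; case: b.
by rewrite nbitS half_bit_double.
Qed.

Lemma nbit_build N (S : nat -> bool) :
  exists m, m < 2 ^ N /\ forall x, nbit m x = (x < N) && S x.
Proof.
elim: N S => [|N IH] S.
  by exists 0; split=> // x; rewrite /nbit div0n.
have [m [h1 h2]] := IH (fun x => S x.+1).
exists (S 0 + m.*2); split; first by rewrite expnS -muln2; case: (S 0) => /=; lia.
by move=> x; rewrite nbit_half; case: x.
Qed.

Lemma nbit_ext m m' : (forall x, nbit m x = nbit m' x) -> m = m'.
Proof.
have [N] := ubnP (m + m'); elim: N m m' => // N IH m m' hN h.
have [h0|h0] := posnP (m + m'); first by lia.
have h1 := h 0; rewrite !nbit0 in h1.
rewrite -(odd_double_half m) -(odd_double_half m') h1; congr (_ + _.*2).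
by apply: IH => [|x]; [lia|rewrite -!nbitS].
Qed.

Lemma nbit_div m e x : nbit (m %/ 2 ^ e) x = nbit m (e + x).
Proof. by rewrite /nbit expnD divnMA. Qed.

Lemma nbit_small m x : m < 2 ^ x -> nbit m x = false.
Proof. by move=> h; rewrite /nbit divn_small. Qed.

Lemma nbit_mod m e x : nbit (m %% 2 ^ e) x = (x < e) && nbit m x.
Proof.
have [hx|hx] := ltnP x e; last first.
  apply: nbit_small; apply: (@leq_trans (2 ^ e)); last by rewrite leq_exp2l.
  by rewrite ltn_pmod // expn_gt0.
rewrite /nbit {2}(divn_eq m (2 ^ e)) -{3}(subnK (ltnW hx)) expnD mulnA.
by rewrite divnMDl ?expn_gt0 // oddD oddM oddX /= subn_eq0 leqNgt hx andbF.
Qed.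

(** The intervals from [2^i] to [2^(i+1) - 1] partition the positive positions, so the blocks can be
    prescribed independently. The last clause gives access to positions that are not powers of two,
    where no flag may appear. *)
Lemma block_exists N (dl : nat -> nat) : (forall e, dl e < 2 ^ e) ->
  exists w, [/\ w < 2 ^ N.*2,
    forall i, 2 ^ i <= N -> (w %/ 2 ^ (2 ^ i)) %% 2 ^ (2 ^ i) = dl (2 ^ i) &
    forall e i, 2 ^ i <= e < 2 ^ i.+1 -> e <= N -> nbit w e = nbit (dl (2 ^ i)) (e - 2 ^ i)].
Proof.
move=> hdl; pose p x := 2 ^ trunc_log 2 x.
have [w [h1 h2]] := nbit_build N.*2 (fun x => nbit (dl (p x)) (x - p x)).
have hp x i : 2 ^ i <= x < 2 ^ i.+1 -> p x = 2 ^ i.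
  by move=> h; rewrite /p (trunc_log_eq _ h).
exists w; split=> // [i hi|e i he hN]; last first.
  rewrite h2 (hp _ _ he); have := expn_gt0 2 i; case/andP: he => *.
  by have -> : e < N.*2 by lia.
apply: nbit_ext => y; rewrite nbit_mod nbit_div h2.
have [hy|hy] := ltnP y (2 ^ i); last first.
  by rewrite /= nbit_small //; apply: leq_trans (hdl _) _; rewrite leq_exp2l.
rewrite (hp _ i) ?addKn; last by rewrite leq_addr expnS; lia.
by have -> : 2 ^ i + y < N.*2 by lia.
Qed.

(** [d] depends only on the bounds, so all tables can share it. A common divisor of two moduli is
    prime to [d] and divides [(y - x) * d], hence it divides [y - x], which divides the factorial
    [d]. *)
Lemma beta_exists N B : exists d, forall g : nat -> nat, (forall i, i < N -> g i <= B) ->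
  exists c, forall i, i < N -> c %% (1 + (i + 1) * d) = g i.
Proof.
pose d := (N + B)`!; exists d => g hg.
have co x y : x < N -> y < N -> x != y -> coprime (1 + (x + 1) * d) (1 + (y + 1) * d).
  wlog lt_xy : x y / x < y => [h hx hy hxy|hx hy _].
    have := hxy; rewrite neq_ltn => /orP[] h'; first exact: h.
    by rewrite coprime_sym; apply: h => //; rewrite eq_sym.
  set q := gcdn (1 + (x + 1) * d) (1 + (y + 1) * d).
  have cq : coprime q d.
    apply: (@coprime_dvdl _ (1 + (x + 1) * d)); first exact: dvdn_gcdl.
    by rewrite /coprime addnC gcdnC gcdnMDl gcdn1.
  have dq : q %| (y - x) * d.
    have -> : (y - x) * d = (1 + (y + 1) * d) - (1 + (x + 1) * d).
      by rewrite subnDl -mulnBl; congr (_ * _); lia.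
    by apply: dvdn_sub; [exact: dvdn_gcdr|exact: dvdn_gcdl].
  have : q %| d.
    rewrite Gauss_dvdl // in dq; apply: dvdn_trans dq _; apply: dvdn_fact.
    by lia.
  by move=> /gcdn_idPl e; move: cq; rewrite /coprime e.
have [c hc] := chinese_exists co g; exists c => i hi; rewrite hc // modn_small //.
apply: leq_ltn_trans (hg i hi) _.
have h : N + B <= d by apply: fact_geq.
by rewrite mulnDl; lia.
Qed.

Lemma ltn_2exp m : m < 2 ^ m. Proof. exact: ltn_expl. Qed.

(** The sets are built along the order of the nodes. The additional element [D] exceeds all earlier
    codes: it makes the new code larger than them and, being no code itself, creates no edge. *)
Lemma nodes_exist n (ed : nat -> nat -> bool) : (forall a b, ed a b -> a < b) ->
  exists F : nat -> nat, [/\ forall a, a < n -> 1 < F a,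
    forall a b, a < b -> b < n -> F a < F b &
    forall a b, a < n -> b < n -> nbit (F b) (F a) = ed a b].
Proof.
move=> hed; elim: n => [|n [F [h1 h2 h3]]]; first by exists id.
pose D := (\sum_(a < n) F a).+1.
have hD a : a < n -> F a < D.
  by move=> ha; rewrite ltnS (bigD1 (Ordinal ha)) //= leq_addr.
pose S x := (x == D) || [exists a : 'I_n, ed a n && (F a == x)].
have [m [hm1 hm2]] := nbit_build D.+1 S.
have hmD : 2 ^ D <= m.
  rewrite leqNgt; apply/negP => /nbit_small.
  by rewrite hm2 ltnSn /S eqxx.
have hDm : D < m by apply: leq_trans hmD; apply: ltn_2exp.
have hmono a b : a < b -> b < n -> F a < F b by apply: h2.
exists (fun a => if a == n then m else F a); split.
- move=> a; rewrite ltnS leq_eqVlt; case: eqP => [_ _|_ /= ha]; last exact: h1.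
  exact: leq_ltn_trans hDm.
- move=> a b hab; rewrite ltnS leq_eqVlt => hb.
  have -> : (a == n) = false by apply/eqP; lia.
  move: hb; case: eqP => [e _|_ /= hb]; last exact: h2.
  by apply: ltn_trans hDm; apply: hD; rewrite -e.
move=> a b; rewrite !ltnS => ha hb.
have [eb|nb] := eqVneq b n; last first.
  have {}hb : b < n by rewrite ltn_neqAle nb.
  have [ea|na] := eqVneq a n; last by apply: h3; rewrite // ltn_neqAle na.
  rewrite (nbit_small (ltn_trans (ltn_trans (hD b hb) hDm) (ltn_2exp m))).
  by apply/esym/negP => /hed; rewrite ea; lia.
have [ea|na] := eqVneq a n.
  rewrite (nbit_small (ltn_2exp m)).
  by apply/esym/negP => /hed; rewrite ea eb ltnn.
have {}ha : a < n by rewrite ltn_neqAle na.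
rewrite eb hm2 ltnS (ltnW (hD a ha)) /S /= (ltn_eqF (hD a ha)) /=.
apply/existsP/idP => [[a' /andP[h /eqP e]]|h]; last by exists (Ordinal ha); rewrite h /=.
have [l|l|<- //] := ltngtP a' a.
  by have := hmono _ _ l ha; rewrite e ltnn.
by have := hmono _ _ l (ltn_ord a'); rewrite e ltnn.
Qed.

Lemma edivN (x y : nat) : ediv (A := Nst) x y = x %/ y.
Proof.
apply: (edivE Nst_PA Nst_euclidean); have [->|hy] := posnP y.
  by left; rewrite divn0.
right; have := divn_eq x y; have := ltn_pmod x hy; set q := x %/ y; set r := x %% y.
move=> h ->; split; last by rewrite /= ltn_add2l.
by have [->|hr] := posnP r; [right; rewrite addn0|left; rewrite /= -[X in X < _]addn0 ltn_add2l].
Qed.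

Lemma emodN (x y : nat) : emod (A := Nst) x y = x %% y.
Proof.
have h : x = ediv (A := Nst) x y * y + emod (A := Nst) x y := ediv_eq Nst_PA Nst_euclidean x y.
by move: h; rewrite edivN {1}(divn_eq x y) => /addnI.
Qed.

Lemma arrN (d c j : nat) : arr (A := Nst) d c j = c %% (1 + (j + 1) * d).
Proof. exact: emodN. Qed.

Lemma pbitN (m x : nat) : pbit (A := Nst) m (2 ^ x) <-> nbit m x.
Proof.
rewrite /pbit emodN edivN /nbit /= modn2.
by case: (odd _).
Qed.

Lemma blkN (w y : nat) : blk (A := Nst) w y = w %/ y %% y.
Proof. by rewrite /blk emodN edivN. Qed.

Section PackageExists.
Variable i : nat.
Let L := i + 1.
Let n := L * L.
Let rad (c c' : nat) := ((c < c') && nbit c' c) || ((c' < c) && nbit c c').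
Let ed (a b : nat) := (a %/ L < b %/ L) && rad (a %% L) (b %% L).

(** The lowest bit of the block at [b] is bit [b] of [w], and between [2^i] and [2^(i+1) - 1] only
    the first bit of [w] is set. *)
Lemma flag_pow2 w N b : 0 < b -> b <= N ->
  (forall i, 2 ^ i <= N -> (w %/ 2 ^ (2 ^ i)) %% 2 ^ (2 ^ i) = 1) ->
  (forall e i, 2 ^ i <= e < 2 ^ i.+1 -> e <= N -> nbit w e = nbit 1 (e - 2 ^ i)) ->
  w %/ 2 ^ b %% 2 ^ b = 1 <-> exists j, b = 2 ^ j.
Proof.
move=> hb hbN h1 h2; split=> [h|[j ej]]; last by rewrite ej h1 // -ej.
exists (trunc_log 2 b).
have /andP[hl hu] := trunc_log_bounds (isT : 1 < 2) hb.
have := h2 b (trunc_log 2 b); rewrite hl hu => /(_ isT hbN).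
have := nbit_mod (w %/ 2 ^ b) b 0; rewrite h hb /= nbit_div addn0 => <-.
case e : (b - _) => [|y]; first by move=> _; lia.
by rewrite nbitS /= /nbit div0n.
Qed.

Theorem package_exists : exists (k : nat) (W : nat -> nat), 0 < k /\ forall x, x < k ->
  dsat (A := Nst) (scons x (scons k (scons i W))) pkg_form.
Proof.
have hed a b : ed a b -> a < b.
  by move=> /andP[h _]; rewrite ltnNge; apply/negP => h'; have := leq_div2r L h'; rewrite leqNgt h.
have [F [hF1 hF2 hF3]] := nodes_exist n hed.
(* [K] exceeds all node codes and is at least [n], so one index range serves for nodes and exponents
   alike. *)
pose K := n + 2 + \sum_(a < n) F a.
have hFK a : a < n -> F a < K.
  move=> ha; apply: leq_trans (_ : (\sum_(a < n) F a).+1 <= _); last by rewrite /K; lia.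
  by rewrite ltnS (bigD1 (Ordinal ha)) //= leq_addr.
have nK : n <= K by rewrite /K -addnA leq_addr.
have K1 : 1 < K by rewrite /K; lia.
(* The block at exponent 0 has no bits, which forces the value 0 there in all four cases. *)
have hU q := @block_exists (F q) (fun e => (0 < e) : nat).
have hT q := @block_exists (F q) (fun e => e).
have hV q := @block_exists (F q) (fun e => if e == 0 then 0 else F q %% e).
have hW q := @block_exists (F q) (fun e => if e == 0 then 0 else 2 ^ (F q %% e)).
have dU e : (0 < e) < 2 ^ e by case: e => // e; rewrite (leq_trans (ltn_2exp 1)) // leq_exp2l.
have dT e : e < 2 ^ e by apply: ltn_2exp.
have dV q e : (if e == 0 then 0 else F q %% e) < 2 ^ e.
  case: eqP => [->//|/eqP he]; apply: leq_trans (ltnW (dT e)).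
  by rewrite ltn_pmod // lt0n.
have dW q e : (if e == 0 then 0 else 2 ^ (F q %% e)) < 2 ^ e.
  by case: eqP => [->//|/eqP he]; rewrite ltn_exp2l // ltn_pmod // lt0n.
pose U q := proj1_sig (cid (hU q dU)). pose T q := proj1_sig (cid (hT q dT)).
pose V q := proj1_sig (cid (hV q (dV q))). pose Wd q := proj1_sig (cid (hW q (dW q))).
pose B := \sum_(j < K) (2 ^ j + logn 2 j + F j + U j + T j + V j + Wd j).
have [d hd] := beta_exists K B.
have hB j : j < K -> 2 ^ j + logn 2 j + F j + U j + T j + V j + Wd j <= B.
  by move=> hj; rewrite /B (bigD1 (Ordinal hj)) //= leq_addr.
have hd' g : (forall j, g j <= 2 ^ j + logn 2 j + F j + U j + T j + V j + Wd j) ->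
    exists c, forall j, j < K -> arr (A := Nst) d c j = g j.
  move=> hg; have [|c hc] := hd g; first by move=> j /hB h; apply: leq_trans (hg j) h.
  by exists c => j hj; rewrite arrN hc.
have [|cE hE] := hd' (fun j => 2 ^ j); first by move=> j; lia.
have [|cN hN] := hd' (fun j => logn 2 j); first by move=> j; lia.
have [|cF hF] := hd' F; first by move=> j; lia.
have [|cU hcU] := hd' U; first by move=> j; lia.
have [|cT hcT] := hd' T; first by move=> j; lia.
have [|cV hcV] := hd' V; first by move=> j; lia.
have [|cW hcW] := hd' Wd; first by move=> j; lia.
exists (K * K), (scons K (scons d (scons cE (scons cN (scons cF (scons cU (scons cT
  (scons cV (scons cW (fun=> 0)))))))))); split; first by rewrite muln_gt0; lia.
move=> x hx; rewrite pkg_formE /pkg edivN emodN /=.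
have ha : x %% K < K by rewrite ltn_pmod //; lia.
have hb : x %/ K < K by rewrite ltn_divLR //; lia.
move: (x %% K) (x %/ K) ha hb => {x hx} a b ha hb.
have E j : j < K -> arr (A := Nst) d cE j = 2 ^ j by apply: hE.
clear hd hd' hB B; split; [|split].
- split; [|split; [|split]].
  + split=> //; rewrite !E //=; last by lia.
    by split=> //; split=> //; apply/negP; rewrite -leqNgt.
  + by move=> h; rewrite !E //=; apply: expnD.
  + by rewrite E //; apply: ltn_2exp.
  + move=> h; rewrite hN //.
    have hl : logn 2 a < K by apply: ltn_trans ha; apply: ltn_logl.
    rewrite E // emodN; split; first by apply/eqP; apply: pfactor_dvdnn.
    split=> //; apply/pbitN; rewrite /nbit.
    have [m' cm em] := pfactor_coprime (isT : prime 2) h.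
    by rewrite {1}em mulnK ?expn_gt0 // -coprime2n.
- move=> h1 h2; rewrite /= in h1 h2.
  have edE : edge (A := Nst) i d cE a b <-> ed a b.
    have hc c : c %% L < K.
      apply: leq_trans nK; rewrite /n; apply: leq_trans (_ : L <= _); first by rewrite ltn_pmod /L; lia.
      by rewrite leq_pmulr // /L; lia.
    rewrite /edge /rado /side /= !edivN !emodN -/L !E ?hc // !pbitN /ed /rad; split.
      by move=> [-> [[-> ->]|[-> ->]]]; rewrite //= orbT.
    by move=> /andP[-> /orP[/andP[-> ->]|/andP[-> ->]]]; split=> //; [left|right].
  have hFa := hFK a h1; rewrite !hF // E // pbitN hF3 //.
  split; first exact: hF1.
  split=> //; split; last by split; apply edE.
  move=> e; have [l|l|//] := ltngtP a b.
    by have := hF2 _ _ l h2; rewrite e ltnn.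
  by have := hF2 _ _ l h1; rewrite e ltnn.
move=> h1 h2 /negP; rewrite /= in h1 h2 *; rewrite hF // -leqNgt => h3.
have hFa := hFK a h1.
have [u1 u2 u3] : [/\ U a < 2 ^ (F a).*2,
    forall i, 2 ^ i <= F a -> (U a %/ 2 ^ (2 ^ i)) %% 2 ^ (2 ^ i) = 1 &
    forall e i, 2 ^ i <= e < 2 ^ i.+1 -> e <= F a -> nbit (U a) e = nbit 1 (e - 2 ^ i)].
  rewrite /U; case: cid => w /= [h4 h5 h6]; split=> //.
    by move=> j /h5 ->; rewrite expn_gt0.
  by move=> e j h7 /(h6 _ _ h7) ->; rewrite expn_gt0.
have fl c : 0 < c -> c <= F a -> flag (A := Nst) d cE (U a) c <-> exists j, c = 2 ^ j.
  move=> h4 h5; rewrite /flag E ?(leq_ltn_trans h5) // blkN.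
  exact: (flag_pow2 h4 h5).
rewrite hcU // hcT // hcV // hcW // !E //; last first.
  by rewrite emodN; apply: leq_ltn_trans hFa; apply: leq_mod.
have e2 : 2 ^ F a * 2 ^ F a = 2 ^ (F a).*2 by rewrite -addnn expnD.
split; [|split].
- have hh : emod (A := Nst) b 2 = 0 -> 0 < b %/ 2 <= F a.
    rewrite emodN => h4; have := divn_eq b 2; rewrite h4 addn0 => h5.
    by have := leq_div b 2; case: (b %/ 2) h5 => [|c]; lia.
  rewrite fl // edivN; split=> [[[|j] e]|[->|[h4 h5]]].
  + by left.
  + right; rewrite emodN e expnS mulKn // modnMr; split=> //.
    by apply/fl; [rewrite expn_gt0|rewrite e expnS in h3; lia|exists j].
  + by exists 0.
  have /andP[h6 h7] := hh h4; have /fl[//|//|j ej] := h5.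
  have h8 : b %% 2 = 0 by rewrite -emodN.
  by exists j.+1; rewrite expnS -ej mulnC [LHS](divn_eq b 2) h8 addn0.
- move=> /fl[//|//|j ej].
  rewrite !blkN emodN.
  rewrite ej; rewrite ej in h3; split; [|split].
  + by rewrite /T; case: cid => w /= [_ h4 _]; apply: h4.
  + rewrite /V; case: cid => w /= [_ h4 _]; rewrite h4 //.
    by rewrite gtn_eqF // expn_gt0.
  + rewrite /Wd; case: cid => w /= [_ h4 _]; rewrite h4 //.
    by rewrite gtn_eqF // expn_gt0.
- rewrite /= e2; split=> //; split; first by rewrite /T; case: cid => w /= [].
  split; first by rewrite /V; case: cid => w /= [].
  by rewrite /Wd; case: cid => w /= [].
Qed.

End PackageExists.

(** * Ackermann membership in the nonstandard model *)

(** The least number principle applied to [B - y]. *)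
Lemma E1_greatest (M : arith_structure) (hI : IE1 M) (P : (nat -> M) -> Prop) e x B :
  E1def P -> P (scons x e) -> le x B ->
  exists y, [/\ P (scons y e), le y B & forall z, le z B -> P (scons z e) -> le z y].
Proof.
move=> hP hx hxB; have hM := proj1 hI.
pose Q := fun e : nat -> M => exists y, le y (e 1) /\
  (add y (e 0) = e 1 /\ P (scons y (fun i => e i.+2))).
have hQ : E1def Q.
  have h1 := E1def_eq M (Add (Var 0) (Var 1)) (Var 2).
  have h2 := E1def_ren (fun i => if i is j.+1 then j.+3 else 0) hP.
  apply: (E1def_ext (E1def_ex (Var 1) (E1def_and hM h1 h2))) => e' /=.
  have E (y : M) : (fun i : nat => scons y e' match i with 0 => 0 | j.+1 => j.+3 end) =
    scons y (fun i => e' i.+2) by apply/funext => -[].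
  by split=> -[y [h3 [h4 h5]]]; exists y; split=> //; split=> //; move: h5; rewrite /Q E.
have [z ez] := pa_subW hM hxB.
have [|z0 [[y [h1 [h2 h3]]] h4]] := @E1_least _ hI Q (scons B e) z hQ.
  by exists x.
rewrite /= in h1 h2 h3; exists y; split=> // u hu hPu.
apply/(pa_not_lt hM) => hlt; have [w ew] := pa_subW hM hu.
apply: (h4 w); first by clear - hM h2 ew hlt; pa_lra hM.
by exists u.
Qed.

Section Arithmetic.
Variable M : arith_structure.
Hypothesis hM : PA_minus M.
Hypothesis hE : euclidean M.
Local Notation "x + y" := (add x y).
Local Notation "x * y" := (mul x y).
Local Notation "1" := one.
Local Notation two := (1 + 1).

Lemma pa_lt_le (x y : M) : lt x y -> le x y. Proof. by left. Qed.

Lemma pa_le_lt_trans (x y z : M) : le x y -> lt y z -> lt x z.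
Proof. by move=> h1 h2; pa_lra hM. Qed.

Lemma pa_lt_le_trans (x y z : M) : lt x y -> le y z -> lt x z.
Proof. by move=> h1 h2; pa_lra hM. Qed.

Lemma pa_le_trans (x y z : M) : le x y -> le y z -> le x z.
Proof. by move=> h1 h2; pa_lra hM. Qed.

Lemma pa_le_anti (x y : M) : le x y -> le y x -> x = y.
Proof. by move=> h1 h2; pa_lra hM. Qed.

Lemma pa_le0x (x : M) : le zero x.
Proof. by have h := emb_ge0 hM x; pa_lra hM. Qed.

Lemma lt_two : lt 1 (two : M). Proof. by pa_lra hM. Qed.

Lemma oddP (q : M) : emod q two = 1 <-> exists h, q = (h + h) + 1.
Proof.
split=> [h|[h e]].
  by exists (ediv q two); have e := ediv_eq hM hE q two; rewrite h in e; rewrite {1}e; pa_ring hM.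
have e' : q = h * two + 1 by rewrite e; pa_ring hM.
by have [] := ediv_emodE hM hE lt_two e'.
Qed.

Lemma evenP (q : M) : emod q two = zero <-> exists h, q = h + h.
Proof.
split=> [h|[h e]].
  by exists (ediv q two); have e := ediv_eq hM hE q two; rewrite h in e; rewrite {1}e; pa_ring hM.
have h0 : lt zero (two : M) by pa_lra hM.
have e' : q = h * two + zero by rewrite e; pa_ring hM.
by have [] := ediv_emodE hM hE h0 e'.
Qed.

Lemma ediv_double (h : M) : ediv (h + h) two = h.
Proof.
have h0 : lt zero (two : M) by pa_lra hM.
have e' : h + h = h * two + zero by pa_ring hM.
by have [] := ediv_emodE hM hE h0 e'.
Qed.

Lemma odd_not_even (h g : M) : h + h <> (g + g) + 1.
Proof.
move=> e; have h1 : emod (h + h) two = zero by apply/evenP; exists h.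
have : emod (h + h) two = 1 by apply/oddP; exists g.
by rewrite h1; apply: zero_neq_one.
Qed.

Lemma even_or_odd (q : M) : (exists h, q = h + h) \/ (exists h, q = (h + h) + 1).
Proof.
have h0 : two <> zero :> M by move=> e; have h := lt_two; pa_lra hM.
have h := emod_lt hM hE q h0; have [e|h1] := pa_le1 hM (emod q two).
  by left; apply/evenP.
by right; apply/oddP; pa_lra hM.
Qed.

(** The cases are the parities of [f / e]; they match the two alternatives of [fCodes] for the next
    block. *)
Lemma emod_double (f e : M) : lt zero e ->
  emod f (e + e) = emod f e \/ emod f (e + e) = emod f e + e.
Proof.
move=> he; have e0 : e <> zero by move=> e0; rewrite e0 in he; pa_lra hM.
have hr := emod_lt hM hE f e0; have ef := ediv_eq hM hE f e.
have [[h eh]|[h eh]] := even_or_odd (ediv f e).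
  have e1 : f = h * (e + e) + emod f e by rewrite {1}ef eh; pa_ring hM.
  have h1 : lt (emod f e) (e + e) by pa_lra hM.
  by left; have [_ ->] := ediv_emodE hM hE h1 e1.
have e1 : f = h * (e + e) + (emod f e + e) by rewrite {1}ef eh; pa_ring hM.
have h1 : lt (emod f e + e) (e + e) by pa_lra hM.
by right; have [_ ->] := ediv_emodE hM hE h1 e1.
Qed.

Lemma emod_small (f e : M) : le e f -> lt f (e + e) -> f = emod f e + e.
Proof.
move=> h1 h2; have [r er] := pa_subW hM h1.
have hr : lt r e by pa_lra hM.
have e1 : f = 1 * e + r by pa_lra hM.
by have [_ ->] := ediv_emodE hM hE hr e1; pa_lra hM.
Qed.

(** * Meaning of the formulas for blocks, codes, powers and membership *)

Definition block (w x a : M) := lt a x /\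
  exists h, le h w /\ exists l, le l x /\ (lt l x /\ w = ((h * x) + a) * x + l).

Lemma blockE w x a : block w x a <-> lt a x /\ blk w x = a.
Proof.
split=> [[h [q [_ [l [_ [h1 h2]]]]]]|[h1 h2]]; split=> //.
  have [e1 _] := ediv_emodE hM hE h1 h2.
  by rewrite /blk e1; have [_ ->] := ediv_emodE hM hE h (erefl (q * x + a)).
have x0 : x <> zero by move=> e; rewrite e in h1; clear - hM h1; pa_nra hM.
exists (ediv (ediv w x) x); split.
  exact: pa_le_trans (ediv_le hM hE _ _) (ediv_le hM hE _ _).
have hl := emod_lt hM hE w x0; exists (emod w x); split; first by left.
split=> //; rewrite {1}(ediv_eq hM hE w x) {1}(ediv_eq hM hE (ediv w x) x).
by rewrite -/(blk w x) h2.
Qed.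

Lemma asat_block (e : nat -> M) w x a :
  asat M e (fBlock w x a) <-> block (eval M e w) (eval M e x) (eval M e a).
Proof.
rewrite /asat /fBlock /block /=.
split=> -[h1 [h [h2 [l [h3 [h4 h5]]]]]]; split=> //; exists h.
  rewrite !eval_lift in h2 h3 h4 h5; split; first exact: h2.
  by exists l; split; [exact: h3|split; [exact: h4|exact: h5]].
rewrite !eval_lift; split; first exact: h2.
by exists l; rewrite !eval_lift; split; [exact: h3|split; [exact: h4|exact: h5]].
Qed.

Definition pow2 (x : M) := lt zero x /\ forall y, le y x -> forall z, le z x ->
  y * z = x -> y = 1 \/ exists h, le h y /\ y = h + h.

Lemma asat_pow (e : nat -> M) x : asat M e (fPow x) <-> pow2 (eval M e x).
Proof.
rewrite /asat /fPow /pow2 /=.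
split=> -[h1 h2]; split=> // y hy z hz hyz.
  have := h2 y; rewrite eval_lift => /(_ hy z); rewrite !eval_lift.
  by move=> /(_ hz hyz).
rewrite eval_lift in hy; rewrite !eval_lift in hz hyz.
exact: (h2 y hy z hz hyz).
Qed.

Definition flagged (u x : M) := pow2 x /\ block u x 1.

Definition codes (u t v w n p : M) :=
  (((block u two 1 /\ block t two 1) /\ (block v two zero /\ block w two 1)) /\
   ((forall x, le x p -> pow2 x ->
      (block u x 1 -> x = two \/ exists y, le y x /\ (x = y * y /\ flagged u y)) /\
      (x = two \/ (exists y, le y x /\ (x = y * y /\ flagged u y)) -> block u x 1)) /\
    (forall x, le x p -> flagged u x ->
      exists a, le a x /\ exists b, le b x /\ exists c, le c x /\
      ((block t x a /\ (block v x b /\ block w x c)) /\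
       ((le (x * x) p -> block t (x * x) (a + a) /\
          ((block v (x * x) b /\ block w (x * x) c) \/
           (block v (x * x) (b + a) /\ block w (x * x) (c * x)))) /\
        (lt p (x * x) -> n = b + a /\ p = c * x)))))).

Lemma iff_and A B A' B' : (A <-> A') -> (B <-> B') -> A /\ B <-> A' /\ B'.
Proof. tauto. Qed.
Lemma iff_or A B A' B' : (A <-> A') -> (B <-> B') -> A \/ B <-> A' \/ B'.
Proof. tauto. Qed.
Lemma iff_imp A B A' B' : (A <-> A') -> (B <-> B') -> (A -> B) <-> (A' -> B').
Proof. tauto. Qed.
Lemma iff_all (T : Type) (P Q : T -> Prop) : (forall x, P x <-> Q x) ->
  (forall x, P x) <-> (forall x, Q x).
Proof. by move=> h; split=> h' x; apply/h. Qed.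
Lemma iff_ex (T : Type) (P Q : T -> Prop) : (forall x, P x <-> Q x) ->
  (exists x, P x) <-> (exists x, Q x).
Proof. by move=> h; split=> -[x hx]; exists x; apply/h. Qed.

Lemma asat_bAll (e : nat -> M) t f :
  asat M e (bAll t f) <-> forall x, le x (eval M e t) -> asat M (scons x e) f.
Proof. by apply: iff_all => x; apply: iff_imp => //=; rewrite /sat /= eval_lift. Qed.

Lemma asat_bEx (e : nat -> M) t f :
  asat M e (bEx t f) <-> exists x, le x (eval M e t) /\ asat M (scons x e) f.
Proof. by apply: iff_ex => x; apply: iff_and => //=; rewrite /sat /= eval_lift. Qed.

Lemma asat_and (e : nat -> M) f g : asat M e (And f g) <-> asat M e f /\ asat M e g.
Proof. by []. Qed.
Lemma asat_or (e : nat -> M) f g : asat M e (Or f g) <-> asat M e f \/ asat M e g.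
Proof. by []. Qed.
Lemma asat_imp (e : nat -> M) f g : asat M e (Imp f g) <-> (asat M e f -> asat M e g).
Proof. by []. Qed.

(** Walks down a formula and its meaning in parallel, evaluating the lifted bounding terms on the
    way. *)
Ltac asat_step := first
  [ rewrite asat_block /= ?eval_lift; exact: iff_refl
  | rewrite asat_pow /= ?eval_lift; exact: iff_refl
  | rewrite asat_bAll /= ?eval_lift; apply: iff_all => ?; apply: iff_imp; [exact: iff_refl|]
  | rewrite asat_bEx /= ?eval_lift; apply: iff_ex => ?; apply: iff_and; [exact: iff_refl|]
  | rewrite asat_and; apply: iff_and | rewrite asat_or; apply: iff_or
  | rewrite asat_imp; apply: iff_imp
  | rewrite /asat /= ?eval_lift; exact: iff_refl ].

Lemma asat_codes (e : nat -> M) u t v w n p : asat M e (fCodes u t v w n p) <->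
  codes (eval M e u) (eval M e t) (eval M e v) (eval M e w) (eval M e n) (eval M e p).
Proof.
rewrite /fCodes /fIff /fFlagged /codes /flagged.
by repeat asat_step.
Qed.

Definition exp2 (n p : M) := (n = zero /\ p = 1) \/
  exists u, le u (p * p) /\ exists t, le t (p * p) /\ exists v, le v (p * p) /\
  exists w, le w (p * p) /\ codes u t v w n p.

Lemma asat_exp2 (e : nat -> M) n p :
  asat M e (fExp2 n p) <-> exp2 (eval M e n) (eval M e p).
Proof.
rewrite /fExp2 asat_or /exp2; apply: iff_or; first by repeat asat_step.
do 4 (rewrite asat_bEx /= ?eval_lift; apply: iff_ex => ?; apply: iff_and; first exact: iff_refl).
by rewrite asat_codes /= !eval_lift.
Qed.

Lemma HF_memE (x m : M) : HF_mem M x m <-> exists p, le p m /\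
  (exp2 x p /\ exists h, le h m /\ exists l, le l p /\ (lt l p /\ m = ((h + h) + 1) * p + l)).
Proof.
rewrite /HF_mem /bit_formula asat_bEx; apply: iff_ex => p; apply: iff_and; first exact: iff_refl.
rewrite asat_and; apply: iff_and; first exact: asat_exp2.
by repeat asat_step.
Qed.

End Arithmetic.

(** * Powers of two and membership in a model that has a package *)

Section PackageModel.
Variable M : arith_structure.
Hypothesis hI : IE1 M.
Let hM : PA_minus M := proj1 hI.
Let hE : euclidean M := IE1_euclidean hI.
Variables (k i K d cE cN cF cU cT cV cW : M).
Hypothesis k0 : lt zero k.
Hypothesis hpkg : forall x, lt x k -> pkg x k i K d cE cN cF cU cT cV cW.
Local Notation "x + y" := (add x y).
Local Notation "x * y" := (mul x y).
Local Notation "1" := one.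
Local Notation two := (1 + 1).
Local Notation E := (arr d cE).
Local Notation F := (arr d cF).
Local Notation n := (size2 i).

Lemma kE : k = K * K.
Proof. by have [[[e _] _] _] := hpkg k0. Qed.

Lemma K_pos : lt zero K.
Proof.
apply/(pa_not_le hM) => h; have e := kE; have h0 := k0.
have {}h : K = zero by have := pa_le0x hM K; move=> h'; pa_lra hM.
by rewrite h in e; pa_lra hM.
Qed.

Lemma pkg_all a b : lt a K -> lt b K ->
  [/\ pkg_exp k i K d cE cN a b, pkg_node i K d cE cF a b &
      pkg_code i d cE cF cU cT cV cW a b].
Proof.
move=> ha hb; have hx : lt (b * K + a) k.
  by rewrite kE; pa_nra hM.
have [h1 h2] := ediv_emodE hM hE ha (erefl (b * K + a)).
by have := hpkg hx; rewrite /pkg h1 h2 => -[h3 [h4 h5]].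
Qed.

Lemma E_add a b : lt (a + b) K -> E (a + b) = E a * E b.
Proof.
move=> h; have ha := pa_le0x hM a; have hb := pa_le0x hM b.
have [|| [_ [h1 _]] _ _] := @pkg_all a b; last exact: h1.
  by pa_lra hM.
by pa_lra hM.
Qed.

Lemma E_0 : E zero = 1.
Proof. by have [[[_ [h _]] _] _ _] := pkg_all K_pos K_pos. Qed.

Lemma E_1 : E 1 = two.
Proof. by have [[[_ [_ [h _]]] _] _ _] := pkg_all K_pos K_pos. Qed.

Lemma n_le_K : le n K.
Proof. by have [[[_ [_ [_ h]]] _] _ _] := pkg_all K_pos K_pos; apply/(pa_not_lt hM). Qed.

Lemma E_gt a : lt a K -> lt a (E a).
Proof. by move=> h; have [[_ [_ [h1 _]]] _ _] := pkg_all h K_pos. Qed.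

Lemma E_mono a b : lt a b -> lt b K -> lt (E a) (E b).
Proof.
move=> hab hb; have [c ec] := pa_subW hM (pa_lt_le hab).
rewrite ec in hb *; rewrite E_add //.
have ha := E_gt (pa_lt_trans hM _ _ _ hab (eq_ind_r (fun z => lt z K) hb ec)).
have ha0 := pa_le0x hM a.
have hc := @E_gt c; have {}hc : lt c (E c) by apply: hc; pa_lra hM.
by rewrite ec in hab; pa_nra hM.
Qed.

Lemma E_le_inv a b : lt a K -> le (E a) (E b) -> le a b.
Proof.
by move=> ha h; apply/(pa_not_lt hM) => h'; have := E_mono h' ha; apply/(pa_not_lt hM).
Qed.

Lemma E_le a b : le a b -> lt b K -> le (E a) (E b).
Proof. by case=> [h|->] hb; [left; apply: E_mono|right]. Qed.

Lemma E_inj a b : lt a K -> lt b K -> E a = E b -> a = b.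
Proof. by move=> ha hb e; apply: (pa_le_anti hM); apply: E_le_inv => //; right. Qed.

Lemma E_double_lt a : lt a K -> lt (E a * E a) K -> lt (a + a) K.
Proof.
move=> ha h; have h1 := E_gt ha; have h2 := pa_le0x hM a.
by pa_nra hM.
Qed.

Lemma E_pos a : lt a K -> lt zero (E a).
Proof.
by move=> ha; have h1 := E_gt ha; have h2 := pa_le0x hM a; pa_lra hM.
Qed.

Lemma E_even a : lt zero a -> lt a K -> exists h, E a = h + h.
Proof.
move=> h0 ha; have [|b e] := @pa_subW _ hM one a.
  by pa_lra hM.
by exists (E b); rewrite e in ha *; rewrite E_add // E_1; pa_ring hM.
Qed.

(** Read off from the table [cN], so no induction in [M] is spent on factoring out powers of two. *)
Lemma valuation y : lt zero y -> lt y K ->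
  exists v q h, [/\ lt v K, y = q * E v & q = (h + h) + 1].
Proof.
move=> h0 hy; have [[_ [_ [_ /(_ h0)[h1 [h2 h3]]]]] _ _] := pkg_all hy K_pos.
set v := arr d cN y in h1 h2 h3; have [h eh] := proj1 (oddP hM hE _) h2.
exists v, (ediv y (E v)), h; split=> //.
by rewrite {1}(ediv_eq hM hE y (E v)) h1; pa_ring hM.
Qed.

(** Write the cofactor [z] as an odd [q'] times [E v]. If [e <= v], size forces [q = 1]; otherwise
    cancelling [E v] equates an even power of two with the odd number [q * q']. *)
Lemma E_odd_divisor e q h z : lt e K -> lt (E e) K -> q = (h + h) + 1 ->
  E e = q * z -> q = 1.
Proof.
move=> he heK eq ez; have hp := E_pos he.
have hz : lt zero z by apply: (pa_pos hM) => e0; rewrite e0 in ez; pa_nra hM.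
have hzK : lt z K by apply: pa_le_lt_trans heK => //; pa_nra hM.
have [v [q' [h' [hv ezv eq']]]] := valuation hz hzK.
have hvp := E_pos hv.
have [hle|/(pa_not_le hM) hlt] := classic (le e v).
  have := E_le hle hv; rewrite ez ezv eq eq' => h1.
  suff : h = zero by move=> ->; pa_lra hM.
  have h0 := pa_le0x hM h'; have h2 := pa_le0x hM h.
  have [//|h3] := pa_le1 hM h; exfalso.
  have h4 : le (((h + h) + 1) * E v) (((h + h) + 1) * (((h' + h') + 1) * E v)).
    by apply: pa_le_mul => //; [right|move: (E v) hvp => w hw; pa_nra hM].
  by move: (E v) hvp h1 h4 => w hw h1 h4; pa_nra hM.
have [c ec] := pa_subW hM (pa_lt_le hlt).
have hc0 : lt zero c by pa_lra hM.
have hcK : lt c K by have := pa_le0x hM v => hv0; pa_lra hM.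
have [g eg] := E_even hc0 hcK.
have e1 : E v * (g + g) = E v * ((((h * h' + h * h') + h) + h') + (((h * h' + h * h') + h) + h') + 1).
  by rewrite -eg -E_add -?ec // ez ezv eq eq'; pa_ring hM.
exfalso; apply: (@odd_not_even _ hM hE g (((h * h' + h * h') + h) + h')).
by move: (g + g) (_ + 1) e1 => u w e1; move: (E v) hvp e1 => r hr e1; pa_nra hM.
Qed.

Lemma pow2_E e : lt e K -> lt (E e) K -> pow2 (E e).
Proof.
move=> he heK; have hp := E_pos he; split=> // y hy z hz ez.
have hy0 : lt zero y by apply: (pa_pos hM) => e0; rewrite e0 in ez; pa_nra hM.
have hyK : lt y K by apply: pa_le_lt_trans hy heK.
have [v [q [h [hv eyv eq]]]] := valuation hy0 hyK.
have e1 : q = 1.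
  by apply: (E_odd_divisor (z := E v * z) he heK eq); rewrite -ez eyv; pa_ring hM.
have eyE : y = E v by rewrite eyv e1; pa_lra hM.
have [v0|v1] := pa_le1 hM v; first by left; rewrite eyE v0 E_0.
right; have [|g eg] := @E_even v _ hv; first by pa_lra hM.
by exists g; rewrite eyE eg; split=> //; have := pa_le0x hM g => h0; pa_lra hM.
Qed.

(** The odd part of [y] divides [y], so by [pow2] it is 1 or even; hence it is 1. *)
Lemma pow2_inv y : pow2 y -> lt y K -> exists2 e, lt e K & y = E e.
Proof.
move=> [h0 h1] hy; have [v [q [h [hv eyv eq]]]] := valuation h0 hy.
have hvp := E_pos hv; exists v => //.
suff e1 : q = 1 by rewrite eyv e1; pa_lra hM.
have hq : le q y by rewrite eyv; move: (E v) hvp => w hw; pa_nra hM.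
have hw : le (E v) y.
  by have := pa_le0x hM h => hh; rewrite eyv eq; move: (E v) hvp => w hw; pa_nra hM.
have [//|[g [_ eg]]] := h1 q hq (E v) hw (esym eyv).
by case: (@odd_not_even _ hM hE g h); rewrite -eg.
Qed.

Lemma one_lt_E e : lt zero e -> lt e K -> lt 1 (E e).
Proof. by move=> h0 h; have h1 := E_gt h; pa_lra hM. Qed.

Lemma block_E u e : lt zero e -> lt e K -> block u (E e) 1 <-> flag d cE u e.
Proof.
move=> h0 h; rewrite (blockE hM hE) /flag; split=> [[]//|h1]; split=> //.
exact: one_lt_E.
Qed.

Lemma flagged_E u e : lt zero e -> lt e K -> lt (E e) K ->
  flagged u (E e) <-> flag d cE u e.
Proof.
move=> h0 h h1; rewrite -block_E //; split=> [[]//|h2]; split=> //.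
exact: pow2_E.
Qed.

Lemma flagged_inv u x : flagged u x -> lt x K ->
  exists e, [/\ lt zero e, lt e K, x = E e & flag d cE u e].
Proof.
move=> [/pow2_inv h1 h2] /h1 [e he ex]; exists e.
have h0 : lt zero e.
  apply: (pa_pos hM) => e0; move: h2; rewrite ex e0 E_0 => -[h _].
  exact: (pa_lt_irr hM _ h).
by split=> //; move: h2; rewrite ex block_E.
Qed.

Lemma sqrt_E e y : lt e K -> lt (E e) K -> pow2 y -> E e = y * y ->
  exists e', [/\ lt e' K, y = E e' & e = e' + e'].
Proof.
move=> he heK hy ey; have y0 := proj1 hy.
have hyK : lt y K by apply: pa_le_lt_trans heK => //; rewrite ey; pa_nra hM.
have [e' he' ey'] := pow2_inv hy hyK; exists e'; split=> //.
have h2 : lt (e' + e') K by apply: E_double_lt => //; rewrite -ey' -ey.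
by apply: E_inj => //; rewrite E_add // -ey' -ey.
Qed.

Section Node.
Variable a : M.
Hypothesis ha : lt a n.
Local Notation f := (F a).
Local Notation u := (arr d cU a).
Local Notation t := (arr d cT a).
Local Notation v := (arr d cV a).
Local Notation w := (arr d cW a).

Lemma a_lt_K : lt a K.
Proof. exact: (pa_lt_le_trans hM ha n_le_K). Qed.

Lemma node_bounds : lt 1 f /\ lt f K.
Proof.
by have [_ /(_ ha ha)[h1 [h2 _]] _] := pkg_all a_lt_K a_lt_K.
Qed.

Lemma node_code b : lt zero b -> le b f -> pkg_code i d cE cF cU cT cV cW a b.
Proof.
move=> h0 h1; have [_ h2] := node_bounds.
by have [] := pkg_all a_lt_K (pa_le_lt_trans hM h1 h2).
Qed.

Lemma node_flag b : lt zero b -> le b f ->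
  flag d cE u b <-> b = 1 \/ exists2 e, b = e + e & flag d cE u e.
Proof.
move=> h0 h1; have [|[h2 h3] _] := node_code h0 h1 ha h0; first by apply/(pa_not_lt hM).
split=> [/h2|] [e|h]; [by left|right| |].
- have [/(evenP hM hE)[e eb] h4] := h.
  by exists e => //; move: h4; rewrite eb ediv_double.
- by apply: h3; left.
- apply: h3; right; have [e eb h4] := h; rewrite eb ediv_double //; split=> //.
  by apply/evenP => //; exists e.
Qed.

Lemma node_blocks b : lt zero b -> le b f -> flag d cE u b ->
  [/\ block t (E b) b, block v (E b) (emod f b) & block w (E b) (E (emod f b))].
Proof.
move=> h0 h1 hfl; have [_ h2] := node_bounds; have hb := pa_le_lt_trans hM h1 h2.
have b0 : b <> zero by move=> e; rewrite e in h0; apply: (pa_lt_irr hM _ h0).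
have hm := emod_lt hM hE f b0; have hE1 := E_gt hb.
have [|_ [/(_ hfl)[h3 [h4 h5]] _]] := node_code h0 h1 ha h0; first by apply/(pa_not_lt hM).
split; apply/(blockE hM hE); split=> //; first exact: pa_lt_trans hM _ _ _ hm hE1.
exact: E_mono.
Qed.

(** The tabulated codes are the witnesses: squaring [x = E e] in [fCodes] is doubling [e] in the
    package. *)
Lemma exp2_complete : lt (E f) K -> exp2 f (E f).
Proof.
move=> hEf; have [f1 fK] := node_bounds; right.
have h01 := Defs.pa_lt01 hM; have K1 := pa_lt_trans hM _ _ _ f1 fK.
have flag1 : flag d cE u 1 by apply/(node_flag h01 (pa_lt_le f1)); left.
have [|_ [_ [hu [ht [hv hw]]]]] := node_code h01 (pa_lt_le f1) ha h01.
  by apply/(pa_not_lt hM); left.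
exists u; split; first by left.
exists t; split; first by left.
exists v; split; first by left.
exists w; split; first by left.
have le_f e : lt e K -> le (E e) (E f) -> le e f by exact: E_le_inv.
split.
  have [h1 h2 h3] := node_blocks h01 (pa_lt_le f1) flag1.
  have e1 : f = f * 1 + zero by pa_lra hM.
  have [_ e0] := ediv_emodE hM hE h01 e1.
  move: h1 h2 h3; rewrite e0 E_0 E_1 => h1 h2 h3; split; split=> //.
  by rewrite -E_1; apply/block_E.
split=> x hx.
  move=> /[dup] hp /pow2_inv [|e he ex]; first exact: pa_le_lt_trans hx hEf.
  rewrite ex in hx hp *; have heK := pa_le_lt_trans hM hx hEf.
  have hef := le_f e he hx.
  (* For [e = 0] both sides fail: a block at 1 cannot hold 1, and 1 is neither 2 nor the square of a
     flagged [y], which exceeds 1. *)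
  have [e0|e1] := pa_le1 hM e.
    rewrite e0 E_0; split=> [[h _]|[h|[y [_ [ey [_ [hy _]]]]]]].
    - by case: (pa_lt_irr hM _ h).
    - by exfalso; pa_lra hM.
    - by exfalso; pa_nra hM.
  have e0 : lt zero e := pa_lt_le_trans hM h01 e1.
  rewrite block_E // node_flag //; split=> -[h|[y h]].
  - by left; rewrite h E_1.
  - move=> hy; right.
    have hyK : lt y K by have hy0 := pa_le0x hM y; pa_lra hM.
    have hy0 : lt zero y by apply: (pa_pos hM) => y0; rewrite y0 in h; pa_lra hM.
    have hyE := E_le (a := y) (b := e) _ he.
    have {}hyE : le (E y) (E e) by apply: hyE; pa_lra hM.
    exists (E y); split=> //; split; first by rewrite -E_add -?h.
    by apply/flagged_E => //; apply: pa_le_lt_trans heK.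
  - by left; apply: E_inj; rewrite // E_1.
  - right; have [hyE [ey hy]] := h; have [e' [he' ey' ee]] := sqrt_E he heK (proj1 hy) ey.
    have e'0 : lt zero e' by apply: (pa_pos hM) => y0; apply: (pa_lt_irr hM zero); move: e0; rewrite ee y0 (pa_add0 hM).
    by exists e' => //; apply/block_E => //; rewrite -ey'; apply: (proj2 hy).
move=> /flagged_inv [|e [e0 he ex hfl]]; first exact: pa_le_lt_trans hx hEf.
rewrite ex in hx *; have hef := le_f e he hx; have heE := E_gt he.
have ne0 : e <> zero by move=> h; rewrite h in e0; apply: (pa_lt_irr hM _ e0).
have hm := emod_lt hM hE f ne0; have [h1 h2 h3] := node_blocks e0 hef hfl.
exists e; split; first by left.
exists (emod f e); split; first by left; apply: pa_lt_trans hM _ _ _ hm heE.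
exists (E (emod f e)); split; first by left; apply: E_mono.
split=> //; split.
  move=> hxx; have hee : lt (e + e) K by apply: E_double_lt => //; apply: pa_le_lt_trans hEf.
  have hee0 : lt zero (e + e) by pa_lra hM.
  have hef2 : le (e + e) f by apply: le_f => //; rewrite E_add.
  have hfl2 : flag d cE u (e + e) by apply/node_flag => //; right; exists e.
  have [h4 h5 h6] := node_blocks hee0 hef2 hfl2; rewrite -E_add //.
  split=> //; have [em|em] := emod_double hM hE f e0; rewrite em in h5 h6; first by left.
  right; split=> //; rewrite -E_add //; by pa_lra hM.
move=> hxx; have hee : lt f (e + e).
  apply/(pa_not_le hM) => hle; have hee := pa_le_lt_trans hM hle fK.
  by have := E_le hle fK; rewrite E_add //; apply/(pa_not_le hM).
have ef := emod_small hM hE hef hee; split=> //.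
by rewrite {1}ef E_add // -ef.
Qed.

Section Sound.
Variables u' t' v' w' p : M.
Hypothesis hp : lt p K.
Hypothesis hcodes : codes u' t' v' w' f p.
Hypothesis p1 : lt 1 p.

(** [DX] and [DY] are syntactic copies of [X] and [Y] below. Without quantifiers over quotient and
    remainder, they and their negations are E1, as the least and greatest number principles
    require. *)
Let DE x := DMod (DVar 4) (DAdd DOne (DMul (DAdd x DOne) (DVar 3))).
Let Dblk w y := DMod (DDiv w y) y.
Let DX := DAnd (DAnd (DLt DZero (DVar 0)) (DLt (DVar 0) (DVar 1)))
  (DAnd (DNot (DLt (DVar 2) (DE (DVar 0)))) (DEq (Dblk (DVar 5) (DE (DVar 0))) DOne)).
Let DY := DAnd (DEq (Dblk (DVar 6) (DE (DVar 0))) (DVar 0))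
  (DAnd (DEq (Dblk (DVar 8) (DE (DVar 0))) (DE (Dblk (DVar 7) (DE (DVar 0)))))
        (DLt (Dblk (DVar 7) (DE (DVar 0))) (DVar 0))).
Let env : nat -> M :=
  scons K (scons p (scons d (scons cE (scons u' (scons t' (scons v' (scons w' (fun=> zero)))))))).
(** [X e]: [E e] is a flagged power of two up to [p]; [Y e]: the blocks at
    [E e] have their intended contents. *)
Let X e := (lt zero e /\ lt e K) /\ (~ lt p (E e) /\ flag d cE u' e).
Let Y e := blk t' (E e) = e /\ (blk w' (E e) = E (blk v' (E e)) /\ lt (blk v' (E e)) e).

Lemma codes_flag_double e : X e -> le (E e * E e) p -> X (e + e).
Proof.
move=> [[h0 h1] [/(pa_not_lt hM) h2 h3]] hxx.
have hxK := pa_le_lt_trans hM hxx hp; have hee := E_double_lt h1 hxK.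
have ee0 : lt zero (e + e) by pa_lra hM.
have heK := pa_le_lt_trans hM h2 hp.
have eE : E (e + e) = E e * E e by rewrite E_add.
split=> //; split; first by apply/(pa_not_lt hM); rewrite eE.
have [_ [hc _]] := hcodes; have [|_ h4] := hc (E e * E e) hxx.
  by rewrite -eE; apply: pow2_E; rewrite // eE.
apply/block_E => //; rewrite eE; apply: h4; right; exists (E e).
have hg := E_gt h1; split; first by pa_nra hM.
by split=> //; apply/flagged_E.
Qed.

(** [Y e] identifies the value [c] of [codes] with [E b] and keeps [b < e], so that the sum [b + e]
    stays below [K], where [E_add] turns [c * x] into [E (b + e)]. *)
Lemma codes_step e : X e -> Y e ->
  [/\ le (E e * E e) p -> Y (e + e) & lt p (E e * E e) -> p = E f].
Proof.
move=> [[h0 h1] [/(pa_not_lt hM) h2 h3]] [h4 [h5 h6]].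
have heK := pa_le_lt_trans hM h2 hp; have [_ [_ hc]] := hcodes.
have [|b' [_ [b [_ [c [_ [[h7 [h8 h9]] [h10 h11]]]]]]]] := hc (E e) h2.
  by apply/flagged_E.
have {}h7 := proj2 (proj1 (blockE hM hE _ _ _) h7).
have {}h8 := proj2 (proj1 (blockE hM hE _ _ _) h8).
have {}h9 := proj2 (proj1 (blockE hM hE _ _ _) h9).
rewrite h4 in h7; rewrite h8 in h5 h6; rewrite h9 in h5; subst b' c.
split=> [hxx|/h11[ef ->]]; last first.
  by rewrite ef h5 E_add // -ef; have [] := node_bounds.
have hxK := pa_le_lt_trans hM hxx hp; have hee := E_double_lt h1 hxK.
rewrite /Y E_add //; have [/(blockE hM hE)[_ h12] h13] := h10 hxx.
split=> //; case: h13 => -[/(blockE hM hE)[_ ->] /(blockE hM hE)[_ ->]].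
  by split=> //; pa_lra hM.
by split; [rewrite h5 E_add //; pa_lra hM|pa_lra hM].
Qed.

Lemma codes_base : X 1 /\ Y 1.
Proof.
have [[[h1 h2] [h3 h4]] _] := hcodes; rewrite -E_1 in h1 h2 h3 h4.
have h01 := Defs.pa_lt01 hM; have K1 := pa_lt_trans hM _ _ _ p1 hp.
split; first split=> //.
  by have p1' := p1; split; [apply/(pa_not_lt hM); rewrite E_1; pa_lra hM|apply/block_E].
have {}h2 := proj2 (proj1 (blockE hM hE _ _ _) h2).
have {}h3 := proj2 (proj1 (blockE hM hE _ _ _) h3).
have {}h4 := proj2 (proj1 (blockE hM hE _ _ _) h4).
by rewrite /Y h2 h3 h4 E_0.
Qed.

Lemma codes_half e : X e -> e = 1 \/ exists2 e', e = e' + e' & X e'.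
Proof.
move=> [[h0 h1] [/(pa_not_lt hM) h2 h3]]; have heK := pa_le_lt_trans hM h2 hp.
have [_ [hc _]] := hcodes; have [h4 _] := hc (E e) h2 (pow2_E h1 heK).
have [|h|[y [hy [ey hfl]]]] := h4; first exact/block_E.
  by left; apply: E_inj; rewrite ?E_1 //; pa_lra hM.
have [e' [he' ey' ee]] := sqrt_E h1 heK (proj1 hfl) ey.
have e'0 : lt zero e'.
  by apply: (pa_pos hM) => y0; apply: (pa_lt_irr hM zero); move: h0; rewrite ee y0 (pa_add0 hM).
right; exists e' => //; split=> //; rewrite -ey'; split.
  by apply/(pa_not_lt hM); exact: (pa_le_trans hM hy h2).
by apply/block_E => //; rewrite -ey'; exact: (proj2 hfl).
Qed.

(** A least counterexample is not 1, and its half would satisfy [Y] and pass it on. *)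
Lemma codes_all e : X e -> Y e.
Proof.
move=> hX; apply: contrapT => hY.
have h := E1def_dsat hM hE (DAnd DX (DNot DY)).
have [|e0 [[hX0 hY0] hmin]] := @E1_least _ hI _ env e h; first by split.
have [h1|[e' ee hX']] := codes_half hX0.
  by apply: hY0; rewrite (h1 : e0 = 1); apply: (proj2 codes_base).
have {}ee : e0 = e' + e' := ee.
have hlt : lt e' e0 by have := proj1 (proj1 hX') => h'; rewrite ee; pa_lra hM.
have hY' : Y e' by apply: contrapT => hn; apply: (hmin e') => //; split.
have [h1 _] := codes_step hX' hY'; apply: hY0; rewrite ee; apply: h1.
rewrite -E_add -ee; last exact: (proj2 (proj1 hX0)).
by apply/(pa_not_lt hM); exact: (proj1 (proj2 hX0)).
Qed.

(** At the greatest flagged exponent [e] doubling must overshoot [p], so the final clause of [codes]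
    applies and gives [p]. *)
Lemma codes_sound : p = E f.
Proof.
have K1 := pa_lt_trans hM _ _ _ p1 hp.
have [e [hX _ hmax]] := @E1_greatest _ hI _ env 1 K (E1def_dsat hM hE DX) (proj1 codes_base) (pa_lt_le K1).
have [_ h] := codes_step hX (codes_all hX); apply: h; apply/(pa_not_le hM) => h.
have h1 := codes_flag_double hX h; have [[h2 h3] _] := h1.
have := hmax (e + e) (pa_lt_le h3) h1; have := proj1 (proj1 hX) => h4 h5.
by exfalso; pa_lra hM.
Qed.

End Sound.

Lemma exp2_sound p : lt p K -> exp2 f p -> p = E f.
Proof.
move=> hp; have [f1 _] := node_bounds.
case=> [[f0 _]|[u' [hu [t' [_ [v' [_ [w' [_ hc]]]]]]]]].
  by exfalso; rewrite f0 in f1; pa_lra hM.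
apply: (@codes_sound u' t' v' w' p) => //.
(* The block of [u'] at 2 holds 1, so [u' >= 2]; with [u' <= p * p] this excludes [p <= 1]. *)
have [[[[_ [h [_ [l [_ [_ eu]]]]]] _] _] _] := hc.
have h0 := pa_le0x hM h; have l0 := pa_le0x hM l.
have h1 : le two (p * p) by rewrite eu in hu; pa_lra hM.
apply/(pa_not_le hM) => h2; have := pa_le_mul hM h2 h2; rewrite (pa_mul1 hM) => h3.
by pa_lra hM.
Qed.

End Node.

(** Below [K] the only [p] with [exp2 (F a) p] is [E (F a)]: uniqueness serves the forward direction
    and existence the converse, which reduces membership to one tabulated bit. *)
Lemma HF_mem_edge a b : lt a n -> lt b n -> HF_mem M (F a) (F b) <-> edge i d cE a b.
Proof.
move=> ha hb; have [_ /(_ ha hb)[_ [_ [_ [h1 h2]]]] _] := pkg_all (a_lt_K ha) (a_lt_K hb).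
have [f1 fK] := node_bounds ha; have [g1 gK] := node_bounds hb.
rewrite HF_memE; split.
  move=> [p [hp [hexp [h [_ [l [_ [hl em]]]]]]]]; apply: h1.
  rewrite -(exp2_sound ha _ hexp); last exact: pa_le_lt_trans hp gK.
  have [e1 _] := ediv_emodE hM hE hl em.
  by rewrite /pbit e1; apply/oddP => //; exists h.
move=> /h2; have hEp := E_pos fK => /[dup] hbit; rewrite /pbit.
move=> /(oddP hM hE)[h eh]; have em := ediv_eq hM hE (F b) (E (F a)).
have E0 : E (F a) <> zero by move=> e; rewrite e in hEp; apply: (pa_lt_irr hM _ hEp).
have hl := emod_lt hM hE (F b) E0; rewrite eh in em.
have [hle hle'] : le (E (F a)) (F b) /\ le h (F b).
  have h0 := pa_le0x hM h; have h0' := pa_le0x hM (emod (F b) (E (F a))).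
  move: (emod (F b) (E (F a))) (E (F a)) (F b) h0' hEp em => r y x h0' hy em.
  by split; pa_nra hM.
exists (E (F a)); split=> //; split.
  by apply: exp2_complete => //; apply: pa_le_lt_trans gK.
exists h; split=> //.
by exists (emod (F b) (E (F a))); split; [left|split].
Qed.

Lemma F_inj a b : lt a n -> lt b n -> F a = F b -> a = b.
Proof.
by move=> ha hb; have [_ /(_ ha hb)[_ [_ [h _]]] _] := pkg_all (a_lt_K ha) (a_lt_K hb).
Qed.

End PackageModel.

(** * Countable acyclic relations *)

(** Recursive choice under conditions that look only at terms already chosen. Later stages do not
    change earlier terms, so the diagonal sequence meets every condition. *)
Lemma extend_seq (T : Type) (t : T) (ok : nat -> (nat -> T) -> Prop) :
  ok 0 (fun=> t) ->
  (forall n l l', (forall j, j < n -> l j = l' j) -> ok n l -> ok n l') ->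
  (forall n l, ok n l -> exists x, ok n.+1 (fun j => if j == n then x else l j)) ->
  exists l, forall n, ok n l.
Proof.
move=> h0 hext hS.
pose step n (p : {l | ok n l}) : {l | ok n.+1 l} :=
  let c := cid (hS n _ (proj2_sig p)) in
  exist (ok n.+1) (fun j => if j == n then sval c else sval p j) (proj2_sig c).
pose st := nat_rect (fun n => {l | ok n l}) (exist (ok 0) _ h0) step.
have st_step n j : j != n -> sval (st n.+1) j = sval (st n) j.
  by rewrite /= => /negPf ->.
have st_eq n m j : j < n -> sval (st (m + n)) j = sval (st n) j.
  move=> hj; elim: m => [|m IH] //; rewrite addSn st_step //.
  by apply/eqP; lia.
exists (fun j => sval (st j.+1) j) => n; apply: hext (proj2_sig (st n)) => j hj.
by rewrite -(@st_eq j.+1 (n - j.+1)) // subnK.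
Qed.

(** Realises a countable graph in the Rado graph given by the binary digits. *)
Lemma colours_exist (S : nat -> nat -> bool) :
  exists c : nat -> nat, forall j k, j < k -> c j < c k /\ nbit (c k) (c j) = S j k.
Proof.
pose ok n (c : nat -> nat) :=
  forall j k, j < k < n -> c j < c k /\ nbit (c k) (c j) = S j k.
suff [c hc] : exists c, forall n, ok n c.
  by exists c => j k hjk; apply: (hc k.+1); rewrite hjk ltnSn.
apply: (@extend_seq _ 0) => [j k|n l l' e h j k /andP[hjk hk]|n c h]; first by rewrite andbF.
  by rewrite -!e //; [apply: h; rewrite hjk|apply: ltn_trans hk].
pose B := (\sum_(j < n) c j).+1.
have hB j : j < n -> c j < B by move=> hj; rewrite ltnS (bigD1 (Ordinal hj)) //= leq_addr.
(* The additional bit [B] makes the new colour larger than all earlier ones; no colour equals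
   [B]. *)
pose Q x := (x == B) || [exists j : 'I_n, S j n && (c j == x)].
have [m [_ hm]] := nbit_build B.+1 Q.
have hBm : B < m.
  apply: leq_trans (ltn_2exp B) _; rewrite leqNgt; apply/negP => /nbit_small.
  by rewrite hm ltnSn /Q eqxx.
exists m => j k /andP[hjk]; rewrite ltnS leq_eqVlt.
case: (k =P n) => [ek _|_ /= hk].
  rewrite ek in hjk; rewrite ltn_eqF //; split; first exact: ltn_trans (hB j hjk) hBm.
  rewrite hm ltnS (ltnW (hB j hjk)) /= /Q ltn_eqF ?hB //= ek.
  apply/existsP/idP => [[j' /andP[hS /eqP ec]]|hS]; last first.
    by exists (Ordinal hjk); rewrite hS eqxx.
  suff -> : j = j' by [].
  have hj' := ltn_ord j'; have [l|l|//] := ltngtP j j'.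
    by have [] := h j j'; [rewrite l|rewrite ec ltnn].
  by have [] := h j' j; [rewrite l|rewrite ec ltnn].
by rewrite ltn_eqF ?(ltn_trans hjk) //; apply: h; rewrite hjk.
Qed.

(** Stated for an arbitrary total preorder so as to give maxima and, with the order reversed,
    minima; [x0] is the value for an empty set. *)
Lemma finite_extremum (T : Type) (r : T -> T -> Prop) (P : nat -> Prop) (l : nat -> T) x0 m :
  (forall x, r x x) -> (forall x y z, r x y -> r y z -> r x z) -> (forall x y, r x y \/ r y x) ->
  exists x, [/\ x = x0 \/ exists j, [/\ j < m, P j & x = l j], r x0 x &
    forall j, j < m -> P j -> r (l j) x].
Proof.
move=> hr ht htot; elim: m => [|m [x [h1 h2 h3]]]; first by exists x0; split=> //; left.
have hx : x = x0 \/ exists j, [/\ j < m.+1, P j & x = l j].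
  by case: h1 => [|[j [hj hP ex]]]; [left|right; exists j; split=> //; apply: ltnW].
have [hm|hm] := classic (P m); last first.
  exists x; split=> // j; rewrite ltnS leq_eqVlt => /orP[/eqP ->//|hj]; exact: h3.
have [hle|hle] := htot (l m) x.
  by exists x; split=> // j; rewrite ltnS leq_eqVlt => /orP[/eqP ->//|hj]; apply: h3.
exists (l m); split; first by right; exists m.
  exact: ht hle.
move=> j; rewrite ltnS leq_eqVlt => /orP[/eqP ->//|hj hP].
by apply: ht hle; apply: h3.
Qed.

Section Levels.
Variable M : arith_structure.
Hypothesis hM : PA_minus M.
Hypothesis hE : euclidean M.
Local Notation num := (numeral M).
Local Notation two := (add one one).

Definition gap (a b : M) := forall s, le (add a (num s)) b.

Lemma gap_mid a b : gap a b -> exists m, gap a m /\ gap m b.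
Proof.
move=> h; have [|z ez] := @pa_subW _ hM a b; first by have := h 0; rewrite /= pa_add0.
have hz s : le (num s) z by have := h s; rewrite ez => h'; pa_lra hM.
exists (add a (ediv z two)); have e2 := ediv_eq hM hE z two.
have t0 : two <> zero :> M by move=> e; have h2 := lt_two hM; pa_lra hM.
have hr := emod_lt hM hE z t0; have q0 := pa_le0x hM (emod z two).
(* The added 1 absorbs the remainder modulo 2. *)
split=> s; have := hz (s + s).+1; rewrite /= (numD hM) => h'; rewrite ?ez; pa_lra hM.
Qed.

(** The interval below [i] is rich enough because comparable points are kept
    at nonstandard distances from each other and from both ends. *)
Lemma levels_exist (R : nat -> nat -> Prop) i : acyclic R -> ~ std i ->
  exists l : nat -> M, (forall j, lt (l j) i) /\ forall j k, R j k -> lt (l j) (l k).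
Proof.
move=> hR hi.
(* The transitive closure is needed because two points may be linked only through points placed
   later. *)
pose ok n (l : nat -> M) :=
  (forall j, j < n -> gap zero (l j) /\ gap (l j) i) /\
  forall j k, j < n -> k < n -> clos_trans _ R j k -> gap (l j) (l k).
have gap_lt a b : gap a b -> lt a b by move=> /(_ 1) h; rewrite /= in h; pa_lra hM.
suff [l hl] : exists l, forall n, ok n l.
  exists l; split=> [j|j k h]; first by apply: gap_lt; apply: (proj1 (hl j.+1) _ _).2.
  apply: gap_lt; apply: (proj2 (hl (maxn j k).+1)); last exact: t_step.
    by rewrite ltnS leq_maxl.
  by rewrite ltnS leq_maxr.
have gap0i : gap zero i.
  by move=> s; have := nstd_gt hM s hi => h; pa_lra hM.
have rt (x y z : M) : le x y -> le y z -> le x z by exact: pa_le_trans.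
have tot (x y : M) : le x y \/ le y x.
  by have [h|h] := classic (le x y); [left|right; move/(pa_not_le hM): h; left].
have gap_le a b a' b' : gap a b -> le a' a -> le b b' -> gap a' b'.
  by move=> h h1 h2 s; have h3 := h s; pa_lra hM.
apply: (@extend_seq _ zero) => [|n l l' e [h1 h2]|n l [h1 h2]]; first by split.
  by split=> [j hj|j k hj hk]; rewrite -!e //; [apply: h1|apply: h2].
(* [a] is the highest level that must lie below the new point and [b] the lowest that must lie above
   it, with 0 and [i] as defaults. *)
have [a [ha a0 ale]] := @finite_extremum _ (@le M) (fun j => clos_trans _ R j n) l zero n
  (fun x => or_intror erefl) rt tot.
have [b [hb bi ble]] := @finite_extremum _ (fun x y : M => le y x) (fun j => clos_trans _ R n j) l i n
  (fun x => or_intror erefl) (fun x y z h h' => rt _ _ _ h' h) (fun x y => tot y x).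
have hab : gap a b.
  case: ha hb => [->|[j [hj hjn ->]]] [->|[k [hk hnk ->]]] //.
  - exact: (h1 k hk).1.
  - exact: (h1 j hj).2.
  - by apply: h2 => //; apply: t_trans hnk.
have [x [hax hxb]] := gap_mid hab; have lt_n j : j < n.+1 -> j != n -> j < n by rewrite ltnS ltn_neqAle => -> ->.
exists x; split=> [j /lt_n|j k /lt_n + /lt_n].
  case: (eqVneq j n) => [_ _|_ /(_ isT) hj]; last exact: h1.
  by split; [apply: gap_le hax a0 _; right|apply: gap_le hxb _ bi; right].
case: (eqVneq j n) => [->|_ /(_ isT) hj]; case: (eqVneq k n) => [->|_].
- by move=> _ _ /hR.
- by move=> _ /(_ isT) hk h; apply: gap_le hxb _ (ble k hk h); right.
- by move=> _ h; apply: gap_le hax (ale j hj h) _; right.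
by move=> /(_ isT) hk; apply: h2.
Qed.

End Levels.

Section Universal.
Variable M : arith_structure.
Hypothesis hI : IE1 M.
Hypothesis hns : nonstandard M.
Let hM : PA_minus M := proj1 hI.
Let hE : euclidean M := IE1_euclidean hI.
Local Notation num := (numeral M).

Lemma pbit_num x c : pbit (num x) (num (2 ^ c)) <-> nbit x c.
Proof.
rewrite -pbitN /pbit -(num_ediv hI).
have -> : add one one = num 2 by rewrite /=; pa_lra hM.
have -> : (one : M) = num 1 by rewrite /=; pa_lra hM.
by rewrite -(num_emod hI); split=> [/(num_inj hM)|->].
Qed.

Lemma HF_universal_nat (R : nat -> nat -> Prop) : acyclic R ->
  exists g : nat -> M, injective g /\ forall m n, R m n <-> HF_mem M (g m) (g n).
Proof.
move=> hR; have [i [k [W [hi k0 hx]]]] := transfer hI hns package_exists.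
have hp x : lt x k -> pkg x k i (W 0) (W 1) (W 2) (W 3) (W 4) (W 5) (W 6) (W 7) (W 8).
  by move=> /hx /pkg_formE.
have [l [hl lR]] := levels_exist hM hE hR hi.
have [c hc] := colours_exist (fun j m => `[< R j m \/ R m j >]).
(* At standard exponents the table holds the true powers of two, so [rado] on standard colours is
   the Rado graph of the natural numbers. *)
have E_num s : arr (W 1) (W 2) (num s) = num (2 ^ s).
  have hK r : lt (num r) (W 0).
    have h1 := n_le_K hI k0 hp; have h2 := nstd_gt hM r hi; rewrite /size2 /side in h1.
    by have h3 := pa_le0x hM i; pa_nra hM.
  elim: s => [|s IH]; first by rewrite /= (E_0 hI k0 hp); pa_lra hM.
  rewrite /= (E_add hI k0 hp) ?IH ?(E_1 hI k0 hp) ?expnS ?numM //; last exact: (hK s.+1).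
  by rewrite /=; pa_ring hM.
(* Level and colour are the two digits of [q m] in base [i + 1]. *)
pose q m := add (mul (l m) (side i)) (num (c m)).
have cL m : lt (num (c m)) (side i).
  by have := nstd_gt hM (c m) hi; rewrite /side => h; pa_lra hM.
have hq m : lt (q m) (size2 i).
  have := hl m; have := cL m; rewrite /q /size2 /side => h1 h2.
  by move: (num (c m)) (l m) h1 h2 => x y h1 h2; pa_nra hM.
have qE m : ediv (q m) (side i) = l m /\ emod (q m) (side i) = num (c m).
  exact: (ediv_emodE hM hE (cL m) (erefl (q m))).
have c_inj : injective c.
  move=> m n e; have [h|h|//] := ltngtP m n.
    by have [] := hc _ _ h; rewrite e ltnn.
  by have [] := hc _ _ h; rewrite e ltnn.
have hlt m n : lt (num (c m)) (num (c n)) <-> m < n.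
  rewrite (num_lt hM); have [h|h|<-] := ltngtP m n; last by rewrite ltnn.
    by have [-> _] := hc _ _ h.
  by have [h' _] := hc _ _ h; rewrite ltnNge ltnW.
(* The colours give the symmetrised relation; the levels increase along [R], so comparing them
   selects the direction. *)
have hedge m n : edge i (W 1) (W 2) (q m) (q n) <-> R m n.
  rewrite /edge /rado; have [-> ->] := qE m; have [-> ->] := qE n.
  rewrite !hlt !E_num !pbit_num; split.
    move=> [h1]; have hn : ~ R n m.
      by move=> /lR h2; apply: (pa_lt_irr hM (l m)); apply: pa_lt_trans hM _ _ _ h1 h2.
    by case=> -[h2]; have [_ ->] := hc _ _ h2; move=> /asboolP[].
  move=> h; split; first exact: lR.
  have [h1|h1|e] := ltngtP m n; first by left; split=> //; have [_ ->] := hc _ _ h1; apply/asboolP; left.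
    by right; split=> //; have [_ ->] := hc _ _ h1; apply/asboolP; right.
  by rewrite e in h; case: (@hR n); apply: t_step.
exists (fun m => arr (W 1) (W 4) (q m)); split=> [m n e|m n].
  have eq := F_inj hI k0 hp (hq m) (hq n) e; apply: c_inj; apply: (num_inj hM).
  by rewrite -(proj2 (qE m)) -(proj2 (qE n)) eq.
by rewrite (HF_mem_edge hI k0 hp (hq m) (hq n)) hedge.
Qed.

Theorem HF_universal (G : Type) (R : relation G) :
  countable G -> acyclic R -> isomorphic_to_submodel R (HF_mem M).
Proof.
move=> [f hf] hR.
(* Numbers outside the range of [f] become isolated points, so acyclicity is preserved. *)
pose R' m n := exists x y, [/\ f x = m, f y = n & R x y].
have lift_path m n : clos_trans _ R' m n ->
    exists x y, [/\ f x = m, f y = n & clos_trans _ R x y].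
  elim=> {m n} [m n [x [y [ex ey h]]]|m n p _ [x [y [ex ey h]]] _ [y' [z [ey' ez h']]]].
    by exists x, y; split=> //; apply: t_step.
  exists x, z; split=> //; apply: t_trans h _.
  by have -> : y = y' by apply: hf; rewrite ey ey'.
have hR' : acyclic R'.
  move=> m /lift_path[x [y [ex ey h]]]; apply: (hR x).
  by have e : x = y by [apply: hf; rewrite ex ey]; rewrite -e in h.
have [g [g_inj hg]] := HF_universal_nat hR'.
exists (fun z => exists x, z = g (f x)), (fun x => exist _ (g (f x)) (ex_intro _ x erefl)).
split.
  pose inv (z : {z | exists x, z = g (f x)}) := sval (cid (proj2_sig z)).
  have hinv z : sval z = g (f (inv z)) by rewrite /inv; case: cid.
  exists inv; split=> [x|z].
    by apply: hf; apply: g_inj; rewrite -hinv.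
  by apply: eq_sig_hprop; [move=> *; exact: Prop_irrelevance|rewrite /= -hinv].
move=> x y; rewrite /induced /= -hg; split=> [h|[x' [y' [/hf -> /hf -> h]]]] //.
by exists x, y.
Qed.

End Universal.

(** * Acyclicity of models of Kripke-Platek set theory *)

Lemma KP_acyclic (N : Type) (E : relation N) : KP E -> acyclic E.
Proof.
move=> hKP x hx.
(* The cycle enters only as a finite nonempty list in which every point has a predecessor. *)
have [s [s0 hs]] : exists s : seq N, s <> [::] /\
    forall y, List.In y s -> exists2 z, List.In z s & E z y.
  suff path y z : clos_trans _ E y z -> exists s, List.In z s /\
      forall y', List.In y' s -> E y y' \/ exists2 z', List.In z' s & E z' y'.
    have [s [hxs hs]] := path x x hx; exists s; split; first by case: s hxs {hs}.
    by move=> y /hs[h|//]; exists x.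
  move=> h; elim: {y z} h => [y z h|y z w _ [s [hz hs]] _ [s' [hw hs']]].
    by exists [:: z]; split; [left|move=> y' [<-|[]]; left].
  exists (List.app s s'); split; first by apply/List.in_or_app; right.
  move=> y' /(@List.in_app_or N)[/hs|/hs'] [h|[z' hz' h]].
  - by left.
  - by right; exists z' => //; apply/List.in_or_app; left.
  - by right; exists z => //; apply/List.in_or_app; left.
  - by right; exists z' => //; apply/List.in_or_app; right.
(* The list is defined by the disjunction of the equations with its points, which are passed as
   parameters; the negated reflexive equation is falsity, for the empty disjunction. *)
pose f := foldr (fun j g => Or (Atom (SEq 0 j.+1)) g) (Not (Atom (SEq 0 0))) (iota 0 (size s)).
pose e j := nth x s j.
have fE y : ssat E (scons y e) f <-> List.In y s.
  have h r : ssat E (scons y e)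
      (foldr (fun j g => Or (Atom (SEq 0 j.+1)) g) (Not (Atom (SEq 0 0))) r) <->
      exists2 j, List.In j r & y = e j.
    rewrite /ssat; elim: r => [|j r IH] /=; first by split=> // -[].
    rewrite IH; split=> [[->|[j' h1 ->]]|[j' [->|h1] h2]].
    - by exists j => //; left.
    - by exists j' => //; right.
    - by left.
    - by right; exists j'.
  rewrite /f h /e; elim: s {s0 hs f e h} => [|z s IH] /=; first by split=> // -[].
  rewrite -IH -[1]/(1 + 0) iotaDl; split=> [[j [<-|/List.in_map_iff[j' [<- h1]]]]|].
  - by left.
  - by move=> ->; right; exists j'.
  - move=> [->|[j h1 ->]]; first by exists 0 => //; left.
    by exists j.+1 => //; right; apply/List.in_map_iff; exists j.
have [|y [/fE hy hmin]] := kp_foundation hKP f e.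
  have [z hz] : exists z, List.In z s by case: (s) s0 => // z ? _; exists z; left.
  by exists z; apply/fE.
by have [z /fE hz hzy] := hs y hy; apply: (hmin z).
Qed.

Theorem theorem10 (M : arith_structure) (hM : PA M \/ IE1 M)
    (hns : nonstandard M) :
  (forall (N : Type) (E : relation N),
      countable N -> KP E -> isomorphic_to_submodel E (HF_mem M)) /\
  (forall (G : Type) (R : relation G),
      countable G -> acyclic R -> isomorphic_to_submodel R (HF_mem M)).
Proof.
have hI : IE1 M by case: hM => // -[h1 h2]; split=> // f _; apply: h2.
split=> [N E hN /KP_acyclic hE|G R hG hR]; exact: HF_universal.
Qed.
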